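(* Let $n\ge 3$ and $0\le k\le n-3$ be integers, let $c\in[-1,1]$, and let $u\in L^\infty(\mathbb{M}_c^{n,k})\cap L^{p_n}(\mathbb{M}_c^{n,k})$ be a smooth positive solution of $$L^{G_c}u=\mu\,u^{p_n-1}$$ on $\mathbb{M}_c^{n,k}$ for some constant $\mu\in\mathbb{R}$. Assume that $$2k\,|c|<n(n-k-2).$$ Then $u\in L^2(\mathbb{M}_c^{n,k})$.
   Context: For $n\ge 3$ set $a_n=\frac{4(n-1)}{n-2}$ and $p_n=\frac{2n}{n-2}$. For $c\in\mathbb{R}$ let $\mathbb{H}_c^{k+1}$ be the simply connected, connected, complete Riemannian manifold of dimension $k+1$ and constant sectional curvature $-c^2$, with metric $\eta_c^{k+1}$ (so $\mathbb{H}_0^{k+1}$ is Euclidean space). Let $\mathbb{S}^m$ be the unit sphere $S^m\subset\mathbb{R}^{m+1}$ with its standard round metric $\rho^m$. The model space is the Riemannian product $\mathbb{M}_c^{n,k}=\mathbb{H}_c^{k+1}\times\mathbb{S}^{n-k-1}$ with metric $G_c=\eta_c^{k+1}+\rho^{n-k-1}$. For a Riemannian manifold $(M,g)$ of dimension $n$, the conformal Laplacian is $L^g=a_n\Delta^g+s^g$, where $s^g$ is the scalar curvature and $\Delta^g$ is the Laplace operator with the sign convention that it is non-negative ($\Delta^g=-\mathrm{div}\,\mathrm{grad}$). $L^p$ spaces are taken with respect to the Riemannian volume measure. *)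

(* Defs.v *)
From HB Require Import structures.
From mathcomp Require Import all_boot all_order all_algebra.
From mathcomp Require Import all_classical all_reals all_analysis.
From mathcomp Require Import measurable_realfun.

Set Implicit Arguments.
Unset Strict Implicit.
Unset Printing Implicit Defensive.
Import Order.TTheory GRing.Theory Num.Theory.
Import numFieldNormedType.Exports.

Local Open Scope classical_set_scope.
Local Open Scope ring_scope.

Section borel_row_vectors.
Context {R : realType} (n : nat).

(* As for n.-tuple R, the sigma-algebra generated by the coordinates, that is
   the Borel sigma-algebra of R^n. *)
Definition rV_measurable : set (set 'rV[R]_n) :=
  g_sigma_preimage (fun (i : 'I_n) (x : 'rV[R]_n) => x 0 i).

Let rV_set0 : rV_measurable set0.
Proof. exact: sigma_algebra0. Qed.

Let rV_setC A : rV_measurable A -> rV_measurable (~` A).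
Proof. exact: sigma_algebraC. Qed.

Let rV_bigcup (F : (set 'rV[R]_n)^nat) : (forall i, rV_measurable (F i)) ->
  rV_measurable (\bigcup_i F i).
Proof. exact: sigma_algebra_bigcup. Qed.

HB.instance Definition _ := @isMeasurable.Build default_measure_display
  'rV[R]_n rV_measurable rV_set0 rV_setC rV_bigcup.

Lemma measurable_coord (i : 'I_n) :
  measurable_fun [set: 'rV[R]_n] (fun x : 'rV[R]_n => x 0 i).
Proof.
move=> _ Y mY; rewrite setTI; apply: sub_sigma_algebra => /=.
rewrite -bigcup_seq/=; exists i => /=; first by rewrite mem_index_enum.
by exists Y => //; rewrite setTI.
Qed.

Lemma measurable_fun_rVP d (T : measurableType d) (f : T -> 'rV[R]_n) :
  measurable_fun [set: T] f <->
  forall i, measurable_fun [set: T] (fun x => f x 0 i).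
Proof.
split=> [mf i|mf].
  by apply: (measurableT_comp (measurable_coord i) mf).
move=> _ Y mY; rewrite setTI.
suff : rV_measurable `<=` [set A | measurable (f @^-1` A)] by exact.
apply: smallest_sub.
  split=> /=.
  - by rewrite preimage_set0.
  - move=> A /= mA; rewrite setTD preimage_setC; exact: measurableC.
  - move=> F /= mF; rewrite preimage_bigcup; exact: bigcupT_measurable.
rewrite -bigcup_seq => A [i _ [B mB <-]] /=.
have := mf i measurableT B mB.
by rewrite !setTI.
Qed.

End borel_row_vectors.

Section lebesgue_row_vectors.
Context {R : realType}.

Definition rV_cons n (p : measurableTypeR R * 'rV[R]_n) : 'rV[R]_n.+1 := row_mx p.1%:M p.2.

Fixpoint lebesgue_rV (n : nat) : set 'rV[R]_n -> \bar R :=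
  match n with
  | 0 => \d_(0 : 'rV[R]_0)
  | n.+1 => pushforward ((@lebesgue_measure R) \x @lebesgue_rV n)%E
              (@rV_cons n)
  end.

Lemma measurable_rV_cons n : measurable_fun setT (@rV_cons n).
Proof.
apply/measurable_fun_rVP => i; rewrite /rV_cons.
case: (splitP (i : 'I_(1 + n))) => j ij.
- have -> : (fun x : measurableTypeR R * 'rV[R]_n =>
      (row_mx x.1%:M x.2 : 'rV_(1 + n)) 0 i) = fst.
    apply/funext => x; rewrite (_ : i = lshift n j); last exact/val_inj.
    by rewrite row_mxEl ord1 mxE eqxx mulr1n.
  exact: measurable_fst.
- have -> : (fun x : measurableTypeR R * 'rV[R]_n =>
      (row_mx x.1%:M x.2 : 'rV_(1 + n)) 0 i) = (fun x => x.2 0 j).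
    apply/funext => x; rewrite (_ : i = rshift 1 j); last exact/val_inj.
    by rewrite row_mxEr.
  exact: (measurableT_comp (measurable_coord j) measurable_snd).
Qed.

Definition rV_uncons n (x : 'rV[R]_n.+1) : measurableTypeR R * 'rV[R]_n :=
  (x 0 0, \row_j x 0 (lift 0 j)).

Lemma measurable_rV_uncons n : measurable_fun setT (@rV_uncons n).
Proof.
apply: measurable_fun_pair; first exact: measurable_coord.
apply/measurable_fun_rVP => i.
under eq_fun do rewrite mxE; exact: measurable_coord.
Qed.

Lemma rV_consK n : cancel (@rV_cons n) (@rV_uncons n).
Proof.
move=> [a x]; rewrite /rV_cons /rV_uncons/=; congr pair.
  transitivity ((row_mx a%:M x : 'rV_(1 + n)) 0 (lshift n 0)).
    by congr fun_of_matrix; exact/val_inj.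
  by rewrite row_mxEl mxE eqxx mulr1n.
apply/rowP => j; rewrite mxE.
transitivity ((row_mx a%:M x : 'rV_(1 + n)) 0 (rshift 1 j)).
  by congr fun_of_matrix; exact/val_inj.
by rewrite row_mxEr.
Qed.

Let lebesgue_rV_product_sigma_finite n
    (mu : {sigma_finite_measure set 'rV[R]_n -> \bar R}) :
  sigma_finite setT (@lebesgue_measure R \x mu)%E.
Proof.
have /sigma_finiteP[F [TF ndF Foo]] := sigma_finiteT (@lebesgue_measure R).
have /sigma_finiteP[G [TG ndG Goo]] := sigma_finiteT mu.
exists (fun n => F n `*` G n).
  rewrite -setXTT TF TG predeqE => -[x y]; split.
    move=> [/= [i _ Fnx] [k _ Gky]]; exists (maxn i k) => //; split.
    - by move: x Fnx; exact/subsetPset/ndF/leq_maxl.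
    - by move: y Gky; exact/subsetPset/ndG/leq_maxr.
  by move=> [i _ []/= ? ?]; split; exists i.
move=> k; have [? ?] := Foo k; have [? ?] := Goo k.
split; first exact: measurableX.
by rewrite product_measure1E// lte_mul_pinfty// ge0_fin_numE.
Qed.

Lemma lebesgue_rV_sigma_finite_measure n :
  exists mu : {sigma_finite_measure set 'rV[R]_n -> \bar R},
    (mu : set _ -> \bar R) = @lebesgue_rV n.
Proof.
elim: n => [|n [mu IH]].
  by exists (\d_(0 : 'rV[R]_0)).
rewrite /= -IH.
pose nu := [the {measure set _ -> \bar R} of (@lebesgue_measure R \x mu)%E].
pose c := measure_function_pushforward__canonical__measure_function_Measure
  nu (@measurable_rV_cons n).
have sc : sigma_finite setT c.
  have [F FT Ffin] := lebesgue_rV_product_sigma_finite mu.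
  exists (fun i => @rV_uncons n @^-1` F i).
    by rewrite -preimage_bigcup -FT preimage_setT.
  move=> i; have [mF nuF] := Ffin i; split.
    by rewrite -[X in measurable X]setTI; exact: measurable_rV_uncons.
  rewrite /c/= /pushforward -comp_preimage.
  rewrite (_ : rV_uncons (n:=n) \o _ = id)//.
  by apply/funext => x /=; rewrite rV_consK.
pose sfm : {sigma_finite_measure set 'rV[R]_n.+1 -> \bar R} :=
  HB.pack_for {sigma_finite_measure set 'rV[R]_n.+1 -> \bar R}
    (Measure.sort c) (Measure.class c)
    (Measure_isSigmaFinite.Build _ _ _ c sc).
by exists sfm.
Qed.

Let lebesgue_rV0 n : @lebesgue_rV n set0 = 0%E.
Proof. by have [mu <-] := lebesgue_rV_sigma_finite_measure n. Qed.

Let lebesgue_rV_ge0 n A : (0 <= @lebesgue_rV n A)%E.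
Proof. by have [mu <-] := lebesgue_rV_sigma_finite_measure n. Qed.

Let lebesgue_rV_semi_sigma_additive n : semi_sigma_additive (@lebesgue_rV n).
Proof.
have [mu <-] := lebesgue_rV_sigma_finite_measure n.
exact: measure_semi_sigma_additive.
Qed.

HB.instance Definition _ n := isMeasure.Build _ _ _ (@lebesgue_rV n)
  (@lebesgue_rV0 n) (@lebesgue_rV_ge0 n) (@lebesgue_rV_semi_sigma_additive n).

Let lebesgue_rV_sigma_finite n : sigma_finite setT (@lebesgue_rV n).
Proof.
have [mu <-] := lebesgue_rV_sigma_finite_measure n.
exact: sigma_finiteT.
Qed.

HB.instance Definition _ n := Measure_isSigmaFinite.Build _ _ _
  (@lebesgue_rV n) (@lebesgue_rV_sigma_finite n).

End lebesgue_row_vectors.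

Section coordinates.
Context {R : realType}.

Definition yamabe_coef (n : nat) : R := 4 * (n%:R - 1) / (n%:R - 2).

Definition yamabe_exp (n : nat) : R := 2 * n%:R / (n%:R - 2).

Definition partial d (i : 'I_d) (f : 'rV[R]_d -> R) : 'rV[R]_d -> R :=
  'D_(delta_mx 0 i) f.

Definition sqnorm d (x : 'rV[R]_d) : R := \sum_i x 0 i ^+ 2.

(* D is meant to be open: every iterated partial derivative of f exists and is
   continuous on D. *)
Definition smooth_on d (D : set 'rV[R]_d) (f : 'rV[R]_d -> R) : Prop :=
  forall (s : seq 'I_d) (x : 'rV[R]_d), D x ->
    {for x, continuous (foldr (@partial d) f s)} /\
    forall i : 'I_d, derivable (foldr (@partial d) f s) x (delta_mx 0 i).

End coordinates.

(* Riemannian geometry of a metric on an open subset of R^d, g x being the Gram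
   matrix of the coordinate vector fields at x. *)
Section riemannian_coordinates.
Context {R : realType} {d : nat}.
Variable g : 'rV[R]_d -> 'M[R]_d.
Implicit Types (x : 'rV[R]_d) (f : 'rV[R]_d -> R) (i j l : 'I_d).

Definition volume_density x : R := Num.sqrt (\det (g x)).

(* Gamma^l_ij *)
Definition christoffel l i j x : R :=
  2^-1 * \sum_r invmx (g x) l r *
    (partial i (fun y => g y j r) x + partial j (fun y => g y i r) x
     - partial r (fun y => g y i j) x).

(* Sign convention: the round spheres have positive Ricci curvature. *)
Definition ricci i j x : R :=
  \sum_l (partial l (christoffel l i j) x - partial j (christoffel l i l) x)
  + \sum_l \sum_r (christoffel l l r x * christoffel r i j x
                   - christoffel l j r x * christoffel r i l x).

Definition scalar_curvature x : R :=
  \sum_i \sum_j invmx (g x) i j * ricci i j x.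

(* - div grad f *)
Definition laplacian f x : R :=
  - (volume_density x)^-1 * \sum_i partial i (fun y =>
      volume_density y * \sum_j invmx (g y) i j * partial j f y) x.

Definition conformal_laplacian f x : R :=
  yamabe_coef d * laplacian f x + scalar_curvature x * f x.

End riemannian_coordinates.

Section model_space.
Context {R : realType}.

(* The space form of curvature - c ^ 2 in Riemann's conformal coordinates: for
   c != 0 the Poincare ball of radius 2 / |c|, for c = 0 the Euclidean space. *)
Definition hyp_dom (c : R) d : set 'rV[R]_d :=
  [set x | c ^+ 2 * sqnorm x < 4].

Definition hyp_metric (c : R) d (x : 'rV[R]_d) : 'M[R]_d :=
  ((1 - c ^+ 2 * sqnorm x / 4) ^- 2)%:M.

Definition unit_sphere m : set 'rV[R]_(m + 1) := [set y | sqnorm y = 1].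

(* Inverse stereographic projection, missing the pole (-1) ^+ b of the last
   coordinate axis; the images of stereo false and stereo true cover the
   sphere. *)
Definition stereo (b : bool) m (y : 'rV[R]_m) : 'rV[R]_(m + 1) :=
  row_mx ((2 / (1 + sqnorm y)) *: y)
    ((-1) ^+ b * ((sqnorm y - 1) / (1 + sqnorm y)))%:M.

(* First fundamental form: the pullback of the Euclidean metric. *)
Definition induced_metric d e (F : 'rV[R]_d -> 'rV[R]_e) (y : 'rV[R]_d) :
    'M[R]_d :=
  \matrix_(i, j) \sum_l partial i (fun z => F z 0 l) y *
                        partial j (fun z => F z 0 l) y.

Variables (c : R) (k m : nat).

(* H_c^(k+1) x S^m as a subset of R^(k+1) x R^(m+1). *)
Definition model : set ('rV[R]_k.+1 * 'rV[R]_(m + 1)) :=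
  [set p | hyp_dom c p.1 /\ unit_sphere p.2].

(* In the charts the dimension of model is k + 1 + m, that is n when
   m = n - k - 1. *)
Definition chart_dom : set 'rV[R]_(k.+1 + m) :=
  [set z | hyp_dom c (lsubmx z)].

Definition chart (b : bool) (z : 'rV[R]_(k.+1 + m)) :
    'rV[R]_k.+1 * 'rV[R]_(m + 1) :=
  (lsubmx z, stereo b (rsubmx z)).

Definition chart_metric (b : bool) (z : 'rV[R]_(k.+1 + m)) :
    'M[R]_(k.+1 + m) :=
  block_mx (hyp_metric c (lsubmx z)) 0
           0 (induced_metric (@stereo b m) (rsubmx z)).

(* The Riemannian volume of model, as a measure on the ambient space which is
   concentrated on model. One chart suffices: it misses only the points over
   one pole of the sphere, which form a null set. *)
Definition model_volume : set ('rV[R]_k.+1 * 'rV[R]_(m + 1)) -> \bar R :=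
  fun A => (\int[@lebesgue_rV R (k.+1 + m)]_(
      z in chart_dom `&` chart false @^-1` A)
    (volume_density (chart_metric false) z)%:E)%E.

End model_space.
Arguments model {R} c k m.
Arguments chart_dom {R} c k m.
Arguments chart {R k m} b z.
Arguments chart_metric {R} c {k m} b z.
Arguments model_volume {R} c k m.

Section model_volume_is_measure.
Context {R : realType}.
Variables (c : R) (k m : nat).

Let nice d (f : 'rV[R]_d -> R) :=
  [/\ measurable_fun setT f, forall x v, derivable f x v &
    forall v, measurable_fun setT ('D_v f)].

Let measurable_inv_ge0 d (T : measurableType d) (f : T -> R) :
  (forall x, 0 <= f x) -> measurable_fun setT f ->
  measurable_fun setT (fun x => (f x)^-1).
Proof.
move=> f0 mf; rewrite (_ : (fun _ => _) = (fun x => f x `^ (-1))).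
  exact: (measurableT_comp (measurable_powR _) mf).
by apply/funext => x; rewrite powR_inv1.
Qed.

Let measurable_sqrt d (T : measurableType d) (f : T -> R) :
  measurable_fun setT f ->
  measurable_fun setT (fun x => Num.sqrt (f x)).
Proof.
move=> mf; apply: measurableT_comp mf.
apply: continuous_measurable_fun; exact: sqrt_continuous.
Qed.

Let nice_cst d a : @nice d (cst a).
Proof.
split=> // v.
by rewrite (_ : 'D_v _ = cst 0)//; apply/funext => x; exact: derive_cst.
Qed.

Let nice_coord d i : @nice d (fun y => y 0 i).
Proof.
have H x v : is_derive x v (fun y : 'rV[R]_d => y 0 i) (v 0 i).
  have dx : derivable (id : 'rV[R]_d -> 'rV[R]_d) x v by exact: derivable_id.
  split; first by move/derivable_mxP : dx; exact.
  have := derive_mx dx; rewrite derive_id => /matrixP/(_ 0 i).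
  by rewrite mxE => <-.
split.
- exact: measurable_coord.
- by move=> x v; have [] := H x v.
- move=> v; rewrite (_ : 'D_v _ = cst (v 0 i))//.
  by apply/funext => x; have [] := H x v.
Qed.

Let niceD d (f g : 'rV[R]_d -> R) : nice f -> nice g -> nice (fun x => f x + g x).
Proof.
move=> [mf df mDf] [mg dg mDg]; split.
- exact: measurable_funD.
- by move=> x v; exact: derivableD.
- move=> v; rewrite (_ : 'D_v _ = fun x => 'D_v f x + 'D_v g x).
    exact: measurable_funD.
  by apply/funext => x; rewrite (deriveD (df x v) (dg x v)).
Qed.

Let niceM d (f g : 'rV[R]_d -> R) : nice f -> nice g -> nice (fun x => f x * g x).
Proof.
move=> [mf df mDf] [mg dg mDg]; split.
- exact: measurable_funM.
- by move=> x v; exact: derivableM.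
- move=> v; rewrite (_ : 'D_v _ = fun x => f x * 'D_v g x + g x * 'D_v f x).
    by apply: measurable_funD; exact: measurable_funM.
  by apply/funext => x; rewrite (deriveM (df x v) (dg x v)).
Qed.

Let niceV d (f : 'rV[R]_d -> R) : (forall x, 0 < f x) -> nice f ->
  nice (fun x => (f x)^-1).
Proof.
move=> f0 [mf df mDf]; split.
- by apply: measurable_inv_ge0 => // x; exact: ltW.
- by move=> x v; apply: derivableV => //; rewrite gt_eqF.
- move=> v; rewrite (_ : 'D_v _ = fun x => - (f x ^+ 2)^-1 * 'D_v f x).
    apply: measurable_funM => //; apply: measurableT_comp => //.
    apply: measurable_inv_ge0 => [x|]; first exact: sqr_ge0.
    exact: measurable_funX.
  by apply/funext => x; rewrite deriveV// gt_eqF.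
Qed.

Let nice_sum d e (f : 'I_e -> 'rV[R]_d -> R) : (forall i, nice (f i)) ->
  nice (fun x => \sum_i f i x).
Proof.
move=> nf; elim: (index_enum 'I_e) => [|i s IH].
  under eq_fun do rewrite big_nil; exact: nice_cst.
by under eq_fun do rewrite big_cons; exact: niceD.
Qed.

Let nice_sqnorm d : nice (@sqnorm R d).
Proof. by apply: nice_sum => i; exact: niceM. Qed.

Let sqnorm_ge0 d (x : 'rV[R]_d) : 0 <= sqnorm x.
Proof. by apply: sumr_ge0 => i _; exact: sqr_ge0. Qed.

Let nice_inv1D d : nice (fun y : 'rV[R]_d => (1 + sqnorm y)^-1).
Proof.
apply: niceV; last by apply: niceD => //; exact: nice_cst.
by move=> x; rewrite ltr_pwDl.
Qed.

Let nice_stereo b d l : nice (fun y : 'rV[R]_d => stereo b y 0 l).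
Proof.
rewrite /stereo; case: (splitP l) => j lj.
- rewrite (_ : (fun _ => _) = fun y => 2 * (1 + sqnorm y)^-1 * y 0 j).
    by apply: niceM => //; apply: niceM => //; exact: nice_cst.
  apply/funext => y; rewrite (_ : l = lshift 1 j); last exact/val_inj.
  by rewrite row_mxEl mxE.
- rewrite (_ : (fun _ => _) = fun y =>
      (-1) ^+ b * ((sqnorm y + -1) * (1 + sqnorm y)^-1)).
    apply: niceM; first exact: nice_cst.
    by apply: niceM => //; apply: niceD => //; exact: nice_cst.
  apply/funext => y; rewrite (_ : l = rshift d j); last exact/val_inj.
  by rewrite row_mxEr !ord1 mxE eqxx mulr1n.
Qed.

Let measurable_lsubmx d e : measurable_fun setT (@lsubmx R 1 d e).
Proof.
apply/measurable_fun_rVP => i; under eq_fun do rewrite mxE.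
exact: measurable_coord.
Qed.

Let measurable_rsubmx d e : measurable_fun setT (@rsubmx R 1 d e).
Proof.
apply/measurable_fun_rVP => i; under eq_fun do rewrite mxE.
exact: measurable_coord.
Qed.

Lemma measurable_chart b : measurable_fun setT (@chart R k m b).
Proof.
apply: measurable_fun_pair; first exact: measurable_lsubmx.
apply/measurable_fun_rVP => i.
have [mst _ _] := @nice_stereo b m i.
exact: (measurableT_comp mst (@measurable_rsubmx _ _)).
Qed.

Let measurable_sqnorm d : measurable_fun setT (@sqnorm R d).
Proof. by have [] := @nice_sqnorm d. Qed.

Lemma measurable_chart_dom : measurable (chart_dom c k m).
Proof.
rewrite -[X in measurable X]setTI.
have mf : measurable_fun setT
    (fun z : 'rV[R]_(k.+1 + m) => c ^+ 2 * sqnorm (lsubmx z)).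
  apply: measurable_funM => //.
  exact: (measurableT_comp (@measurable_sqnorm _) (@measurable_lsubmx _ _)).
rewrite (_ : chart_dom c k m = (fun z : 'rV[R]_(k.+1 + m) =>
    c ^+ 2 * sqnorm (lsubmx z)) @^-1` `]-oo, 4[).
  by apply: mf => //; exact: measurable_itv.
by apply/seteqP; split=> z /=; rewrite in_itv.
Qed.

Let measurable_induced_metric b d i j :
  measurable_fun setT (fun y => induced_metric (@stereo R b d) y i j).
Proof.
under eq_fun do rewrite mxE.
apply: measurable_sum => l; have [_ _ mD] := @nice_stereo b d l.
apply: measurable_funM; first exact: (mD (delta_mx 0 i)).
exact: (mD (delta_mx 0 j)).
Qed.

Let measurable_hyp_metric d i j :
  measurable_fun setT (fun x => @hyp_metric R c d x i j).
Proof.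
under eq_fun do rewrite mxE.
case: (i == j) => /=; last exact: measurable_cst.
apply: measurable_inv_ge0 => [x|]; first exact: sqr_ge0.
apply: measurable_funX; apply: measurable_funB => //.
apply: measurable_funM; last exact: measurable_cst.
by apply: measurable_funM; [exact: measurable_cst|exact: measurable_sqnorm].
Qed.

Let measurable_chart_metric b i j :
  measurable_fun setT (fun z => @chart_metric R c k m b z i j).
Proof.
rewrite /chart_metric; case: (splitP i) => i' ii; case: (splitP j) => j' jj.
- have -> : i = lshift m i' by exact/val_inj.
  have -> : j = lshift m j' by exact/val_inj.
  under eq_fun do rewrite block_mxEul.
  exact: (measurableT_comp (@measurable_hyp_metric _ i' j')
    (@measurable_lsubmx _ _)).
- have -> : i = lshift m i' by exact/val_inj.
  have -> : j = rshift k.+1 j' by exact/val_inj.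
  under eq_fun do rewrite block_mxEur mxE; exact: measurable_cst.
- have -> : i = rshift k.+1 i' by exact/val_inj.
  have -> : j = lshift m j' by exact/val_inj.
  under eq_fun do rewrite block_mxEdl mxE; exact: measurable_cst.
- have -> : i = rshift k.+1 i' by exact/val_inj.
  have -> : j = rshift k.+1 j' by exact/val_inj.
  under eq_fun do rewrite block_mxEdr.
  exact: (measurableT_comp (@measurable_induced_metric b _ i' j')
    (@measurable_rsubmx _ _)).
Qed.

Lemma measurable_volume_density b :
  measurable_fun setT (volume_density (@chart_metric R c k m b)).
Proof.
apply: measurable_sqrt; apply: measurable_sum => s.
by apply: measurable_funM => //; apply: measurable_prod => i _.
Qed.

Let model_volume0 : model_volume c k m set0 = 0%E.
Proof. by rewrite /model_volume preimage_set0 setI0 integral_set0. Qed.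

Let model_volume_ge0 A : (0 <= model_volume c k m A)%E.
Proof. by apply: integral_ge0 => z _; rewrite lee_fin sqrtr_ge0. Qed.

Let model_volume_semi_sigma_additive :
  semi_sigma_additive (model_volume c k m).
Proof.
move=> F mF tF mUF; rewrite /model_volume preimage_bigcup setI_bigcupr.
have mpre A : measurable A ->
    measurable (chart_dom c k m `&` chart false @^-1` A).
  move=> mA; apply: measurableI; first exact: measurable_chart_dom.
  by rewrite -[X in measurable X]setTI; exact: measurable_chart.
apply: semi_sigma_additive_nng_induced.
- by apply/measurable_EFinP; exact: measurable_volume_density.
- by move=> z; rewrite lee_fin sqrtr_ge0.
- by move=> n; exact: mpre.
- apply/trivIsetP => /= i j _ _ ij; rewrite setIACA -preimage_setI.
  by move/trivIsetP : tF => /(_ _ _ _ _ ij) ->//; rewrite preimage_set0 setI0.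
- by rewrite -setI_bigcupr -preimage_bigcup; exact: mpre.
Qed.

HB.instance Definition _ := isMeasure.Build _ _ _ (model_volume c k m)
  model_volume0 model_volume_ge0 model_volume_semi_sigma_additive.

End model_volume_is_measure.

(* Main.v *)
(* Test the equation against P u, where the weight P = A B is the product of a
   radial weight A on the hyperbolic factor, decaying like exp (- 2 tau q) with
   |grad q|^2 <= c^2 + eta, and of a cutoff B near the pole of the sphere missed by
   the stereographic chart.  A radial field Y on the hyperbolic factor with
   div Y - |Y|^2 >= k^2 c^2 / 4 supplies, after completing a square, the bottom of
   its spectrum, and leaves
     kappa * int P u^2 <= |mu| int u^p + (cutoff errors),
     kappa = s + a k^2 c^2 / 4 - a (c^2 + eta) tau^2 (up to small corrections).
   Take tau = b / n.  The volume of hyperbolic balls grows like exp (k q), so for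
   b > k the pointwise bound u^2 exp (- 2 tau q) <= u^p + exp (- b q) makes the
   weighted square of u integrable; this kills the radial cutoff error.  The cutoff
   at the pole is logarithmic; its energy tends to 0 since u is bounded and the
   sphere has dimension m >= 2.  For b close to k, kappa > 0 follows from
   2 k |c| < n (n - k - 2).  As eta -> 0 the weights increase to 1, and Fatou's
   lemma bounds int u^2. *)
Require Import Defs.
From mathcomp Require Import all_boot all_order all_algebra.
From mathcomp Require Import all_classical all_reals all_analysis.
From mathcomp Require Import measurable_realfun ess_sup_inf ring lra zify.
Import Order.TTheory GRing.Theory Num.Theory.
Import numFieldNormedType.Exports.
Local Open Scope classical_set_scope.
Local Open Scope ring_scope.
Set Implicit Arguments.
Unset Strict Implicit.
Unset Printing Implicit Defensive.

(** * Divergence theorem on row vectors *)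

(** Everything happens in the single chart [chart false], over flat Lebesgue measure, and rests on
    one tool: a compactly supported C1 field has total divergence zero. The volume and capacity
    estimates use it too. Instead of computing in polar coordinates, they choose a radial weight
    whose flat divergence absorbs the integrand outside a compact set.

    The obstacle is that int u^2 may not be assumed finite while the errors are removed. Hence
    [kappa] is fixed before any limit is taken, and the final bound |mu| int u^p + 2 depends neither
    on eta nor on the cutoff lengths.

    The radial function is q = ln (1 + eta Q) with Q = |x|^2 / F, F being the conformal factor of
    the ball. It is smooth at the centre, unlike the distance, and it exhausts the ball. For c != 0
    its slope at infinity is |c| whatever eta is, yet q tends to 0 pointwise with eta, so one family
    of weights both decays fast enough and converges to 1. *)

Section rV_cons_coordinates.
Context {R : realType}.

Lemma rV_cons0 d (t : R) (y : 'rV[R]_d) : rV_cons (t, y) 0 0 = t.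
Proof. by have /(congr1 fst) := rV_consK (t, y). Qed.

Lemma rV_consS d (t : R) (y : 'rV[R]_d) i : rV_cons (t, y) 0 (lift 0 i) = y 0 i.
Proof.
by have /(congr1 snd)/rowP/(_ i) := rV_consK (t, y); rewrite mxE.
Qed.

End rV_cons_coordinates.

Section borel.
Context {R : realType}.

(** The sigma-algebra is generated by the coordinates, so an open set has to be written as a
    countable union of boxes: those with rational centre and radius that it contains. *)
Lemma open_rV_measurable d (U : set 'rV[R]_d) : open U -> measurable U.
Proof.
move=> oU.
pose B (p : 'rV[rat]_d * rat) := [set y : 'rV[R]_d |
  forall i, `|ratr (p.1 0 i) - y 0 i| < ratr p.2].
have mB p : measurable (B p).
  rewrite (_ : B p = \big[setI/setT]_(i < d)
      ((fun y : 'rV[R]_d => y 0 i) @^-1` (ball (ratr (p.1 0 i) : R) (ratr p.2 : R)))).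
    apply: bigsetI_measurable => i _.
    by rewrite -[X in measurable X]setTI; apply: measurable_coord => //;
      exact: measurable_ball.
  rewrite -bigcap_seq; apply/seteqP; split => y /= h.
    by move=> i _; apply: h.
  by move=> i; apply: (h i); rewrite /= mem_index_enum.
rewrite (_ : U = \bigcup_p (if `[< B p `<=` U >] then B p else set0)).
  apply: countable_bigcupT_measurable => // p; case: ifP => // _; exact: mB.
apply/seteqP; split => [x Ux|x [p _]]; last by case: asboolP => // + /=; apply.
have /nbhs_ballP[e /= e0 eU] : nbhs x U by exact: open_nbhs_nbhs.
have [r] : exists r : rat, ratr r \in `]0, (e / 2)[.
  by apply: rat_in_itvoo; rewrite divr_gt0.
rewrite in_itv/= => /andP[r0 re].
have qP i : exists q : rat, `|ratr q - x 0 i| < ratr r.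
  have [q] : exists q : rat, ratr q \in `](x 0 i - ratr r), (x 0 i + ratr r)[.
    by apply: rat_in_itvoo; lra.
  by rewrite in_itv/= => /andP[? ?]; exists q; rewrite ltr_norml; lra.
have [q qE] := choice qP.
exists (\row_i q i, r) => //.
have Bx : B (\row_i q i, r) x by move=> i /=; rewrite mxE.
rewrite asboolT// => y By; apply: eU; split => // i j.
rewrite ord1; have := By j; have := Bx j; rewrite /ball/= mxE.
set a := ratr _; move: (x 0 j) (y 0 j) => s t h1 h2.
rewrite (_ : s - t = (a - t) - (a - s)); last by ring.
by rewrite (le_lt_trans (ler_normB _ _))//; lra.
Qed.

Lemma continuous_rV_measurable d (D : set 'rV[R]_d) (f : 'rV[R]_d -> R) :
  open D -> (forall x, D x -> {for x, continuous f}) -> measurable_fun D f.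
Proof.
move=> oD cf.
move=> mD; apply: (measurability _ (RGenOInfty.measurableE R)) => //.
move=> _ [_ [a ->] <-]; apply: open_rV_measurable.
rewrite openE => x [Dx fx]; apply: filterI; first exact: open_nbhs_nbhs.
apply: (cf x Dx); apply: open_nbhs_nbhs; split => //; exact: interval_open.
Qed.

Definition box d (M : R) : set 'rV[R]_d := [set z | forall i, `|z 0 i| <= M].

Lemma closed_box d M : closed (@box d M).
Proof.
rewrite (_ : box M = \bigcap_(i in [set: 'I_d])
    ((fun z : 'rV[R]_d => z 0 i) @^-1` [set t | `|t| <= M])).
  apply: closed_bigI => i _; apply: closed_comp => [z _|].
    exact: coord_continuous.
  rewrite (_ : [set t | _] = [set t : R | - M <= t] `&` [set t | t <= M]).
    by apply: closedI; [exact: closed_ge|exact: closed_le].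
  by apply/seteqP; split => t /=; rewrite ler_norml => /andP.
by apply/seteqP; split => z h i; [move=> _|]; exact: (h i).
Qed.

Lemma compact_box d M : compact (@box d M).
Proof.
apply: bounded_closed_compact; last exact: closed_box.
exists `|M|; split=> [|N MN z Bz]; first exact: num_real.
rewrite /= [leLHS]/Num.Def.normr/= mx_normrE bigmax_le//= => [|[i j] _].
  by rewrite (le_trans (normr_ge0 M))// ltW.
by rewrite ord1 (le_trans (Bz j))// (le_trans (ler_norm M))// ltW.
Qed.

Lemma continuous_box_bounded d M (f : 'rV[R]_d -> R) :
  continuous f -> exists C, forall z, box M z -> `|f z| <= C.
Proof.
move=> cf; have : compact (f @` box M).
  by apply: continuous_compact; [exact: continuous_subspaceT|exact: compact_box].
move=> /compact_bounded[C [_ hC]]; exists (C + 1) => z Bz.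
by apply: (hC (C + 1)); [rewrite ltrDl|exists z].
Qed.

Lemma measurable_box d M : measurable (@box d M).
Proof.
rewrite -[box M]setCK; apply: measurableC; apply: open_rV_measurable.
exact/closed_openC/closed_box.
Qed.

Lemma lebesgue_box d M : (lebesgue_rV (@box d M) < +oo)%E.
Proof.
elim: d => [|d IH]; first by rewrite /= diracE; case: (_ \in _); exact: ltry.
rewrite /= /pushforward (_ : _ @^-1` _ = `[- M, M]%classic `*` box M).
  rewrite product_measure1E => [||]; last 2 first.
  - exact: measurable_itv.
  - exact: measurable_box.
  rewrite lte_mul_pinfty//= lebesgue_measure_itv/= lte_fin; case: ifP => // _.
apply/seteqP; split => [[t y] /= h|[t y] /= [+ h] i].
  split; first by have := h 0; rewrite (rV_cons0 t y) in_itv/= ler_norml.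
  by move=> i; have := h (lift 0 i); rewrite rV_consS.
rewrite in_itv/= -ler_norml => tM.
by case: (unliftP 0 i) => [j ->|->]; rewrite ?rV_cons0 ?rV_consS.
Qed.

Lemma box_integrable d M (g : 'rV[R]_d -> R) : continuous g ->
  (forall z, ~ box M z -> g z = 0) ->
  (@lebesgue_rV R d).-integrable [set: 'rV[R]_d] (EFin \o g).
Proof.
move=> cg g0; have mg : measurable_fun setT g.
  by apply: continuous_rV_measurable; [exact: openT|move=> x _; exact: cg].
have [C hC] := @continuous_box_bounded _ M _ cg.
have : (@lebesgue_rV R d).-integrable (box M) (EFin \o g).
  apply: measurable_bounded_integrable.
  - exact: measurable_box.
  - exact: lebesgue_box.
  - exact: measurable_funTS.
  - exists C; split=> [|N CN z Bz]; first exact: num_real.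
    by rewrite /= (le_trans (hC z Bz))// ltW.
move=> /(integrable_mkcond _ (@measurable_box d M)) h.
apply: (eq_integrable measurableT _ _ _ h).
move=> z _; rewrite patchE /=; case: ifPn => // /negP; rewrite inE => zB.
by rewrite g0.
Qed.

Lemma partial_out_box d M i (f : 'rV[R]_d -> R) :
  (forall z, ~ box M z -> f z = 0) -> forall z, ~ box M z -> partial i f z = 0.
Proof.
move=> f0 z zB; rewrite /partial (@near_eq_derive _ _ _ _ (cst 0)).
  exact: derive_cst.
near=> y; apply: f0; near: y.
have : open_nbhs z (~` box M) by split => //; exact/closed_openC/closed_box.
exact: open_nbhs_nbhs.
Unshelve. all: by end_near. Qed.

Lemma integral_derive_eq0 M (f : R -> R) : (forall t, derivable f t 1) ->
  continuous ('D_1 f) -> (forall t, M < `|t| -> f t = 0) ->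
  (\int[@lebesgue_measure R]_t ('D_1 f t)%:E = 0)%E.
Proof.
move=> df cf f0; pose N := `|M| + 1.
have N0 : 0 < N by rewrite ltr_wpDl.
have MN : M < N by rewrite (le_lt_trans (ler_norm M))// ltrDl.
have D0 t : N <= `|t| -> 'D_1 f t = 0.
  move=> Nt; rewrite (@near_eq_derive _ _ _ _ (cst 0)); first exact: derive_cst.
  near=> s; apply: f0; near: s.
  have := @norm_continuous _ _ t; move/cvgr_gt; apply.
  exact: lt_le_trans Nt.
have -> : (fun t => ('D_1 f t)%:E) =
    (fun t => ('D_1 f t)%:E) \_ `[- N, N]%classic.
  apply/funext => t; rewrite patchE; case: ifPn => //.
  rewrite mem_setE in_itv/= -ler_norml -ltNge => /ltW Nt.
  by rewrite D0.
rewrite -integral_mkcond (@continuous_FTC2 _ _ f).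
- by rewrite !f0 ?subee// ?normrN gtr0_norm.
- by rewrite gtrN.
- exact: continuous_subspaceT.
- have cff : continuous f.
    by move=> t; apply: differentiable_continuous; apply/derivable1_diffP.
  split=> [t _|//|]; first exact: df.
  - exact/cvg_at_right_filter/cff.
  - exact/cvg_at_left_filter/cff.
- by move=> t _; rewrite derive1E.
Unshelve. all: by end_near. Qed.

(** Both difference quotients are the same function of [h]. It serves for coordinate slices in
    Fubini's theorem and for lines in the chain rule. *)
Lemma derive_along (V W : normedModType R) (F : V -> W) (f : W -> R) x v w :
  (forall h, F (h *: v + x) = h *: w + F x) ->
  (derivable (f \o F) x v <-> derivable f (F x) w) /\
  'D_v (f \o F) x = 'D_w f (F x).
Proof.
move=> FE; have E : (fun h => h^-1 *: (((f \o F) \o shift x) (h *: v) - (f \o F) x))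
    = (fun h => h^-1 *: ((f \o shift (F x)) (h *: w) - f (F x))).
  by apply/funext => h /=; rewrite FE.
by rewrite /derivable /derive E.
Qed.

Lemma continuous_rV (T : topologicalType) d (F : T -> 'rV[R]_d) :
  (forall i, continuous (fun x => F x 0 i)) -> continuous F.
Proof.
move=> cF x A [P nP PA].
have : \forall y \near x, forall i, P 0 i (F y 0 i).
  by apply: filter_forall => i; exact: (cF i x _ (nP 0 i)).
by apply: filterS => y Py; apply: PA => i j; rewrite ord1.
Qed.

Lemma continuous_rV_consl d (y : 'rV[R]_d) :
  continuous (fun t : R => rV_cons (t, y) : 'rV[R]_d.+1).
Proof.
apply: continuous_rV => i; case: (unliftP 0 i) => [j ->|->].
  by under eq_fun do rewrite rV_consS; exact: cst_continuous.
by under eq_fun do rewrite rV_cons0; move=> x; exact: cvg_id.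
Qed.

Lemma continuous_rV_consr d (t : R) :
  continuous (fun y : 'rV[R]_d => rV_cons (t, y) : 'rV[R]_d.+1).
Proof.
apply: continuous_rV => i; case: (unliftP 0 i) => [j ->|->].
  by under eq_fun do rewrite rV_consS; exact: coord_continuous.
by under eq_fun do rewrite rV_cons0; exact: cst_continuous.
Qed.

Lemma integral_lebesgue_rVS d (g : 'rV[R]_d.+1 -> R) :
  (@lebesgue_rV R d.+1).-integrable setT (EFin \o g) ->
  (lebesgue_measure \x @lebesgue_rV R d)%E.-integrable setT
     (EFin \o g \o @rV_cons R d) /\
  (\int[@lebesgue_rV R d.+1]_z (g z)%:E =
   \int[lebesgue_measure \x @lebesgue_rV R d]_p (g (rV_cons p))%:E)%E.
Proof.
move=> ig; have mg := measurable_int _ ig.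
pose pf := measure_function_pushforward__canonical__measure_function_Measure
  [the {measure set _ -> \bar R} of (lebesgue_measure \x @lebesgue_rV R d)%E]
  (@measurable_rV_cons R d).
have ip : (lebesgue_measure \x @lebesgue_rV R d)%E.-integrable setT
     (EFin \o g \o @rV_cons R d).
  apply/integrableP; split.
    by apply: measurableT_comp mg _; exact: measurable_rV_cons.
  have /integrableP[_] := ig; apply: le_lt_trans.
  rewrite [leRHS](eq_measure_integral pf); last by [].
  rewrite ge0_integral_pushforward//; last by apply: measurableT_comp.
  exact: measurable_rV_cons.
split => //.
rewrite [LHS](eq_measure_integral pf); last by [].
by rewrite integral_pushforward//; exact: measurable_rV_cons.
Qed.

Lemma add_deltaE d (h : R) (l i : 'I_d) (w : 'rV[R]_d) :
  (h *: delta_mx 0 l + w) 0 i = h * (i == l)%:R + w 0 i.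
Proof. by rewrite !mxE. Qed.

Lemma rV_consD0 d (t h : R) (y : 'rV[R]_d) :
  rV_cons (h *: 1 + t, y) = h *: delta_mx 0 0 + rV_cons (t, y).
Proof.
apply/rowP => i; rewrite add_deltaE.
case: (unliftP 0 i) => [j ->|->]; rewrite ?rV_cons0 ?rV_consS /= ?eqxx//.
by rewrite mulr0 add0r.
Qed.

Lemma rV_consDS d (t h : R) (y : 'rV[R]_d) j :
  rV_cons (t, h *: delta_mx 0 j + y) =
  h *: delta_mx 0 (lift 0 j) + rV_cons (t, y).
Proof.
apply/rowP => i; rewrite add_deltaE.
case: (unliftP 0 i) => [l ->|->].
  by rewrite !rV_consS add_deltaE (inj_eq (@lift_inj _ _)).
by rewrite !rV_cons0 /= mulr0 add0r.
Qed.

(** Induction on the dimension, with the order of integration chosen so that the inner integral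
    already vanishes: by the induction hypothesis on a slice if [i] is not the first coordinate, by
    the fundamental theorem of calculus on a line if it is. *)
Lemma integral_partial_eq0 d M (i : 'I_d) (f : 'rV[R]_d -> R) :
  (forall z, derivable f z (delta_mx 0 i)) -> continuous (partial i f) ->
  (forall z, ~ box M z -> f z = 0) ->
  (\int[@lebesgue_rV R d]_z (partial i f z)%:E = 0)%E.
Proof.
elim: d i f => [[]//|d IH] i f df cf f0.
have ig := box_integrable cf (partial_out_box i f0).
have [ip ->] := integral_lebesgue_rVS ig.
have boxP t y : ~ (`|t| <= M /\ box M y) -> f (rV_cons (t, y)) = 0.
  move=> h; apply: f0 => hb; apply: h; split.
    by have := hb 0; rewrite rV_cons0.
  by move=> l; have := hb (lift 0 l); rewrite rV_consS.
have [[j ij]|i0] : (exists j : 'I_d, i = lift 0 j) \/ i = 0.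
  by case: (unliftP 0 i) => [j ->|->]; [left; exists j|right].
- rewrite -(integral12_prod_meas1 ip)/=.
  rewrite (eq_integral (cst 0%E)) ?integral0// => t _ /=.
  have dA y := @derive_along _ _ (fun y => rV_cons (t, y)) f y _ _
    (fun h => rV_consDS t h y j).
  rewrite /fubini_F/= (eq_integral (fun y =>
      (partial j (f \o (fun y => rV_cons (t, y))) y)%:E)); last first.
    by move=> y _; rewrite /partial (dA y).2 ij.
  apply: IH.
  + by move=> y; apply/(dA y).1; rewrite -ij.
  + rewrite (_ : partial j _ = partial i f \o (fun y => rV_cons (t, y))).
      move=> y; apply: continuous_comp; last exact: cf.
      exact: continuous_rV_consr.
    by apply/funext => y; rewrite /partial (dA y).2 ij.
  + by move=> y yB /=; apply: boxP => -[].
- rewrite -(integral21_prod_meas1 ip)/=.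
  rewrite (eq_integral (cst 0%E)) ?integral0// => y _ /=.
  have dA t := @derive_along _ _ (fun t : R => rV_cons (t, y)) f t _ _
    (fun h => rV_consD0 t h y).
  rewrite /fubini_G/= (eq_integral (fun t : measurableTypeR R =>
      ('D_1 (f \o (fun t => rV_cons (t, y))) t)%:E)); last first.
    by move=> t _; rewrite /partial (dA t).2 i0.
  apply: (@integral_derive_eq0 M).
  + by move=> t; apply/(dA t).1; rewrite -i0.
  + rewrite (_ : 'D_1 (f \o (fun t : R => rV_cons (t, y))) =
        partial i f \o (fun t : R => rV_cons (t, y))).
      move=> t; apply: continuous_comp; last exact: cf.
      exact: continuous_rV_consl.
    by apply/funext => t; rewrite /partial (dA t).2 i0.
  + by move=> t tM /=; apply: boxP => -[+ _]; rewrite leNgt tM.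
Qed.

End borel.

(** * Continuously differentiable functions *)

(** A directional derivative of [f] does not make [f] differentiable on [V]. Restricting to the line
    [t *: v + x] reduces to one variable, where derivability and differentiability agree. *)
Lemma is_derive_comp_real (R : realType) (V : normedModType R) (h : R -> R)
    (f : V -> R) x v df dh :
  is_derive x v f df -> is_derive (f x) 1 h dh ->
  is_derive x v (h \o f) (dh * df).
Proof.
move=> [fx fE] [hx hE].
pose F (t : R) := t *: v + x.
have FE t : F (t *: 1 + 0) = t *: v + F 0.
  by rewrite /F addr0 scale0r add0r; congr (_ *: _ + _); exact: mulr1.
have F0 : F 0 = x by rewrite /F scale0r add0r.
have [d1 D1] := derive_along f FE; have [d2 D2] := derive_along (h \o f) FE.
rewrite F0 in d1 D1 d2 D2.
have fF0 : (f \o F) 0 = f x by rewrite /= F0.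
have df1 : derivable (f \o F) 0 1 := d1.2 fx.
have hf1 : derivable h ((f \o F) 0) 1 by rewrite fF0; exact hx.
have /derivable1_diffP dc : differentiable (h \o (f \o F)) 0.
  by apply: differentiable_comp; apply/derivable1_diffP; [exact df1|exact hf1].
split; first exact: (d2.1 dc).
have := derive1_comp df1 hf1.
rewrite !derive1E fF0 hE D1 fE => <-.
exact: (esym D2).
Qed.

Section pointwise_is_derive.
Context {R : realType} {V : normedModType R}.
Implicit Types (f g : V -> R) (x v : V).

Lemma is_derive_eq_val f x v (df df' : R) :
  is_derive x v f df -> df = df' -> is_derive x v f df'.
Proof. by move=> h <-. Qed.

Lemma is_derive_add f g x v df dg : is_derive x v f df -> is_derive x v g dg ->
  is_derive x v (fun y => f y + g y) (df + dg).
Proof. exact: is_deriveD. Qed.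

Lemma is_derive_mul f g x v df dg : is_derive x v f df -> is_derive x v g dg ->
  is_derive x v (fun y => f y * g y) (f x * dg + g x * df).
Proof. exact: (@is_deriveM _ _ f g). Qed.

Lemma is_derive_inv f x v df : f x != 0 -> is_derive x v f df ->
  is_derive x v (fun y => (f y)^-1) (- (f x) ^- 2 * df).
Proof.
move=> fx [dfx <-]; split; first exact: derivableV.
by rewrite deriveV.
Qed.

Lemma is_derive_bigsum (I : Type) (s : seq I) (P : pred I) (F : I -> V -> R)
    (dF : I -> R) x v :
  (forall i, P i -> is_derive x v (F i) (dF i)) ->
  is_derive x v (fun y => \sum_(i <- s | P i) F i y) (\sum_(i <- s | P i) dF i).
Proof.
move=> h; elim: s => [|a s IH].
  rewrite big_nil (_ : (fun y => _) = cst 0); first exact: is_derive_cst.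
  by apply/funext => y; rewrite big_nil.
rewrite big_cons (_ : (fun y => _) =
    fun y => (if P a then F a y else 0) + \sum_(i <- s | P i) F i y).
  case: ifPn => Pa; first exact: is_derive_add (h a Pa) IH.
  by have := is_derive_add (is_derive_cst 0 x v) IH; rewrite add0r.
by apply/funext => y; rewrite big_cons; case: ifP; rewrite ?add0r.
Qed.

Lemma is_derive_pow f x v df (j : nat) : is_derive x v f df ->
  is_derive x v (fun y => f y ^+ j) (j%:R * f x ^+ j.-1 * df).
Proof.
move=> hf; elim: j => [|j IH].
  by rewrite !mul0r; exact: is_derive_cst.
rewrite (_ : (fun y => _) = fun y => f y * f y ^+ j); last first.
  by apply/funext => y; rewrite exprS.
apply: is_derive_eq_val (is_derive_mul hf IH) _.
by case: j {IH} => [|j] /=; rewrite -?natr1 ?exprS; ring.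
Qed.

End pointwise_is_derive.

Section pointwise_continuity.
Context {R : realType} {T : topologicalType}.
Implicit Types (f g : T -> R) (x : T).

Lemma continuous_for_add f g x : {for x, continuous f} -> {for x, continuous g} ->
  {for x, continuous (fun y => f y + g y)}.
Proof. exact: continuousD. Qed.

Lemma continuous_for_mul f g x : {for x, continuous f} -> {for x, continuous g} ->
  {for x, continuous (fun y => f y * g y)}.
Proof. exact: continuousM. Qed.

Lemma continuous_for_comp (h : R -> R) f x : {for x, continuous f} ->
  {for f x, continuous h} -> {for x, continuous (fun y => h (f y))}.
Proof. exact: continuous_comp. Qed.

End pointwise_continuity.

Section C1.
Context {R : realType} {d : nat}.
Implicit Types (D K : set 'rV[R]_d) (f g : 'rV[R]_d -> R) (x : 'rV[R]_d).

Definition C1_on D f := forall x, D x -> {for x, continuous f} /\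
  forall i, derivable f x (delta_mx 0 i) /\ {for x, continuous (partial i f)}.

Lemma near_eq_continuous f g x : (\near x, f x = g x) ->
  {for x, continuous f} -> {for x, continuous g}.
Proof.
move=> fg; rewrite /prop_for /continuous_at -(nbhs_singleton fg).
by move=> cf; apply: (cvg_trans _ cf); exact: (near_eq_cvg fg).
Qed.

(** Since [D] is open, [df i] agrees with [partial i f] near each point of [D], which transfers its
    continuity. *)
Lemma C1_onP D f (df : 'I_d -> 'rV[R]_d -> R) : open D ->
  (forall x, D x -> {for x, continuous f} /\
    forall i, is_derive x (delta_mx 0 i) f (df i x) /\
      {for x, continuous (df i)}) ->
  C1_on D f.
Proof.
move=> oD h x Dx; have [cf hf] := h x Dx; split => // i.
have [[df1 df2] cdf] := hf i; split => //.
apply: near_eq_continuous cdf; near=> y.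
have /h[_ /(_ i)[[_ <-]//]] : D y.
by near: y; exact: open_nbhs_nbhs.
Unshelve. all: by end_near. Qed.

Lemma C1_is_derive D f x i : C1_on D f -> D x ->
  is_derive x (delta_mx 0 i) f (partial i f x).
Proof. by move=> h /h[_ /(_ i)[? _]]; exact: derivableP. Qed.

Lemma C1_cst D (a : R) : open D -> C1_on D (fun=> a).
Proof.
move=> oD; apply: (@C1_onP _ _ (fun _ _ => 0)) => // x Dx; split.
  exact: cst_continuous.
by move=> i; split; [exact: is_derive_cst|exact: cst_continuous].
Qed.

Lemma is_derive_coord x v (j : 'I_d) :
  is_derive x v (fun y : 'rV[R]_d => y 0 j) (v 0 j).
Proof.
have dx : derivable (id : 'rV[R]_d -> 'rV[R]_d) x v by exact: derivable_id.
split; first by move/derivable_mxP : dx; exact.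
by have := derive_mx dx; rewrite derive_id => /matrixP/(_ 0 j); rewrite mxE => <-.
Qed.

Lemma C1_coord D (j : 'I_d) : open D -> C1_on D (fun y => y 0 j).
Proof.
move=> oD; apply: (@C1_onP _ _ (fun i _ => (delta_mx 0 i : 'rV[R]_d) 0 j)) => //.
move=> x Dx; split; first exact: coord_continuous.
by move=> i; split; [exact: is_derive_coord|exact: cst_continuous].
Qed.

Lemma C1_add D f g : open D -> C1_on D f -> C1_on D g ->
  C1_on D (fun y => f y + g y).
Proof.
move=> oD hf hg.
apply: (@C1_onP _ _ (fun i y => partial i f y + partial i g y)) => //.
move=> x Dx; have [cf df] := hf x Dx; have [cg dg] := hg x Dx.
split; first exact: continuous_for_add cf cg.
move=> i; have [/derivableP df1 df2] := df i; have [/derivableP dg1 dg2] := dg i.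
by split; [exact: is_derive_add df1 dg1|exact: continuous_for_add df2 dg2].
Qed.

Lemma C1_mul D f g : open D -> C1_on D f -> C1_on D g ->
  C1_on D (fun y => f y * g y).
Proof.
move=> oD hf hg.
apply: (@C1_onP _ _ (fun i y => f y * partial i g y + g y * partial i f y)) => //.
move=> x Dx; have [cf df] := hf x Dx; have [cg dg] := hg x Dx.
split; first exact: continuous_for_mul cf cg.
move=> i; have [/derivableP df1 df2] := df i; have [/derivableP dg1 dg2] := dg i.
split; first exact: is_derive_mul df1 dg1.
exact: continuous_for_add (continuous_for_mul cf dg2) (continuous_for_mul cg df2).
Qed.

Lemma C1_comp D (E : set R) (h : R -> R) f : open D -> C1_on D f ->
  (forall x, D x -> E (f x)) ->
  (forall t, E t -> derivable h t 1 /\ {for t, continuous ('D_1 h)}) ->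
  C1_on D (fun y => h (f y)).
Proof.
move=> oD hf fE hh.
apply: (@C1_onP _ _ (fun i y => 'D_1 h (f y) * partial i f y)) => //.
move=> x Dx; have [cf df] := hf x Dx; have [h1 h2] := hh _ (fE _ Dx).
split.
  apply: continuous_for_comp => //.
  by apply: differentiable_continuous; apply/derivable1_diffP.
move=> i; have [/derivableP df1 df2] := df i.
split; first exact: is_derive_comp_real df1 (derivableP h1).
exact: continuous_for_mul (continuous_for_comp cf h2) df2.
Qed.

Lemma eq_C1 D f g : open D -> (forall x, D x -> f x = g x) ->
  C1_on D f -> C1_on D g.
Proof.
move=> oD fg hf; apply: (@C1_onP _ _ (fun i => partial i f)) => // x Dx.
have [cf df] := hf x Dx.
have nfg : \near x, f x = g x.
  by near=> y; apply: fg; near: y; exact: open_nbhs_nbhs.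
split; first exact: near_eq_continuous cf.
move=> i; have [/derivableP df1 df2] := df i.
by split; [exact: near_eq_is_derive nfg df1|exact: df2].
Unshelve. all: by end_near. Qed.

Lemma C1_sum D (I : Type) (s : seq I) (P : pred I) (F : I -> 'rV[R]_d -> R) :
  open D -> (forall i, P i -> C1_on D (F i)) ->
  C1_on D (fun y => \sum_(i <- s | P i) F i y).
Proof.
move=> oD hF; elim: s => [|a s IH].
  by apply: eq_C1 (C1_cst 0 oD) => // y _; rewrite big_nil.
have [Pa|Pa] := boolP (P a); last first.
  by apply: eq_C1 IH => // y _; rewrite big_cons (negbTE Pa).
by apply: eq_C1 (C1_add oD (hF a Pa) IH) => // y _; rewrite big_cons Pa.
Qed.

(** The fields live on [D] only, while integration by parts is available on the whole of R^d. The
    extension by zero stays C1 because [D] and the complement of [K] form an open cover and the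
    extension vanishes on the second. *)
Lemma C1_patch D K M f : open D -> closed K -> K `<=` D -> K `<=` box M ->
  C1_on D f -> (forall x, D x -> ~ K x -> f x = 0) ->
  [/\ forall x i, derivable (f \_ D) x (delta_mx 0 i),
      forall i, partial i (f \_ D) = (partial i f) \_ D,
      forall i, continuous (partial i (f \_ D)) &
      forall x, ~ box M x -> (f \_ D) x = 0].
Proof.
move=> oD cK KD KM hf f0.
have nD x : D x -> \near x, f x = (f \_ D) x.
  move=> Dx; near=> y; rewrite patchE mem_set//; near: y.
  exact: open_nbhs_nbhs.
have nK x : ~ D x -> \near x, 0 = (f \_ D) x.
  move=> nDx; near=> y; rewrite patchE; case: ifPn => //.
  rewrite inE => Dy; rewrite f0//; near: y.
  have : open_nbhs x (~` K) by split; [exact: closed_openC|move/KD].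
  exact: open_nbhs_nbhs.
have isD x i : is_derive x (delta_mx 0 i) (f \_ D) ((partial i f \_ D) x).
  rewrite patchE; case: ifPn; rewrite ?(inE,notin_setE) => Dx.
    by apply: (near_eq_is_derive (nD _ Dx)); exact: (C1_is_derive _ hf).
  apply: (near_eq_is_derive (nK _ Dx)); exact: is_derive_cst.
have E i : partial i (f \_ D) = (partial i f) \_ D.
  by apply/funext => x; have [_ <-] := isD x i.
split => //.
- move=> i; rewrite E => x; have [Dx|nDx] := pselect (D x).
    have [_ /(_ i)[_]] := hf x Dx; apply: near_eq_continuous.
    near=> y; rewrite patchE mem_set//; near: y.
    exact: open_nbhs_nbhs.
  apply: (@near_eq_continuous (fun=> 0)); last exact: cst_continuous.
  have : open_nbhs x (~` K) by split; [exact: closed_openC|move/KD].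
  move=> /open_nbhs_nbhs; apply: filterS => y Ky.
  rewrite -E /partial (@near_eq_derive _ _ _ (f \_ D) (cst 0)).
    by rewrite derive_cst.
  have : open_nbhs y (~` K) by split; [exact: closed_openC|].
  move=> /open_nbhs_nbhs; apply: filterS => t Kt.
  by rewrite patchE; case: ifPn => //; rewrite inE => Dt; rewrite f0.
- move=> x xM; rewrite patchE; case: ifPn => //; rewrite inE => Dx.
  by rewrite f0// => /KM.
Unshelve. all: by end_near. Qed.

(** The form in which the divergence theorem is always applied. Finiteness of the integral of [g1]
    is not assumed but deduced from that of [g2]. The pointwise inequality is asked almost
    everywhere because the solution is only known to be essentially bounded. *)
Lemma le_integral_divergence D K M (Z : 'I_d -> 'rV[R]_d -> R) (g1 g2 : 'rV[R]_d -> R) :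
  open D -> closed K -> K `<=` D -> K `<=` box M ->
  (forall i, C1_on D (Z i)) -> (forall i x, D x -> ~ K x -> Z i x = 0) ->
  measurable_fun D g1 -> measurable_fun D g2 ->
  (forall x, D x -> 0 <= g1 x) -> (forall x, D x -> 0 <= g2 x) ->
  {ae @lebesgue_rV R d, forall x, D x ->
     g1 x <= \sum_i partial i (Z i) x + g2 x} ->
  (\int[@lebesgue_rV R d]_(x in D) (g1 x)%:E <=
   \int[@lebesgue_rV R d]_(x in D) (g2 x)%:E)%E.
Proof.
move=> oD cK KD KM hZ Z0 mg1 mg2 g10 g20 g12.
have mD := open_rV_measurable oD.
have hp i := C1_patch oD cK KD KM (hZ i) (Z0 i).
have iZ i : (@lebesgue_rV R d).-integrable D (EFin \o partial i (Z i)).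
  have [h1 h2 h3 h4] := hp i.
  apply/(integrable_mkcond _ mD).
  have := box_integrable (h3 i) (partial_out_box i h4).
  apply: eq_integrable => // x _ /=; rewrite h2 !patchE.
  by case: ifP.
have Z_0 i : (\int[@lebesgue_rV R d]_(x in D) (partial i (Z i) x)%:E = 0)%E.
  have [h1 h2 h3 h4] := hp i.
  rewrite integral_mkcond -[RHS](integral_partial_eq0 (h1^~ i) (h3 i) h4).
  by apply: eq_integral => x _; rewrite h2 !patchE; case: ifP.
have [g2oo|] := eqVneq (\int[@lebesgue_rV R d]_(x in D) (g2 x)%:E)%E +oo%E.
  by rewrite g2oo leey.
rewrite -ltey => g2oo.
have ig2 : (@lebesgue_rV R d).-integrable D (EFin \o g2).
  apply/integrableP; split; first exact/measurable_EFinP.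
  apply: le_lt_trans g2oo; apply: ge0_le_integral => //.
  - by apply: measurableT_comp => //; exact/measurable_EFinP.
  - exact/measurable_EFinP.
  - by move=> x Dx /=; rewrite ger0_norm// g20.
have iS : (@lebesgue_rV R d).-integrable D
    (fun x => \sum_(i <- index_enum 'I_d) (partial i (Z i) x)%:E)%E.
  by apply: integrable_sum => // i _; exact: iZ.
have ES : (\int[@lebesgue_rV R d]_(x in D)
    (\sum_(i <- index_enum 'I_d) (partial i (Z i) x)%:E) = 0)%E.
  by rewrite integral_sum// big1.
pose h x := (\sum_(i <- index_enum 'I_d) (partial i (Z i) x)%:E + (g2 x)%:E)%E.
have mh : measurable_fun D h.
  by apply: emeasurable_funD; [exact: measurable_int iS|exact: measurable_int ig2].
have <- : (\int[@lebesgue_rV R d]_(x in D) h x =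
           \int[@lebesgue_rV R d]_(x in D) (g2 x)%:E)%E.
  by rewrite integralD// ES add0e.
have gh : {ae @lebesgue_rV R d, forall x, D x -> ((g1 x)%:E <= h x)%E}.
  by apply: filterS g12 => x hx Dx; rewrite /h sumEFin -EFinD lee_fin; exact: hx.
(* [h] dominates [g1 >= 0] only almost everywhere; passing to its positive part gives the sign at
   every point that monotonicity of the integral asks for. *)
have -> : (\int[@lebesgue_rV R d]_(x in D) h x =
           \int[@lebesgue_rV R d]_(x in D) maxe (h x) 0)%E.
  apply: ae_eq_integral => //; first exact: (measurable_maxe mh).
  apply: filterS gh => x hx Dx /=; rewrite /Order.max ifN// -leNgt.
  by rewrite (le_trans _ (hx Dx))// lee_fin g10.
apply: ae_ge0_le_integral => //.
- exact/measurable_EFinP.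
- by move=> x _; rewrite le_max lexx orbT.
- exact: (measurable_maxe mh).
- by apply: filterS gh => x hx Dx; rewrite le_max hx.
Qed.

End C1.

(** * Curvature of block conformally flat metrics *)

Section block_conformal_metric.
Context {R : realType} {d : nat}.
Variables (B : 'I_d -> bool) (al be : bool -> R).
Implicit Types (x y z : 'rV[R]_d) (b : bool) (i j k l r : 'I_d).

Definition block_sqnorm b z := \sum_(i | B i == b) z 0 i ^+ 2.

(** A block with metric [(al + be |z|^2) ^- 2 |dz|^2] has constant curvature [4 al be]. One
    computation thus serves the ball ([al = 1], [be = - c^2 / 4]) and the sphere in stereographic
    coordinates ([al = be = 1 / 2]). *)
Definition conformal_factor b z := al b + be b * block_sqnorm b z.

Definition block_metric z : 'M[R]_d :=
  diag_mx (\row_i (conformal_factor (B i) z) ^- 2).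

Local Notation w := conformal_factor.

Lemma is_derive_block_sqnorm b x k :
  is_derive x (delta_mx 0 k) (block_sqnorm b) (2 * x 0 k * (B k == b)%:R).
Proof.
have h i : is_derive x (delta_mx 0 k) (fun y : 'rV[R]_d => y 0 i ^+ 2)
    (if i == k then 2 * x 0 k else 0).
  have dc := is_derive_coord x (delta_mx 0 k) i.
  apply: is_derive_eq_val (is_derive_mul dc dc) _.
  by rewrite mxE eqxx /=; case: eqP => [->|_] /=; ring.
apply: is_derive_eq_val (is_derive_bigsum _ (fun i _ => h i)) _.
rewrite big_mkcond (bigD1 k)//= eqxx big1 ?addr0 => [|i /negbTE ->].
  by case: ifP; rewrite ?mulr1 ?mulr0.
by case: ifP.
Qed.

Lemma is_derive_conformal_factor b x k : is_derive x (delta_mx 0 k) (w b)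
  (2 * be b * x 0 k * (B k == b)%:R).
Proof.
have ds := is_derive_block_sqnorm b x k.
apply: is_derive_eq_val (is_derive_add (is_derive_cst (al b) _ _)
  (is_derive_mul (is_derive_cst (be b) _ _) ds)) _.
rewrite /=; ring.
Qed.

Lemma C1_block_sqnorm (D : set 'rV[R]_d) b : open D -> C1_on D (block_sqnorm b).
Proof.
move=> oD; apply: C1_sum => // i _.
by apply: eq_C1 (C1_mul oD (C1_coord i oD) (C1_coord i oD)).
Qed.

Lemma C1_conformal_factor (D : set 'rV[R]_d) b : open D -> C1_on D (w b).
Proof.
move=> oD; apply: C1_add => //; first exact: C1_cst.
by apply: C1_mul => //; [exact: C1_cst|exact: C1_block_sqnorm].
Qed.

Lemma continuous_conformal_factor b : continuous (w b).
Proof. by move=> x; have [] := C1_conformal_factor b openT I (x := x). Qed.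

Definition regular : set 'rV[R]_d := [set x | forall b, w b x != 0].

(** The closed form of the Christoffel symbols must hold on a neighbourhood before it can be
    differentiated. *)
Lemma open_regular : open regular.
Proof.
rewrite (_ : regular = [set x | w true x != 0] `&` [set x | w false x != 0]).
  by apply: openI; apply: open_comp (@open_neq _ 0) => x _;
    exact: continuous_conformal_factor.
by apply/seteqP; split => x /= h; [split; exact: h|by case: h => ? ? []].
Qed.

Lemma block_metricE z i j : block_metric z i j = (i == j)%:R * (w (B i) z) ^- 2.
Proof. by rewrite !mxE; case: eqP => //= _; rewrite ?mulr1n ?mul1r ?mul0r. Qed.

Lemma det_block_metric z : \det (block_metric z) = \prod_i (w (B i) z) ^- 2.
Proof. by rewrite det_diag; apply: eq_bigr => i _; rewrite mxE. Qed.

Lemma volume_density_block z : (forall b, 0 < w b z) ->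
  volume_density block_metric z = \prod_i (w (B i) z)^-1.
Proof.
move=> w0; rewrite /volume_density det_block_metric.
under eq_bigr do rewrite -exprVn.
rewrite prodrXl sqrtr_sqr ger0_norm// prodr_ge0// => i _.
by rewrite invr_ge0 ltW.
Qed.

Lemma invmx_block_metric z : regular z -> invmx (block_metric z) =
  diag_mx (\row_i (w (B i) z) ^+ 2).
Proof.
move=> rz; have E : diag_mx (\row_i (w (B i) z) ^+ 2) *m block_metric z = 1%:M.
  rewrite mulmx_diag -diag_const_mx; congr diag_mx; apply/rowP => i.
  by rewrite !mxE mulfV// expf_neq0.
by rewrite -[LHS]mul1mx -E mulmxK//; have [] := mulmx1_unit E.
Qed.

Lemma invmx_block_metricE z i j : regular z ->
  invmx (block_metric z) i j = (i == j)%:R * (w (B i) z) ^+ 2.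
Proof.
move=> /invmx_block_metric ->.
by rewrite !mxE; case: eqP => //= _; rewrite ?mulr1n ?mul1r ?mul0r.
Qed.

Lemma sum_delta (i : 'I_d) (F : 'I_d -> R) : \sum_l (i == l)%:R * F l = F i.
Proof.
rewrite (bigD1 i)//= eqxx mul1r big1 ?addr0// => l.
by rewrite eq_sym => /negbTE ->; rewrite mul0r.
Qed.

Lemma partial_block_metric x i j k : regular x ->
  partial k (fun y => block_metric y i j) x =
  - 4 * (i == j)%:R * (B k == B i)%:R * be (B i) * x 0 k * (w (B i) x) ^- 3.
Proof.
move=> rx; have dw := is_derive_conformal_factor (B i) x k.
have -> : (fun y => block_metric y i j) =
    (fun y => (i == j)%:R * (w (B i) y * w (B i) y)^-1).
  by apply/funext => y; rewrite block_metricE.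
have := is_derive_mul (is_derive_cst ((i == j)%:R : R) x (delta_mx 0 k))
  (is_derive_inv _ (is_derive_mul dw dw)).
move=> /(_ _)[]; first by rewrite mulf_neq0.
move=> _; rewrite /partial => ->/=; have := rx (B i); move: (w _ _) => t t0.
by field.
Qed.

(** Inside its block, [theta * z_k] is the k-th partial derivative of [ln w]; the formula below is
    the usual one for a metric [e^(2 phi) |dz|^2] with [phi = - ln w]. *)
Definition theta b x := 2 * be b / w b x.

Definition christoffel_formula l i j x : R :=
  - theta (B l) x * (B i == B l)%:R * (B j == B l)%:R *
  ((j == l)%:R * x 0 i + (i == l)%:R * x 0 j - (i == j)%:R * x 0 l).

Lemma christoffel_block x l i j : regular x ->
  christoffel block_metric l i j x = christoffel_formula l i j x.
Proof.
move=> rx; rewrite /christoffel /christoffel_formula /theta.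
under eq_bigr do rewrite invmx_block_metricE// -mulrA.
rewrite sum_delta !partial_block_metric//.
have wl := rx (B l).
have [->|jl] := eqVneq j l.
  have [->|il] := eqVneq i l; rewrite ?eqxx /=; first by field.
  by rewrite /=; field; rewrite !rx.
have [->|il] := eqVneq i l.
  by rewrite (eq_sym l) (negbTE jl) ?eqxx /=; field; rewrite !rx.
have [->|ij] := eqVneq i j; last by rewrite /=; field; rewrite !rx.
rewrite (eq_sym (B l)); have [->|_] := eqVneq (B j) (B l); rewrite /=; last by ring.
by field.
Qed.

Lemma partial_christoffel x k l i j : regular x ->
  partial k (christoffel block_metric l i j) x =
  (B i == B l)%:R * (B j == B l)%:R *
  ((theta (B l) x) ^+ 2 * x 0 k * (B k == B l)%:R *
    ((j == l)%:R * x 0 i + (i == l)%:R * x 0 j - (i == j)%:R * x 0 l)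
   - theta (B l) x * ((j == l)%:R * (i == k)%:R + (i == l)%:R * (j == k)%:R
      - (i == j)%:R * (l == k)%:R)).
Proof.
move=> rx.
have nE : \near x, christoffel block_metric l i j x = christoffel_formula l i j x.
  have : open_nbhs x regular by split => //; exact: open_regular.
  by move=> /open_nbhs_nbhs; apply: filterS => y; exact: christoffel_block.
rewrite /partial (near_eq_derive _ nE).
have dc := is_derive_coord x (delta_mx 0 k).
have dw := is_derive_conformal_factor (B l) x k.
have cst_ (a : R) : is_derive x (delta_mx 0 k) (fun=> a) 0 by exact: is_derive_cst.
have dth := is_derive_mul (cst_ (2 * be (B l))) (is_derive_inv (rx (B l)) dw).
have dL := is_derive_mul (is_derive_mul (is_derive_mul (cst_ (-1)) dth)
   (cst_ (B i == B l)%:R)) (cst_ (B j == B l)%:R).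
have dR := is_derive_add (is_derive_add (is_derive_mul (cst_ (j == l)%:R) (dc i))
  (is_derive_mul (cst_ (i == l)%:R) (dc j)))
  (is_derive_mul (cst_ (- (i == j)%:R)) (dc l)).
have [_ E] := is_derive_mul dL dR.
have -> : christoffel_formula l i j = (fun y : 'rV[R]_d =>
    -1 * (2 * be (B l) * (w (B l) y)^-1) * (B i == B l)%:R * (B j == B l)%:R *
    ((j == l)%:R * y 0 i + (i == l)%:R * y 0 j + - (i == j)%:R * y 0 l)).
  by apply/funext => y; rewrite /christoffel_formula /theta; ring.
apply: etrans E _.
rewrite !mxE eqxx /= /theta; have := rx (B l).
by move: (w _ _) => t t0; field.
Qed.

Definition block_card b : R := \sum_(l | B l == b) 1.

Lemma ricci_deriv_term x i l : regular x ->
  partial l (christoffel block_metric l i i) x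
  - partial i (christoffel block_metric l i l) x =
  (B l == B i)%:R * (theta (B i) x ^+ 2 * ((i == l)%:R * (2 * x 0 i * x 0 l)
     - x 0 l ^+ 2 - x 0 i ^+ 2) + theta (B i) x * (2 - 2 * (i == l)%:R)).
Proof.
move=> rx; rewrite !partial_christoffel// (eq_sym (B i)) !eqxx (eq_sym l i).
have [->|_] := eqVneq (B l) (B i); last by rewrite !(mulr0, mul0r) subr0.
by have [->|_] := eqVneq i l; rewrite /=; ring.
Qed.

Lemma ricci_quadratic_term x i l r : regular x ->
  christoffel block_metric l l r x * christoffel block_metric r i i x
  - christoffel block_metric l i r x * christoffel block_metric r i l x =
  (B l == B i)%:R * ((B r == B i)%:R * (theta (B i) x ^+ 2 *
    (x 0 r * ((i == r)%:R * (2 * x 0 i) - x 0 r) - (r == l)%:R * x 0 i ^+ 2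
     + (i == l)%:R * x 0 r ^+ 2 + (i == r)%:R * x 0 l ^+ 2
     - (i == l)%:R * (i == r)%:R * (2 * x 0 i ^+ 2)))).
Proof.
move=> rx; rewrite !christoffel_block// /christoffel_formula.
rewrite !eqxx (eq_sym (B i) (B l)) (eq_sym (B i) (B r)) (eq_sym l r).
have [Er|_] := eqVneq (B r) (B i); last by rewrite /=; ring.
rewrite Er (eq_sym (B i) (B l)).
have [El|_] := eqVneq (B l) (B i); last by rewrite /=; ring.
rewrite El.
have [il|il] := eqVneq i l; have [ir|ir] := eqVneq i r.
- by rewrite -il -ir ?eqxx /=; ring.
- by rewrite -il (eq_sym r i) (negbTE ir) /=; ring.
- by rewrite -ir (negbTE il) /=; ring.
- by have [->|_] := eqVneq r l; rewrite /=; ring.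
Qed.

Lemma sum_block_cond b (F : 'I_d -> R) :
  \sum_l (B l == b)%:R * F l = \sum_(l | B l == b) F l.
Proof.
rewrite [RHS]big_mkcond; apply: eq_bigr => l _.
by case: ifP; rewrite ?mul1r ?mul0r.
Qed.

Lemma sum_block_delta i (F : 'I_d -> R) :
  \sum_(l | B l == B i) (i == l)%:R * F l = F i.
Proof.
rewrite (bigD1 i)//= eqxx mul1r big1 ?addr0// => l /andP[_].
by rewrite eq_sym => /negbTE ->; rewrite mul0r.
Qed.

(** The inverse metric is diagonal, so these diagonal entries determine the scalar curvature. *)
Lemma ricci_block x i : regular x ->
  ricci block_metric i i x = (block_card (B i) - 1) * theta (B i) x *
    (2 - theta (B i) x * block_sqnorm (B i) x).
Proof.
move=> rx; rewrite /ricci.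
under eq_bigr do rewrite ricci_deriv_term//.
under [X in _ + X]eq_bigr => l _ do under eq_bigr do rewrite ricci_quadratic_term//.
under [X in _ + X]eq_bigr => l _ do rewrite -mulr_sumr sum_block_cond.
rewrite !sum_block_cond.
set t := theta _ _; set S := block_sqnorm _ _; set N := block_card _.
have SE : \sum_(l | B l == B i) x 0 l ^+ 2 = S by [].
have sc a : \sum_(l | B l == B i) a = a * N by rewrite mulr_sumr mulr1.
have sx : \sum_(l | B l == B i) (i == l)%:R = 1 :> R.
  apply: etrans (sum_block_delta i (fun=> 1)).
  by apply: eq_bigr => l _; rewrite mulr1.
have H1 : \sum_(l | B l == B i) (t ^+ 2 * ((i == l)%:R * (2 * x 0 i * x 0 l)
     - x 0 l ^+ 2 - x 0 i ^+ 2) + t * (2 - 2 * (i == l)%:R)) =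
   t ^+ 2 * (2 * x 0 i ^+ 2 - S - x 0 i ^+ 2 * N) + t * (2 * N - 2).
  rewrite big_split/= -!mulr_sumr !sumrB sum_block_delta SE !sc.
  by rewrite -mulr_sumr sx; ring.
rewrite H1.
have H2 l : B l == B i -> \sum_(r | B r == B i) (t ^+ 2 *
    (x 0 r * ((i == r)%:R * (2 * x 0 i) - x 0 r) - (r == l)%:R * x 0 i ^+ 2
     + (i == l)%:R * x 0 r ^+ 2 + (i == r)%:R * x 0 l ^+ 2
     - (i == l)%:R * (i == r)%:R * (2 * x 0 i ^+ 2))) =
   t ^+ 2 * (x 0 i ^+ 2 - S + (i == l)%:R * (S - 2 * x 0 i ^+ 2) + x 0 l ^+ 2).
  move=> Bl; rewrite -mulr_sumr; congr (_ * _).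
  rewrite (eq_bigr (fun r => (i == r)%:R * (x 0 r * (2 * x 0 i) + x 0 l ^+ 2
     - (i == l)%:R * (2 * x 0 i ^+ 2)) + ((i == l)%:R - 1) * x 0 r ^+ 2
     + - x 0 i ^+ 2 * (l == r)%:R)); last first.
    by move=> r _; rewrite (eq_sym l r); ring.
  rewrite !big_split/= sum_block_delta -!mulr_sumr SE.
  have -> : \sum_(r | B r == B i) (l == r)%:R = 1 :> R.
    rewrite -(eqP Bl); apply: etrans (sum_block_delta l (fun=> 1)).
    by apply: eq_bigr => r _; rewrite mulr1.
  ring.
rewrite (eq_bigr _ H2) -mulr_sumr !big_split/= sum_block_delta SE sc sumrN.
rewrite sc; ring.
Qed.

(** The dependence on the point cancels: [w^2 theta (2 - theta |z|^2) = 4 be (w - be |z|^2) = 4 al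
    be]. *)
Lemma scalar_curvature_block x : regular x ->
  scalar_curvature block_metric x =
  \sum_i (block_card (B i) - 1) * (4 * al (B i) * be (B i)).
Proof.
move=> rx; rewrite /scalar_curvature; apply: eq_bigr => i _.
under eq_bigr do rewrite invmx_block_metricE// -mulrA.
rewrite sum_delta ricci_block// -mulrA mulrCA; congr (_ * _).
rewrite /theta; have := rx (B i); rewrite /w.
move=> w0; field. exact: w0.
Qed.

Lemma laplacian_block (f : 'rV[R]_d -> R) x (D : set 'rV[R]_d) : open D -> D x ->
  (forall y, D y -> forall b, 0 < w b y) ->
  laplacian block_metric f x = - \prod_i (w (B i) x) *
    \sum_i partial i (fun y => (\prod_j (w (B j) y)^-1) *
       (w (B i) y ^+ 2 * partial i f y)) x.
Proof.
move=> oD Dx w0; rewrite /laplacian volume_density_block; last exact: w0.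
rewrite -prodfV; under [X in - X]eq_bigr do rewrite invrK.
congr (_ * _); apply: eq_bigr => i _; apply: near_eq_derive.
have : open_nbhs x D by [].
move=> /open_nbhs_nbhs; apply: filterS => y Dy.
have w0y := w0 y Dy.
rewrite volume_density_block; last exact: w0y.
have ry : regular y by move=> b; rewrite gt_eqF.
congr (_ * _).
rewrite (eq_bigr (fun j => (i == j)%:R * (w (B i) y ^+ 2 * partial j f y))).
  by rewrite sum_delta.
by move=> j _; rewrite invmx_block_metricE// mulrA.
Qed.

End block_conformal_metric.

(** * The metric of the model space in a chart *)

Section chart_metric_block.
Context {R : realType}.

Lemma is_derive_sqnorm d (y : 'rV[R]_d) i :
  is_derive y (delta_mx 0 i) (@sqnorm R d) (2 * y 0 i).
Proof.
have := is_derive_block_sqnorm (fun=> true) true y i.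
rewrite mulr1 (_ : block_sqnorm _ _ = @sqnorm R d)//.
Qed.

Lemma sqnorm_ge0 d (y : 'rV[R]_d) : 0 <= sqnorm y.
Proof. by apply: sumr_ge0 => i _; exact: sqr_ge0. Qed.

Lemma sqnorm1D_neq0 d (y : 'rV[R]_d) : 1 + sqnorm y != 0.
Proof. by rewrite gt_eqF// ltr_pwDl// sqnorm_ge0. Qed.

Lemma is_derive_inv1D_sqnorm d (y : 'rV[R]_d) i :
  is_derive y (delta_mx 0 i) (fun z => (1 + sqnorm z)^-1)
    (- (1 + sqnorm y) ^- 2 * (2 * y 0 i)).
Proof.
have := is_derive_add (is_derive_cst (1 : R) y (delta_mx 0 i)) (is_derive_sqnorm y i).
move=> /(@is_derive_inv _ _ (fun z => 1 + sqnorm z) _ _ _ (sqnorm1D_neq0 y)).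
by rewrite add0r.
Qed.

Lemma partial_stereol b m (y : 'rV[R]_m) i l :
  partial i (fun z => stereo b z 0 (lshift 1 l)) y =
  2 * (1 + sqnorm y)^-1 * (i == l)%:R
  - 4 * (1 + sqnorm y) ^- 2 * y 0 i * y 0 l.
Proof.
rewrite (_ : (fun z => _) = (fun z => 2 * (1 + sqnorm z)^-1 * z 0 l)); last first.
  by apply/funext => z; rewrite row_mxEl mxE.
have w0 := sqnorm1D_neq0 y.
have cst_ (a : R) : is_derive y (delta_mx 0 i) (fun=> a) 0 by exact: is_derive_cst.
have [_ E] := is_derive_mul (is_derive_mul (cst_ 2)
  (is_derive_inv1D_sqnorm y i))
  (is_derive_coord y (delta_mx 0 i) l).
apply: etrans E _; rewrite !mxE eqxx /= (eq_sym l).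
by field.
Qed.

Lemma partial_stereor b m (y : 'rV[R]_m) i :
  partial i (fun z => stereo b z 0 (rshift m 0)) y =
  (-1) ^+ b * (4 * (1 + sqnorm y) ^- 2 * y 0 i).
Proof.
have w0 := @sqnorm1D_neq0 m.
rewrite (_ : (fun z => _) =
    (fun z => (-1) ^+ b * (1 + -2 * (1 + sqnorm z)^-1))); last first.
  apply/funext => z; rewrite row_mxEr mxE eqxx mulr1n; congr (_ * _).
  by field; exact: w0.
have cst_ (a : R) : is_derive y (delta_mx 0 i) (fun=> a) 0 by exact: is_derive_cst.
have [_ E] := is_derive_mul (cst_ ((-1) ^+ b)) (is_derive_add (cst_ 1)
  (is_derive_mul (cst_ (-2))
  (is_derive_inv1D_sqnorm y i))).
apply: etrans E _; move: (w0 y) => w0y.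
by field.
Qed.

(** Stereographic projection is conformal, and the choice of the pole enters only through the square
    of a sign. *)
Lemma induced_metric_stereo b m (y : 'rV[R]_m) :
  induced_metric (@stereo R b m) y = (((1 + sqnorm y) / 2) ^- 2)%:M.
Proof.
apply/matrixP => i j; rewrite !mxE big_split_ord/= big_ord1.
rewrite !partial_stereor.
under eq_bigr do rewrite !partial_stereol.
have w0 := sqnorm1D_neq0 y.
rewrite (eq_bigr (fun l => (i == l)%:R * (4 * (1 + sqnorm y) ^- 2 * (j == l)%:R
   - 8 * (1 + sqnorm y) ^- 3 * y 0 j * y 0 l)
   + (j == l)%:R * (- 8 * (1 + sqnorm y) ^- 3 * y 0 i * y 0 l)
   + 16 * (1 + sqnorm y) ^- 4 * y 0 i * y 0 j * y 0 l ^+ 2)); last first.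
  by move=> l _; field.
rewrite !big_split/= !sum_delta -mulr_sumr -/(sqnorm y) (eq_sym j).
have bb : ((-1) ^+ b : R) * (-1) ^+ b = 1 by rewrite -signr_addb addbb.
rewrite [(-1) ^+ b * _ * _]mulrACA bb mul1r.
case: eqVneq => [->|ij] /=; rewrite ?mulr1n ?mulr0n; by field.
Qed.

Variables (c : R) (k m : nat).

Definition in_left (i : 'I_(k.+1 + m)) : bool := (i < k.+1)%N.
Definition block_al (b : bool) : R := if b then 1 else 2^-1.
Definition block_be (b : bool) : R := if b then - (c ^+ 2 / 4) else 2^-1.

Lemma block_sqnorm_left (z : 'rV[R]_(k.+1 + m)) :
  block_sqnorm in_left true z = sqnorm (lsubmx z).
Proof.
rewrite /block_sqnorm big_split_ord/= [X in _ + X]big_pred0 ?addr0; last first.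
  by move=> i; rewrite /in_left/= ltnNge leq_addr.
by apply: eq_big => [i|i _]; rewrite ?mxE// /in_left /= ltn_ord.
Qed.

Lemma block_sqnorm_right (z : 'rV[R]_(k.+1 + m)) :
  block_sqnorm in_left false z = sqnorm (rsubmx z).
Proof.
rewrite /block_sqnorm big_split_ord/= [X in X + _]big_pred0 ?add0r; last first.
  by move=> i; rewrite /in_left/= ltn_ord.
by apply: eq_big => [i|i _]; rewrite ?mxE// /in_left /= ltnNge leq_addr.
Qed.

Lemma chart_metric_block b :
  chart_metric c b = block_metric in_left block_al block_be.
Proof.
apply/funext => z; rewrite /chart_metric induced_metric_stereo.
apply/matrixP => i j; rewrite [RHS]block_metricE.
have E1 : conformal_factor in_left block_al block_be true z
    = 1 - c ^+ 2 * sqnorm (lsubmx z) / 4.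
  by rewrite /conformal_factor block_sqnorm_left /=; field.
have E2 : conformal_factor in_left block_al block_be false z
    = (1 + sqnorm (rsubmx z)) / 2.
  by rewrite /conformal_factor block_sqnorm_right /=; field.
have il (i' : 'I_k.+1) : in_left (lshift m i') = true by rewrite /in_left /= ltn_ord.
have ir (i' : 'I_m) : in_left (rshift k.+1 i') = false.
  by rewrite /in_left /= ltnNge leq_addr.
case: (split_ordP i) => i' ->; case: (split_ordP j) => j' ->.
- by rewrite block_mxEul mxE il E1 (inj_eq (@lshift_inj _ _)) [RHS]mulr_natl.
- by rewrite block_mxEur mxE eq_lrshift mul0r.
- by rewrite block_mxEdl mxE eq_rlshift mul0r.
- by rewrite block_mxEdr mxE ir E2 (inj_eq (@rshift_inj _ _)) [RHS]mulr_natl.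
Qed.

Lemma chart_dom_factor z : chart_dom c k m z ->
  forall b, 0 < conformal_factor in_left block_al block_be b z.
Proof.
rewrite /chart_dom/= /hyp_dom/= => zD [].
  by rewrite /conformal_factor block_sqnorm_left /=; lra.
rewrite /conformal_factor block_sqnorm_right /=.
by have := sqnorm_ge0 (rsubmx z); lra.
Qed.

Lemma block_card_left : block_card in_left true = k.+1%:R :> R.
Proof.
rewrite /block_card big_split_ord/= [X in _ + X]big_pred0 ?addr0; last first.
  by move=> i; rewrite /in_left/= ltnNge leq_addr.
rewrite (eq_bigl xpredT) ?sumr_const ?card_ord// => i.
by rewrite /in_left /= ltn_ord.
Qed.

Lemma block_card_right : block_card in_left false = m%:R :> R.
Proof.
rewrite /block_card big_split_ord/= [X in X + _]big_pred0 ?add0r; last first.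
  by move=> i; rewrite /in_left/= ltn_ord.
rewrite (eq_bigl xpredT) ?sumr_const ?card_ord// => i.
by rewrite /in_left /= ltnNge leq_addr.
Qed.

Lemma scalar_curvature_chart b z : chart_dom c k m z ->
  scalar_curvature (chart_metric c b) z =
  - c ^+ 2 * k%:R * k.+1%:R + m%:R * (m%:R - 1).
Proof.
move=> zD; rewrite chart_metric_block scalar_curvature_block; last first.
  by move=> b'; rewrite gt_eqF// chart_dom_factor.
rewrite big_split_ord/=.
rewrite (eq_bigr (fun=> (k.+1%:R - 1) * (4 * 1 * - (c ^+ 2 / 4)))); last first.
  by move=> i _; rewrite /in_left /= ltn_ord block_card_left.
rewrite [X in _ + X](eq_bigr (fun=> (m%:R - 1) * (4 * 2^-1 * 2^-1))); last first.
  by move=> i _; rewrite /in_left /= ltnNge leq_addr /= block_card_right.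
have sc (l : nat) (a : R) : \sum_(i < l) a = l%:R * a.
  by rewrite sumr_const card_ord mulr_natl.
by rewrite !sc -natr1; field.
Qed.

End chart_metric_block.

Section continuous_on_lemmas.
Context {R : realType} {d : nat}.
Implicit Types (D : set 'rV[R]_d) (f g : 'rV[R]_d -> R).

Definition continuous_on D f := forall x, D x -> {for x, continuous f}.

Lemma C1_continuous D f : C1_on D f -> continuous_on D f.
Proof. by move=> h x /h[]. Qed.

Lemma continuous_on_cst D (a : R) : continuous_on D (fun=> a).
Proof. by move=> x _; exact: cst_continuous. Qed.

Lemma continuous_on_add D f g : continuous_on D f -> continuous_on D g ->
  continuous_on D (fun z => f z + g z).
Proof. by move=> hf hg x Dx; apply: continuousD; [exact: hf|exact: hg]. Qed.

Lemma continuous_on_mul D f g : continuous_on D f -> continuous_on D g ->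
  continuous_on D (fun z => f z * g z).
Proof. by move=> hf hg x Dx; apply: continuousM; [exact: hf|exact: hg]. Qed.

Lemma continuous_on_comp D (h : R -> R) f : continuous_on D f ->
  (forall x, D x -> {for f x, continuous h}) ->
  continuous_on D (fun z => h (f z)).
Proof.
by move=> hf hh x Dx; apply: (@continuous_comp _ _ _ f h); [exact: hf|exact: hh].
Qed.

Lemma continuous_on_measurable D f : open D -> continuous_on D f ->
  measurable_fun D f.
Proof. exact: continuous_rV_measurable. Qed.

End continuous_on_lemmas.

Section weights.
Context {R : realType}.

(* [h] is continuously differentiable with derivative [h'] in a neighbourhood of
   the radii s >= 0 satisfying [top], and vanishes beyond an admissible radius. *)
Definition weight (top : R -> Prop) (h h' : R -> R) := exists (E : set R) (r : R),
  [/\ open E, forall s, 0 <= s -> top s -> E s,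
      forall s, E s -> is_derive s 1 h (h' s) /\ {for s, continuous h'},
      top r & forall s, r < s -> top s -> h s = 0].

End weights.

(** * Flat divergence inequalities for products of two radial weights *)

Section weighted_divergence.
Context {R : realType}.
Variables (c : R) (k m : nat).
Local Notation n := (k.+1 + m)%N.
Local Notation D := (chart_dom c k m).
Implicit Types z : 'rV[R]_n.

(* [z] is a point x of the ball, where the metric is [dfac `|x|^2 ^- 2 |dx|^2],
   followed by the stereographic coordinates y of a point of the sphere. *)
Definition xs z : R := sqnorm (lsubmx z).
Definition yt z : R := sqnorm (rsubmx z).
Definition dfac (s : R) := 1 - c ^+ 2 / 4 * s.
Definition ball_top (s : R) : Prop := c ^+ 2 * s < 4.
Definition vol z := (dfac (xs z)) ^- k.+1 * ((1 + yt z) / 2) ^- m.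

Lemma continuous_block_sqnorm b :
  continuous (block_sqnorm (@in_left k m) b : 'rV[R]_n -> R).
Proof. by move=> z; have [] := @C1_block_sqnorm R _ (@in_left k m) _ b openT z I. Qed.

Lemma open_chart_dom : open D.
Proof.
rewrite (_ : D = (fun z => block_sqnorm (@in_left k m) true z) @^-1`
    [set s | c ^+ 2 * s < 4]); last first.
  by apply/seteqP; split=> z /=; rewrite block_sqnorm_left.
apply: open_comp => [z _|]; first exact: continuous_block_sqnorm.
rewrite (_ : [set s | _] = ( *%R (c ^+ 2)) @^-1` [set s | s < 4])//.
by apply: open_comp (@open_lt _ 4) => s _; exact: mulrl_continuous.
Qed.

Lemma is_derive_xs z i :
  is_derive z (delta_mx 0 i) xs (2 * z 0 i * (@in_left k m i)%:R).
Proof.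
have := is_derive_block_sqnorm (@in_left k m) true z i.
rewrite eqb_id (_ : block_sqnorm _ _ = xs)//.
by apply/funext => y; rewrite block_sqnorm_left.
Qed.

Lemma is_derive_yt z i :
  is_derive z (delta_mx 0 i) yt (2 * z 0 i * (~~ @in_left k m i)%:R).
Proof.
have := is_derive_block_sqnorm (@in_left k m) false z i.
rewrite eqbF_neg (_ : block_sqnorm _ _ = yt)//.
by apply/funext => y; rewrite block_sqnorm_right.
Qed.

Lemma C1_xs : C1_on D xs.
Proof.
rewrite (_ : xs = block_sqnorm (@in_left k m) true).
  exact: C1_block_sqnorm open_chart_dom.
by apply/funext => y; rewrite block_sqnorm_left.
Qed.

Lemma C1_yt : C1_on D yt.
Proof.
rewrite (_ : yt = block_sqnorm (@in_left k m) false).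
  exact: C1_block_sqnorm open_chart_dom.
by apply/funext => y; rewrite block_sqnorm_right.
Qed.

Lemma sum_left (z : 'rV[R]_n) :
  \sum_i (@in_left k m i)%:R * z 0 i ^+ 2 = xs z.
Proof.
rewrite /xs -block_sqnorm_left /block_sqnorm [RHS]big_mkcond /=.
by apply: eq_bigr => i _; rewrite eqb_id; case: in_left; rewrite ?mul1r ?mul0r.
Qed.

Lemma sum_right (z : 'rV[R]_n) :
  \sum_i (~~ @in_left k m i)%:R * z 0 i ^+ 2 = yt z.
Proof.
rewrite /yt -block_sqnorm_right /block_sqnorm [RHS]big_mkcond /=.
by apply: eq_bigr => i _; rewrite eqbF_neg; case: in_left; rewrite ?mul1r ?mul0r.
Qed.

Lemma card_left : \sum_i (@in_left k m i)%:R = k.+1%:R :> R.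
Proof.
rewrite -(@block_card_left R k m) /block_card [RHS]big_mkcond /=.
by apply: eq_bigr => i _; rewrite eqb_id; case: in_left.
Qed.

Lemma card_right : \sum_i (~~ @in_left k m i)%:R = m%:R :> R.
Proof.
rewrite -(@block_card_right R k m) /block_card [RHS]big_mkcond /=.
by apply: eq_bigr => i _; rewrite eqbF_neg; case: in_left.
Qed.

Lemma C1_weight (top : R -> Prop) h h' (f : 'rV[R]_n -> R) : C1_on D f ->
  (forall z, D z -> 0 <= f z /\ top (f z)) -> weight top h h' ->
  C1_on D (fun z => h (f z)).
Proof.
move=> Cf fD [E [r [oE E0 hE _ _]]].
apply: (C1_comp open_chart_dom Cf (E := E)).
  by move=> z /fD[f0 ft]; exact: E0.
move=> t Et; have [[d1 _] c1] := hE _ Et; split => //.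
rewrite /prop_for /continuous_at.
have nE : \forall s \near t, h' s = 'D_1 h s.
  have : open_nbhs t E by [].
  by move=> /open_nbhs_nbhs; apply: filterS => s /hE[[_ <-]].
rewrite -(nbhs_singleton nE); apply: cvg_trans c1; exact: (near_eq_cvg nE).
Qed.

Lemma xs_range z : D z -> 0 <= xs z /\ ball_top (xs z).
Proof. by move=> Dz; split; [exact: sqnorm_ge0|]. Qed.

Lemma yt_range z : D z -> 0 <= yt z /\ True.
Proof. by move=> Dz; split => //; exact: sqnorm_ge0. Qed.

Variables (A A' B B' : R -> R).
Hypothesis wA : weight ball_top A A'.
Hypothesis wB : weight (fun=> True) B B'.

Definition prodw z := A (xs z) * B (yt z).

Lemma C1_prodw : C1_on D prodw.
Proof.
apply: C1_mul open_chart_dom _ _.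
  exact: C1_weight C1_xs xs_range wA.
exact: C1_weight C1_yt yt_range wB.
Qed.

Lemma partial_prodw z i : D z -> partial i prodw z =
  2 * z 0 i * ((@in_left k m i)%:R * (A' (xs z) * B (yt z))
             + (~~ @in_left k m i)%:R * (A (xs z) * B' (yt z))).
Proof.
move=> Dz; have [E [r [_ E0 hE _ _]]] := wA; have [E2 [r2 [_ E20 hE2 _ _]]] := wB.
have [x0 xt] := xs_range Dz; have [y0 yy] := yt_range Dz.
have [dA _] := hE _ (E0 _ x0 xt); have [dB _] := hE2 _ (E20 _ y0 yy).
have [_ Ep] := is_derive_mul (is_derive_comp_real (is_derive_xs z i) dA)
   (is_derive_comp_real (is_derive_yt z i) dB).
apply: etrans Ep _ => /=; ring.
Qed.

Lemma prodw_support : exists (K : set 'rV[R]_n) (M : R),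
  [/\ closed K, K `<=` D, K `<=` box M & forall z, D z -> ~ K z -> prodw z = 0].
Proof.
have [E [r [_ _ _ tr Ar]]] := wA; have [E2 [r2 [_ _ _ _ Br]]] := wB.
exists [set z | xs z <= r /\ yt z <= r2], (1 + (`|r| + `|r2|)); split.
- rewrite (_ : [set z | _] = (fun z => block_sqnorm (@in_left k m) true z) @^-1`
    [set s | s <= r] `&` (fun z => block_sqnorm (@in_left k m) false z) @^-1`
    [set s | s <= r2]); last first.
    by apply/seteqP; split=> z /=; rewrite block_sqnorm_left block_sqnorm_right.
  by apply: closedI; apply: closed_comp (@closed_le _ _) => z _;
    exact: continuous_block_sqnorm.
- move=> z [zr _]; rewrite /chart_dom/= /hyp_dom/=; apply: le_lt_trans tr.
  by rewrite ler_wpM2l// sqr_ge0.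
- move=> z [zr zr2] i.
  have : z 0 i ^+ 2 <= xs z + yt z.
    rewrite -sum_left -sum_right -big_split/= (bigD1 i)//= -mulrDl.
    rewrite (_ : _%:R + _%:R = 1); last by case: in_left; rewrite ?addr0 ?add0r.
    rewrite mul1r lerDl sumr_ge0// => j _.
    by rewrite -mulrDl mulr_ge0 ?sqr_ge0// addr_ge0.
  have := ler_norm r; have := ler_norm r2.
  (* [2 v <= 1 + v^2] turns the bound on [z_i^2] into one on [|z_i|]; this is the 1 in the size of
     the box. *)
  have : 0 <= (`|z 0 i| - 1) ^+ 2 by exact: sqr_ge0.
  have := normr_ge0 (z 0 i); rewrite -[X in X <= xs z + _](real_normK (num_real _)).
  move: `|z 0 i| => v; rewrite expr2 => *; nra.
- move=> z Dz nK; rewrite /prodw.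
  have [zr|zr] := ltP r (xs z).
    by rewrite Ar ?mul0r//; have [] := xs_range Dz.
  have [zr2|zr2] := ltP r2 (yt z); first by rewrite Br ?mulr0.
  by exfalso; apply: nK.
Qed.

(** The added term is minus the flat divergence of [- x A(|x|^2) B(|y|^2)], x being the ball
    coordinates and y the stereographic ones. Powers of the conformal factors inside [A] and [B]
    carry the volume density, so the metric does not appear. *)
Lemma radial_ineq_left (G1 G2 : 'rV[R]_n -> R) :
  measurable_fun D G1 -> measurable_fun D G2 ->
  (forall z, D z -> 0 <= G1 z) -> (forall z, D z -> 0 <= G2 z) ->
  (forall z, D z -> G1 z + B (yt z) *
     (k.+1%:R * A (xs z) + 2 * xs z * A' (xs z)) <= G2 z) ->
  (\int[@lebesgue_rV R n]_(z in D) (G1 z)%:E <=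
   \int[@lebesgue_rV R n]_(z in D) (G2 z)%:E)%E.
Proof.
move=> mG1 mG2 G10 G20 G12; have [K [M [cK KD KM K0]]] := prodw_support.
pose Z i z := - (@in_left k m i)%:R * z 0 i * prodw z.
have CZ i : C1_on D (Z i).
  apply: C1_mul open_chart_dom _ C1_prodw.
  apply: C1_mul open_chart_dom (C1_cst _ open_chart_dom) _.
  exact: C1_coord open_chart_dom.
apply: (le_integral_divergence open_chart_dom cK KD KM CZ) => //.
  by move=> i z Dz Kz; rewrite /Z K0// mulr0.
apply: aeW => z Dz.
have -> : \sum_i partial i (Z i) z =
   - (B (yt z) * (k.+1%:R * A (xs z) + 2 * xs z * A' (xs z))); last first.
  by have := G12 z Dz; lra.
have pZ i : partial i (Z i) z = - (@in_left k m i)%:R * prodw z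
   - (@in_left k m i)%:R * z 0 i ^+ 2 * (2 * A' (xs z) * B (yt z)).
  have [_ E] := is_derive_mul (is_derive_mul
    (is_derive_cst (- (@in_left k m i)%:R : R) z (delta_mx 0 i))
    (is_derive_coord z (delta_mx 0 i) i)) (C1_is_derive i C1_prodw Dz).
  apply: etrans E _; rewrite partial_prodw// mxE !eqxx /=.
  by case: in_left => /=; ring.
rewrite (eq_bigr _ (fun i _ => pZ i)) sumrB -!mulr_suml sumrN card_left sum_left.
rewrite /prodw; ring.
Qed.

Lemma radial_ineq_right (G1 G2 : 'rV[R]_n -> R) :
  measurable_fun D G1 -> measurable_fun D G2 ->
  (forall z, D z -> 0 <= G1 z) -> (forall z, D z -> 0 <= G2 z) ->
  (forall z, D z -> G1 z + A (xs z) *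
     (m%:R * B (yt z) + 2 * yt z * B' (yt z)) <= G2 z) ->
  (\int[@lebesgue_rV R n]_(z in D) (G1 z)%:E <=
   \int[@lebesgue_rV R n]_(z in D) (G2 z)%:E)%E.
Proof.
move=> mG1 mG2 G10 G20 G12; have [K [M [cK KD KM K0]]] := prodw_support.
pose Z i z := - (~~ @in_left k m i)%:R * z 0 i * prodw z.
have CZ i : C1_on D (Z i).
  apply: C1_mul open_chart_dom _ C1_prodw.
  apply: C1_mul open_chart_dom (C1_cst _ open_chart_dom) _.
  exact: C1_coord open_chart_dom.
apply: (le_integral_divergence open_chart_dom cK KD KM CZ) => //.
  by move=> i z Dz Kz; rewrite /Z K0// mulr0.
apply: aeW => z Dz.
have -> : \sum_i partial i (Z i) z =
   - (A (xs z) * (m%:R * B (yt z) + 2 * yt z * B' (yt z))); last first.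
  by have := G12 z Dz; lra.
have pZ i : partial i (Z i) z = - (~~ @in_left k m i)%:R * prodw z
   - (~~ @in_left k m i)%:R * z 0 i ^+ 2 * (2 * A (xs z) * B' (yt z)).
  have [_ E] := is_derive_mul (is_derive_mul
    (is_derive_cst (- (~~ @in_left k m i)%:R : R) z (delta_mx 0 i))
    (is_derive_coord z (delta_mx 0 i) i)) (C1_is_derive i C1_prodw Dz).
  apply: etrans E _; rewrite partial_prodw// mxE !eqxx /=.
  by case: in_left => /=; ring.
rewrite (eq_bigr _ (fun i _ => pZ i)) sumrB -!mulr_suml sumrN card_right sum_right.
rewrite /prodw; ring.
Qed.

End weighted_divergence.

(** * Energy inequality *)

Section more_C1.
Context {R : realType} {d : nat}.
Implicit Types (D : set 'rV[R]_d) (f : 'rV[R]_d -> R).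

Lemma continuous_inv_on D f : continuous_on D f -> (forall z, D z -> f z != 0) ->
  continuous_on D (fun z => (f z)^-1).
Proof. by move=> cf f0 z Dz; exact: (cvgV (f0 z Dz) (cf z Dz)). Qed.

Lemma C1_inv D f : open D -> C1_on D f -> (forall z, D z -> f z != 0) ->
  C1_on D (fun z => (f z)^-1).
Proof.
move=> oD Cf f0; apply: (@C1_onP _ _ _ _
  (fun i z => - (f z) ^- 2 * partial i f z)) => //.
move=> z Dz; have ci := continuous_inv_on (C1_continuous Cf) f0.
split; first exact: ci.
move=> i; split; first exact: is_derive_inv (f0 z Dz) (C1_is_derive i Cf Dz).
apply: continuousM; last by have [_ /(_ i)[]] := Cf z Dz.
apply: continuousN; rewrite /prop_for (_ : (fun z => _) = fun z => (f z)^-1 * (f z)^-1).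
  exact: (continuous_on_mul ci ci Dz).
by apply/funext => y; rewrite expr2 invfM.
Qed.

Lemma C1_pow D f j : open D -> C1_on D f -> C1_on D (fun z => f z ^+ j).
Proof.
move=> oD Cf; elim: j => [|j IH]; first exact: C1_cst.
by apply: eq_C1 (C1_mul oD Cf IH) => // z _; rewrite exprS.
Qed.

Lemma C1_invpow D f j : open D -> C1_on D f -> (forall z, D z -> f z != 0) ->
  C1_on D (fun z => f z ^- j).
Proof.
move=> oD Cf f0; apply: (C1_inv oD (C1_pow _ oD Cf)) => z Dz.
by rewrite expf_neq0// f0.
Qed.

End more_C1.

(** The two sides differ by [P (f u + f U p / (2 P) + q U)^2]. It is used with [f] the conformal
    factor, [u] and [p] the partial derivatives of [U] and [P], and [q * f] a component of the field
    Y. For [P = 0] both sides vanish, a quotient by 0 being 0. *)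
Lemma completed_square (R : realType) (P p f u U q : R) : 0 <= P ->
  (P = 0 -> p = 0) ->
  - (f ^+ 2 * U ^+ 2 * p ^+ 2 / (4 * P) + q ^+ 2 * P * U ^+ 2) <=
  f ^+ 2 * u * (P * u + U * p) + q * f * (U ^+ 2 * p + 2 * P * U * u).
Proof.
rewrite le_eqVlt => /predU1P[<- /(_ erefl) ->|P0 _].
  by rewrite !(mulr0, mul0r, addr0, expr0n, oppr0)//=.
rewrite -subr_ge0 (_ : _ - _ = P * (f * u + f * U * p / (2 * P) + q * U) ^+ 2).
  by rewrite mulr_ge0 ?sqr_ge0// ltW.
by field; rewrite gt_eqF.
Qed.

Section energy.
Context {R : realType}.
Variables (c : R) (k m : nat).
Local Notation n := (k.+1 + m)%N.
Local Notation D := (chart_dom c k m).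
Implicit Types z : 'rV[R]_n.
Local Notation xs := (@xs R k m).
Local Notation yt := (@yt R k m).
Local Notation vol := (@vol R c k m).

Lemma factor_left z :
  conformal_factor (@in_left k m) block_al (block_be c) true z = dfac c (xs z).
Proof. by rewrite /conformal_factor block_sqnorm_left /dfac /xs /=; ring. Qed.

Lemma factor_right z :
  conformal_factor (@in_left k m) block_al (block_be c) false z = (1 + yt z) / 2.
Proof. by rewrite /conformal_factor block_sqnorm_right /yt /=; field. Qed.

Lemma prod_factorV z : \prod_(i < n)
  (conformal_factor (@in_left k m) block_al (block_be c) (in_left i) z)^-1 = vol z.
Proof.
rewrite big_split_ord/=.
rewrite (eq_bigr (fun=> (dfac c (xs z))^-1)); last first.
  by move=> i _; rewrite /in_left /= ltn_ord factor_left.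
rewrite [X in _ * X](eq_bigr (fun=> ((1 + yt z) / 2)^-1)); last first.
  by move=> i _; rewrite /in_left /= ltnNge leq_addr /= factor_right.
by rewrite !prodr_const !card_ord !exprVn.
Qed.

Lemma dfac_gt0 z : D z -> 0 < dfac c (xs z).
Proof. by move=> /chart_dom_factor/(_ true); rewrite factor_left. Qed.

Lemma hfac_gt0 z : 0 < (1 + yt z) / 2.
Proof. by rewrite divr_gt0// ltr_pwDl// sqnorm_ge0. Qed.

Lemma vol_gt0 z : D z -> 0 < vol z.
Proof.
move=> Dz; rewrite /vol mulr_gt0// invr_gt0 exprn_gt0//.
  exact: dfac_gt0.
exact: hfac_gt0.
Qed.

Lemma volume_density_vol b z : D z -> volume_density (chart_metric c b) z = vol z.
Proof.
move=> Dz; rewrite chart_metric_block volume_density_block ?prod_factorV//.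
exact: chart_dom_factor.
Qed.

Lemma C1_dfac : C1_on D (fun z => dfac c (xs z)).
Proof.
apply: eq_C1 (C1_conformal_factor (@in_left k m) block_al (block_be c) true _).
- exact: open_chart_dom.
- by move=> z _; rewrite factor_left.
- exact: open_chart_dom.
Qed.

Lemma C1_hfac : C1_on D (fun z => (1 + yt z) / 2).
Proof.
apply: eq_C1 (C1_conformal_factor (@in_left k m) block_al (block_be c) false _).
- exact: open_chart_dom.
- by move=> z _; rewrite factor_right.
- exact: open_chart_dom.
Qed.

Lemma C1_dhpow j l : C1_on D (fun z => dfac c (xs z) ^- j * ((1 + yt z) / 2) ^- l).
Proof.
have oD := @open_chart_dom R c k m.
apply: (C1_mul oD); apply: (C1_invpow _ oD).
- exact: C1_dfac.
- by move=> z /dfac_gt0; rewrite lt0r => /andP[].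
- exact: C1_hfac.
- by move=> z _; have := hfac_gt0 z; rewrite lt0r => /andP[].
Qed.

Definition fac (i : 'I_n) z := if in_left i then dfac c (xs z) else (1 + yt z) / 2.

Lemma factorE i z :
  conformal_factor (@in_left k m) block_al (block_be c) (in_left i) z = fac i z.
Proof.
by rewrite /fac; case: (@in_left k m i); rewrite (factor_left, factor_right).
Qed.

Lemma C1_fac i : C1_on D (fac i).
Proof. by rewrite /fac; case: (@in_left k m i); [exact: C1_dfac|exact: C1_hfac]. Qed.

Lemma conformal_laplacian_chart b (f : 'rV[R]_n -> R) z : D z ->
  yamabe_coef n * \sum_i partial i (fun y => vol y * (fac i y ^+ 2 * partial i f y)) z
  = vol z * ((- c ^+ 2 * k%:R * k.+1%:R + m%:R * (m%:R - 1)) * f z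
             - conformal_laplacian (chart_metric c b) f z).
Proof.
move=> Dz; rewrite /conformal_laplacian scalar_curvature_chart//.
rewrite chart_metric_block (laplacian_block f (@open_chart_dom R c k m) Dz); last first.
  by move=> y; exact: chart_dom_factor.
pose w b := conformal_factor (@in_left k m) block_al (block_be c) b.
have -> : \prod_(i < n) w (in_left i) z = (vol z)^-1.
  by rewrite -prod_factorV -prodfV; apply: eq_bigr => i _; rewrite invrK.
have -> : \sum_(i < n) partial i (fun y =>
    (\prod_(j < n) (w (@in_left k m j) y)^-1) *
    (w (in_left i) y ^+ 2 * partial i f y)) z =
    \sum_i partial i (fun y => vol y * (fac i y ^+ 2 * partial i f y)) z.
  apply: eq_bigr => i _; congr (partial i _ z); apply/funext => y.
  by rewrite /w prod_factorV factorE.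
have := vol_gt0 Dz; rewrite lt0r => /andP[v0 _].
by field.
Qed.

Variables (A A' B B' : R -> R).
Hypothesis wA : weight (ball_top c) A A'.
Hypothesis wB : weight (fun=> True) B B'.
Hypothesis A_ge0 : forall s, 0 <= A s.
Hypothesis B_ge0 : forall t, 0 <= B t.
Hypothesis A'_eq0 : forall s, A s = 0 -> A' s = 0.
Hypothesis B'_eq0 : forall t, B t = 0 -> B' t = 0.

Local Notation P := (@prodw R k m A B).

Lemma prodw_ge0 z : 0 <= P z.
Proof. by rewrite mulr_ge0. Qed.

Lemma partial_prodw_eq0 i z : D z -> P z = 0 -> partial i P z = 0.
Proof.
move=> Dz /eqP; rewrite (partial_prodw wA wB)// /prodw mulf_eq0.
by move=> /orP[] /eqP E; [rewrite (A'_eq0 E)|rewrite (B'_eq0 E)]; rewrite E; ring.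
Qed.

(* |grad P|^2 / (4 P) for the chart metric; the junk value x / 0 = 0 is the right
   one since grad P vanishes with P. *)
Definition prodw_energy z :=
  dfac c (xs z) ^+ 2 * xs z * (A' (xs z) ^+ 2 / A (xs z)) * B (yt z)
  + ((1 + yt z) / 2) ^+ 2 * yt z * (B' (yt z) ^+ 2 / B (yt z)) * A (xs z).

Lemma sum_partial_prodw z : D z ->
  \sum_i fac i z ^+ 2 * (partial i P z) ^+ 2 / (4 * P z) = prodw_energy z.
Proof.
move=> Dz; rewrite /prodw_energy.
rewrite (eq_bigr (fun i =>
  (dfac c (xs z) ^+ 2 * (A' (xs z) ^+ 2 / A (xs z)) * B (yt z)) *
    ((in_left i)%:R * z 0 i ^+ 2)
  + (((1 + yt z) / 2) ^+ 2 * (B' (yt z) ^+ 2 / B (yt z)) * A (xs z)) *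
     ((~~ in_left i)%:R * z 0 i ^+ 2))).
  rewrite big_split/= -!mulr_sumr sum_left sum_right; ring.
move=> i _; rewrite (partial_prodw wA wB)// /fac /prodw.
have [->|A0] := eqVneq (A (xs z)) 0.
  rewrite !(mul0r, mulr0, invr0).
  by case: (@in_left k m i); rewrite /= ?(mul0r, mulr0, addr0, invr0).
have [->|B0] := eqVneq (B (yt z)) 0.
  rewrite !(mul0r, mulr0, invr0).
  by case: (@in_left k m i); rewrite /= ?(mul0r, mulr0, addr0, invr0).
by case: (@in_left k m i) => /=; field; rewrite A0 B0.
Qed.

Variable U : 'rV[R]_n -> R.
Hypothesis U_smooth : smooth_on D U.

Lemma C1_U : C1_on D U.
Proof.
move=> z Dz; have [cU dU] := U_smooth [::] Dz; split; first exact: cU.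
move=> i; have [ciU _] := U_smooth [:: i] Dz.
by split; [exact: (dU i)|exact: ciU].
Qed.

Lemma C1_partialU i : C1_on D (partial i U).
Proof.
move=> z Dz; have [cU dU] := U_smooth [:: i] Dz; split; first exact: cU.
move=> j; have [ciU _] := U_smooth [:: j; i] Dz.
by split; [exact: (dU j)|exact: ciU].
Qed.

(* vol * (P U grad U + P U^2 Y) for Y = (k c^2 / 4) F x, F = dfac (|x|^2), a field
   such that div Y - |Y|^2 = (k c^2 / 4) (k + F) >= k^2 c^2 / 4. *)
Definition energy_field i z := (vol z * (fac i z ^+ 2 * partial i U z)) * (P z * U z)
  + (k%:R * c ^+ 2 / 4 * (in_left i)%:R) *
    (dfac c (xs z) ^- k * ((1 + yt z) / 2) ^- m * z 0 i * (P z * U z ^+ 2)).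

Let oD : open D := @open_chart_dom R c k m.

Lemma C1_flux i : C1_on D (fun z => vol z * (fac i z ^+ 2 * partial i U z)).
Proof.
apply: (C1_mul oD); first exact: C1_dhpow.
apply: (C1_mul oD); last exact: C1_partialU.
apply: (C1_pow _ oD); exact: C1_fac.
Qed.

Lemma C1_energy_field i : C1_on D (energy_field i).
Proof.
apply: (C1_add oD); apply: (C1_mul oD); first exact: C1_flux.
- by apply: (C1_mul oD); [exact: (C1_prodw wA wB)|exact: C1_U].
- exact: C1_cst.
- apply: (C1_mul oD).
    by apply: (C1_mul oD); [exact: C1_dhpow|exact: C1_coord].
  apply: (C1_mul oD); first exact: (C1_prodw wA wB).
  by apply: (C1_pow _ oD); exact: C1_U.
Qed.

(** Removes the truncated predecessor, which [field] cannot treat; at [j = 0] both sides are 0. *)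
Lemma natr_pow_pred (j : nat) (x : R) : x != 0 ->
  j%:R * x ^+ j.-1 = j%:R * x ^+ j / x.
Proof. by case: j => [|j] x0 /=; rewrite ?mul0r// exprSr mulrA mulfK. Qed.

Lemma is_derive_radial_flux i z : D z -> @in_left k m i ->
  is_derive z (delta_mx 0 i)
    (fun y => dfac c (xs y) ^- k * ((1 + yt y) / 2) ^- m * y 0 i)
    (vol z * (dfac c (xs z) + k%:R * c ^+ 2 / 2 * z 0 i ^+ 2)).
Proof.
move=> Dz il.
have cst_ (a : R) : is_derive z (delta_mx 0 i) (fun=> a) 0 by exact: is_derive_cst.
have F0 : dfac c (xs z) != 0 by have := dfac_gt0 Dz; rewrite lt0r => /andP[].
have H0 : (1 + yt z) / 2 != 0 by have := hfac_gt0 z; rewrite lt0r => /andP[].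
have dFx := is_derive_add (cst_ 1)
      (is_derive_mul (cst_ (- (c ^+ 2 / 4))) (is_derive_xs z i)).
have E1 : (fun y => 1 + - (c ^+ 2 / 4) * xs y) = (fun y => dfac c (xs y)).
  by apply/funext => y; rewrite /dfac mulNr.
rewrite E1 in dFx.
have dH := is_derive_mul (is_derive_add (cst_ 1) (is_derive_yt z i)) (cst_ 2^-1).
have dFk := @is_derive_inv _ _ (fun y => dfac c (xs y) ^+ k) _ _ _
  (expf_neq0 k F0) (is_derive_pow k dFx).
have dHm := @is_derive_inv _ _ (fun y => ((1 + yt y) / 2) ^+ m) _ _ _
  (expf_neq0 m H0) (is_derive_pow m dH).
apply: is_derive_eq_val (is_derive_mul (is_derive_mul dFk dHm)
  (is_derive_coord z (delta_mx 0 i) i)) _.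
rewrite mxE !eqxx il /= /vol [dfac _ _ ^+ k.+1]exprS.
have := expf_neq0 m H0; set Hm := _ ^+ m => Hm0.
rewrite !(mulr0, mul0r, addr0, add0r, mulr1) (natr_pow_pred k F0).
have := expf_neq0 k F0; set Fk := _ ^+ k => Fk0.
by field; rewrite F0 Fk0 Hm0.
Qed.

Lemma partial_energy_field i z : D z -> partial i (energy_field i) z =
  P z * U z * partial i (fun y => vol y * (fac i y ^+ 2 * partial i U y)) z
  + vol z * fac i z ^+ 2 * partial i U z *
      (P z * partial i U z + U z * partial i P z)
  + k%:R * c ^+ 2 / 4 * (in_left i)%:R * vol z *
    ((dfac c (xs z) + k%:R * c ^+ 2 / 2 * z 0 i ^+ 2) * (P z * U z ^+ 2)
     + dfac c (xs z) * z 0 i * (U z ^+ 2 * partial i P z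
                                + 2 * P z * U z * partial i U z)).
Proof.
move=> Dz; have dU := C1_is_derive i C1_U Dz.
have dP := C1_is_derive i (C1_prodw wA wB) Dz.
have dF := C1_is_derive i (C1_flux i) Dz.
have cst_ (a : R) : is_derive z (delta_mx 0 i) (fun=> a) 0 by exact: is_derive_cst.
have dF1 := is_derive_mul dF (is_derive_mul dP dU).
have F0 : dfac c (xs z) != 0 by have := dfac_gt0 Dz; rewrite lt0r => /andP[].
have H0 : (1 + yt z) / 2 != 0 by have := hfac_gt0 z; rewrite lt0r => /andP[].
have [il|il] := boolP (@in_left k m i).
  have [_ E] := is_derive_add dF1
    (is_derive_mul (cst_ (k%:R * c ^+ 2 / 4 * 1))
      (is_derive_mul (is_derive_radial_flux Dz il)
       (is_derive_mul dP (is_derive_mul dU dU)))).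
  rewrite /energy_field il; apply: etrans E _.
  rewrite /vol [dfac _ _ ^+ k.+1]exprS.
  have := expf_neq0 m H0; set Hm := _ ^+ m => Hm0.
  have := expf_neq0 k F0; set Fk := _ ^+ k => Fk0 /=.
  by field; rewrite F0 Fk0 Hm0.
have [_ E] := is_derive_add dF1 (cst_ 0).
rewrite /energy_field (negbTE il) /= mulr0.
rewrite (_ : (fun z0 => _) = fun z0 => vol z0 * (fac i z0 ^+ 2 * partial i U z0)
   * (P z0 * U z0) + 0); last by apply/funext => y; rewrite mul0r.
by apply: etrans E _; ring.
Qed.

Lemma energy_divergence_ge z : D z ->
  P z * U z * (\sum_i partial i (fun y => vol y * (fac i y ^+ 2 * partial i U y)) z)
  + vol z * (P z * U z ^+ 2 * (k%:R ^+ 2 * c ^+ 2 / 4) - U z ^+ 2 * prodw_energy z)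
  <= \sum_i partial i (energy_field i) z.
Proof.
move=> Dz.
(* Component of Y in the orthonormal frame made of [fac i] times the i-th coordinate field. *)
pose q i : R := k%:R * c ^+ 2 / 4 * z 0 i * (in_left i)%:R.
have V0 := vol_gt0 Dz; have F0 := dfac_gt0 Dz.
have step i : P z * U z * partial i (fun y => vol y * (fac i y ^+ 2 * partial i U y)) z
  - vol z * U z ^+ 2 * (fac i z ^+ 2 * (partial i P z) ^+ 2 / (4 * P z))
  + vol z * P z * U z ^+ 2 * (k%:R * c ^+ 2 / 4) *
     (dfac c (xs z) * (in_left i)%:R
       + k%:R * c ^+ 2 / 4 * ((in_left i)%:R * z 0 i ^+ 2)) <=
  partial i (energy_field i) z.
  rewrite partial_energy_field//.
  have := @completed_square _ (P z) (partial i P z) (fac i z) (partial i U z)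
    (U z) (q i)
    (prodw_ge0 z) (partial_prodw_eq0 i Dz).
  rewrite -subr_ge0 => /(mulr_ge0 (ltW V0)).
  rewrite -(subr_ge0 _ (_ + _)) => /le_trans; apply.
  rewrite le_eqVlt; apply/orP; left; apply/eqP.
  (* [P z] may be 0, so its inverse is generalized: the identity is linear in it and holds for any
     value. *)
  by rewrite /q /fac; case: (@in_left k m i) => /=; move: (4 * P z)^-1 => v; field.
rewrite -sum_partial_prodw//.
apply: le_trans (ler_sum _ (fun i _ => step i)).
rewrite big_split/= sumrB -!mulr_sumr big_split/= -!mulr_sumr card_left sum_left.
rewrite -subr_ge0.
have PU0 : 0 <= vol z * P z * U z ^+ 2.
  by rewrite mulr_ge0 ?sqr_ge0// mulr_ge0 ?prodw_ge0// ltW.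
set SL := \sum_i _; set SE := \sum_i _.
have k0 : 0 <= k%:R :> R by [].
have := mulr_ge0 (mulr_ge0 PU0 (mulr_ge0 k0 (sqr_ge0 c))) (ltW F0).
rewrite -natr1; move: F0; rewrite /dfac => F0 h.
apply: le_trans (_ : 0 <= vol z * P z * U z ^+ 2 * (k%:R * c ^+ 2) *
   (1 - c ^+ 2 / 4 * xs z) / 4) _; first by rewrite divr_ge0// mulrA.
by rewrite le_eqVlt; apply/orP; left; apply/eqP; field.
Qed.

Variable mu : R.
Hypothesis n3 : (3 <= n)%N.
Hypothesis U_eq : forall z, D z -> conformal_laplacian (chart_metric c false) U z =
  mu * U z `^ (yamabe_exp n - 1).

Lemma yamabe_coef_gt0 : 0 < yamabe_coef n :> R.
Proof.
have n3R : 3 <= n%:R :> R by rewrite (ler_nat R 3).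
by rewrite /yamabe_coef divr_gt0 ?mulr_gt0//; lra.
Qed.

(** The equation tested against P U, in integrated form. [G1] and [G2] are left free so that the
    error terms can be moved to the right pointwise, before integrating. *)
Lemma energy_ineq (G1 G2 : 'rV[R]_n -> R) :
  measurable_fun D G1 -> measurable_fun D G2 ->
  (forall z, D z -> 0 <= G1 z) -> (forall z, D z -> 0 <= G2 z) ->
  {ae @lebesgue_rV R n, forall z, D z -> G1 z <= vol z *
    (P z * ((- c ^+ 2 * k%:R * k.+1%:R + m%:R * (m%:R - 1)
               + yamabe_coef n * (k%:R ^+ 2 * c ^+ 2 / 4)) * U z ^+ 2
            - mu * (U z * U z `^ (yamabe_exp n - 1)))
     - yamabe_coef n * U z ^+ 2 * prodw_energy z) + G2 z} ->
  (\int[@lebesgue_rV R n]_(z in D) (G1 z)%:E <=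
   \int[@lebesgue_rV R n]_(z in D) (G2 z)%:E)%E.
Proof.
move=> mG1 mG2 G10 G20 G12; have [K [M [cK KD KM K0]]] := prodw_support k m wA wB.
pose Z i z := yamabe_coef n * energy_field i z.
have CZ i : C1_on D (Z i).
  by apply: C1_mul => //; [exact: C1_cst|exact: C1_energy_field].
apply: (le_integral_divergence oD cK KD KM CZ) => //.
  by move=> i z Dz Kz; rewrite /Z /energy_field K0// !mul0r !mulr0 addr0 mulr0.
apply: filterS G12 => z G12 Dz; apply: le_trans (G12 Dz) _; rewrite lerD2r.
have -> : \sum_i partial i (Z i) z =
    yamabe_coef n * \sum_i partial i (energy_field i) z.
  rewrite mulr_sumr; apply: eq_bigr => i _.
  have [_ E] := is_derive_mul (is_derive_cst (yamabe_coef n : R) z (delta_mx 0 i))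
    (C1_is_derive i (C1_energy_field i) Dz).
  by apply: etrans E _; rewrite /= mulr0 addr0.
apply: le_trans (ler_wpM2l (ltW yamabe_coef_gt0) (energy_divergence_ge Dz)).
rewrite [leRHS]mulrDr (mulrCA _ (P z * U z)).
rewrite (conformal_laplacian_chart false U Dz) U_eq//.
by rewrite le_eqVlt; apply/orP; left; apply/eqP; ring.
Qed.

End energy.

(** * Cutoff weights *)

Section cutoff.
Context {R : realType}.
Implicit Types (v t s L b eta : R).

Definition pp v : R := Num.max 0 v.

Lemma pp_ge0 v : 0 <= pp v.
Proof. by rewrite /pp le_max lexx. Qed.

Lemma pp_le1 v : v <= 1 -> pp v <= 1.
Proof. by move=> v1; rewrite /pp ge_max ler01. Qed.

Lemma ppE v : 0 <= v -> pp v = v.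
Proof. by move=> v0; rewrite /pp max_r. Qed.

Lemma pp_eq0 v : v <= 0 -> pp v = 0.
Proof. by move=> v0; rewrite /pp max_l. Qed.

Lemma continuous_pp : continuous pp.
Proof.
move=> v; apply: (@continuous_max _ _ (cst 0) id); first exact: cst_continuous.
exact: cvg_id.
Qed.

(** Reason for squaring the cutoffs: the square of the positive part is C1, and the quotient h'^2 /
    h occurring in the energy stays bounded up to the edge of the support. *)
Lemma is_derive_pp2 v : is_derive v 1 (fun t => pp t ^+ 2) (2 * pp v).
Proof.
have [v0|v0|v0] := ltgtP v 0.
- have nE : \forall t \near v, 0 = pp t ^+ 2.
    have : open_nbhs v [set t | t < 0] by split => //; exact: open_lt.
    move=> /open_nbhs_nbhs; apply: filterS => t /= t0.
    by rewrite pp_eq0 ?expr0n// ltW.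
  apply: (near_eq_is_derive nE); rewrite pp_eq0 ?mulr0; last exact: ltW.
  exact: is_derive_cst.
- have nE : \forall t \near v, t * t = pp t ^+ 2.
    have : open_nbhs v [set t | 0 < t] by split => //; exact: open_gt.
    move=> /open_nbhs_nbhs; apply: filterS => t /= t0.
    by rewrite ppE ?expr2// ltW.
  apply: (near_eq_is_derive nE); rewrite ppE; last exact: ltW.
  apply: is_derive_eq_val (is_derive_mul (is_derive_id v 1) (is_derive_id v 1)) _.
  ring.
- rewrite v0 pp_eq0// mulr0.
  have n0 : (fun h : R => `|h|) @ 0^' --> (0 : R).
    have := @norm_continuous _ R 0; rewrite /continuous_at normr0 => h.
    exact: cvg_within_filter.
  (* At 0 the difference quotient is [pp h ^+ 2 / h], squeezed between [- |h|] and [|h|]. *)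
  have H : (fun h => h^-1 *: (((fun t => pp t ^+ 2) \o shift 0) (h *: 1) - pp 0 ^+ 2))
      @ 0^' --> (0 : R).
    apply: (@squeeze_cvgr _ _ _ _ (fun h => - `|h|) (fun h => `|h|)).
    + near=> h; have h0 : h != 0 by near: h; exact: nbhs_dnbhs_neq.
      rewrite /= addr0 (pp_eq0 (lexx 0)) expr0n subr0 -ler_norml.
      rewrite -[h *: 1]/(h * 1) -[_ *: _]/(h^-1 * _) mulr1.
      rewrite normrM normfV ler_pdivrMl ?normr_gt0// -normrM -expr2.
      rewrite !ger0_norm ?sqr_ge0//; have [h1|h1] := leP 0 h; first by rewrite ppE.
      by rewrite pp_eq0 ?expr0n ?sqr_ge0// ltW.
    + by rewrite -[X in _ --> X]oppr0; exact: cvgN.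
    + exact: n0.
  by split; [apply/cvg_ex; exists 0|exact: cvg_lim H].
Unshelve. all: by end_near. Qed.

Lemma is_derive_ln_comp (f : R -> R) t df : 0 < f t -> is_derive t 1 f df ->
  is_derive t 1 (fun s => ln (f s)) ((f t)^-1 * df).
Proof.
move=> f0 hf; apply: (@is_derive_comp_real _ _ (@ln R) f) => //.
exact: is_derive1_ln.
Qed.

Lemma continuous_real_pow (f : R -> R) t j : {for t, continuous f} ->
  {for t, continuous (fun s => f s ^+ j)}.
Proof.
move=> cf; elim: j => [|j IH]; first exact: cst_continuous.
rewrite (_ : (fun s => _) = fun s => f s * f s ^+ j); first exact: continuousM.
by apply/funext => s; rewrite exprS.
Qed.

Lemma continuous_real_invpow (f : R -> R) t j : f t != 0 ->
  {for t, continuous f} -> {for t, continuous (fun s => f s ^- j)}.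
Proof.
move=> f0 cf; apply: (@cvgV _ _ _ _ (fun s => f s ^+ j)).
  by rewrite expf_neq0.
exact: continuous_real_pow.
Qed.

Lemma is_derive_continuous (f : R -> R) t df : is_derive t 1 f df ->
  {for t, continuous f}.
Proof. by case=> d _; apply: differentiable_continuous; apply/derivable1_diffP. Qed.

(** A logarithmic cutoff near the missing pole, times a power: [j = m] carries the volume density of
    the sphere up to the factor [2 ^+ m], [j = m.-1] is the flux that controls the capacity of the
    pole, and [j = 0] is the cutoff in the test weight. *)
Definition hy (j : nat) L t : R := (1 + t) ^- j * pp (1 - ln (1 + t) / L) ^+ 2.

Definition hy' (j : nat) L t : R :=
  - (j%:R * (1 + t) ^- j.+1 * pp (1 - ln (1 + t) / L) ^+ 2
     + 2 * (1 + t) ^- j.+1 * pp (1 - ln (1 + t) / L) / L).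

Lemma is_derive_1D t : is_derive t 1 (fun s : R => 1 + s) 1.
Proof.
apply: is_derive_eq_val
  (is_derive_add (is_derive_cst (1 : R) t 1) (is_derive_id t 1)) _.
by rewrite add0r.
Qed.

Lemma is_derive_hy j L t : 0 < L -> 0 < 1 + t -> is_derive t 1 (hy j L) (hy' j L t).
Proof.
move=> L0 t0; have d1 := is_derive_1D t.
have cst_ (a : R) : is_derive t 1 (fun=> a) 0 by exact: is_derive_cst.
have dl := is_derive_ln_comp t0 d1.
have dv := is_derive_add (cst_ 1)
  (is_derive_mul (is_derive_mul (cst_ (-1)) dl) (cst_ L^-1)).
have dp := is_derive_comp_real dv (is_derive_pp2 _).
have t1 : 1 + t != 0 by rewrite gt_eqF.
have dj := @is_derive_inv _ _ (fun s => (1 + s) ^+ j) _ _ _ (expf_neq0 j t1)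
  (is_derive_pow j d1).
have -> : hy j L = (fun s => (1 + s) ^- j * pp (1 + -1 * ln (1 + s) * L^-1) ^+ 2).
  by apply/funext => s; rewrite /hy mulN1r mulNr.
apply: is_derive_eq_val (is_derive_mul dj dp) _.
rewrite /hy' (natr_pow_pred j t1) ![(1 + t) ^+ j.+1]exprS /=.
rewrite mulN1r [in LHS]mulNr; set q := pp _.
have := expf_neq0 j t1; set T := _ ^+ j => T0.
by field; rewrite t1 T0 gt_eqF.
Qed.

Lemma continuous_lnD t : 0 < 1 + t -> {for t, continuous (fun s => ln (1 + s))}.
Proof.
by move=> t0; apply: (is_derive_continuous (is_derive_ln_comp t0 (is_derive_1D t))).
Qed.

Lemma continuous_pp_ln L t : 0 < 1 + t ->
  {for t, continuous (fun s => pp (1 - ln (1 + s) / L))}.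
Proof.
move=> t0; apply: (@continuous_comp _ _ _ (fun s => 1 - ln (1 + s) / L) pp); last first.
  exact: continuous_pp.
apply: continuousB; first exact: cst_continuous.
by apply: continuousM; [exact: continuous_lnD|exact: cst_continuous].
Qed.

Lemma continuous_hy' j L t : 0 < 1 + t -> {for t, continuous (hy' j L)}.
Proof.
move=> t0; have c1 : {for t, continuous (fun s : R => 1 + s)}.
  exact: is_derive_continuous (is_derive_1D t).
have t1 : 1 + t != 0 by rewrite gt_eqF.
have ci := @continuous_real_invpow (fun s => 1 + s) t j.+1 t1 c1.
have cp : {for t, continuous (fun s => pp (1 - ln (1 + s) / L))}.
  exact: continuous_pp_ln.
apply: continuousN; apply: continuousD.
  apply: continuousM; last exact: continuous_real_pow.
  by apply: continuousM => //; exact: cst_continuous.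
apply: continuousM; last exact: cst_continuous.
by apply: continuousM => //; apply: continuousM => //; exact: cst_continuous.
Qed.

Lemma weight_hy j L : 0 < L -> weight (fun=> True) (hy j L) (hy' j L).
Proof.
move=> L0; exists [set t | 0 < 1 + t], (expR L - 1); split => //.
- rewrite (_ : [set t | _] = (fun t => 1 + t) @^-1` [set t | 0 < t])//.
  apply: open_comp (@open_gt _ 0) => t _.
  exact: is_derive_continuous (is_derive_1D t).
- by move=> t t0 _ /=; rewrite ltr_pwDl.
- by move=> t t0; split; [exact: is_derive_hy|exact: continuous_hy'].
- move=> t Lt _; rewrite /hy pp_eq0 ?expr0n ?mulr0//.
  have wL : expR L < 1 + t by lra.
  rewrite subr_le0 ler_pdivlMr// mul1r -[leLHS](expRK L) ler_ln ?posrE ?expR_gt0//.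
    exact: ltW.
  exact: lt_trans (expR_gt0 _) wL.
Qed.

End cutoff.

(** * Exponentially decaying weights on the hyperbolic ball *)

Section ball_weight.
Context {R : realType}.
Variables (c eta : R).
Hypothesis eta0 : 0 < eta.
Implicit Types (s L b : R).

Local Notation F := (dfac c).

Definition gfac s := F s + eta * s.

(* [expR (lq s) = 1 + eta * Q], where [Q = s / F s] exhausts the ball. *)
Definition lq s := ln (gfac s) - ln (F s).

(** [j = k.+1] carries the volume density of the ball, [j = k] is the flux that controls the volume
    growth, [j = 0] is the test weight. With [b = 0] only the cutoff at [lq s = L] remains. *)
Definition hx (j : nat) b L s := F s ^- j * expR (- b * lq s) * pp (1 - lq s / L) ^+ 2.

Definition hx' (j : nat) b L s := F s ^- j * expR (- b * lq s) *
  ((j%:R * (c ^+ 2 / 4) / F s - b * (eta / (F s * gfac s))) * pp (1 - lq s / L) ^+ 2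
   - 2 * pp (1 - lq s / L) * (eta / (F s * gfac s)) / L).

Lemma is_derive_dfac s : is_derive s 1 F (- (c ^+ 2 / 4)).
Proof.
have cst_ (a : R) : is_derive s 1 (fun=> a) 0 by exact: is_derive_cst.
have -> : F = (fun s => 1 + - (c ^+ 2 / 4) * s).
  by apply/funext => y; rewrite /dfac mulNr.
apply: is_derive_eq_val
  (is_derive_add (cst_ 1) (is_derive_mul (cst_ _) (is_derive_id s 1))) _.
ring.
Qed.

Lemma is_derive_gfac s : is_derive s 1 gfac (- (c ^+ 2 / 4) + eta).
Proof.
have cst_ (a : R) : is_derive s 1 (fun=> a) 0 by exact: is_derive_cst.
apply: is_derive_eq_val (is_derive_add (is_derive_dfac s)
  (is_derive_mul (cst_ eta) (is_derive_id s 1))) _.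
ring.
Qed.

Lemma is_derive_lq s : 0 < F s -> 0 < gfac s ->
  is_derive s 1 lq (eta / (F s * gfac s)).
Proof.
move=> F0 G0; have cst_ (a : R) : is_derive s 1 (fun=> a) 0 by exact: is_derive_cst.
have -> : lq = (fun s => ln (gfac s) + -1 * ln (F s)).
  by apply/funext => y; rewrite /lq mulN1r.
apply: is_derive_eq_val (is_derive_add (is_derive_ln_comp G0 (is_derive_gfac s))
  (is_derive_mul (cst_ (-1)) (is_derive_ln_comp F0 (is_derive_dfac s)))) _.
move: F0 G0; rewrite /gfac /dfac => F0 G0; field.
by rewrite !gt_eqF//; lra.
Qed.

Lemma is_derive_hx j b L s : 0 < L -> 0 < F s -> 0 < gfac s ->
  is_derive s 1 (hx j b L) (hx' j b L s).
Proof.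
move=> L0 F0 G0; have F1 : F s != 0 by rewrite gt_eqF.
have cst_ (a : R) : is_derive s 1 (fun=> a) 0 by exact: is_derive_cst.
have dl := is_derive_lq F0 G0.
have dF := @is_derive_inv _ _ (fun s => F s ^+ j) _ _ _ (expf_neq0 j F1)
  (is_derive_pow j (is_derive_dfac s)).
have dE := is_derive_comp_real (is_derive_mul (cst_ (- b)) dl) (is_derive_expR _).
have dp := is_derive_comp_real (is_derive_add (cst_ 1)
   (is_derive_mul (is_derive_mul (cst_ (-1)) dl) (cst_ L^-1))) (is_derive_pp2 _).
have -> : hx j b L = (fun s => F s ^- j * expR (- b * lq s) *
    pp (1 + -1 * lq s * L^-1) ^+ 2).
  by apply/funext => y; rewrite /hx mulN1r mulNr.
apply: is_derive_eq_val (is_derive_mul (is_derive_mul dF dE) dp) _.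
rewrite /hx' (natr_pow_pred j F1) /=.
rewrite mulN1r [in LHS](mulNr (lq s)); set q := pp _; set e := expR _.
have := expf_neq0 j F1; set T := _ ^+ j => T0.
by field; rewrite T0 F1 !gt_eqF.
Qed.

Lemma continuous_hx' j b L s : 0 < F s -> 0 < gfac s -> {for s, continuous (hx' j b L)}.
Proof.
move=> F0 G0; have F1 : F s != 0 by rewrite gt_eqF.
have cF := is_derive_continuous (is_derive_dfac s).
have cG := is_derive_continuous (is_derive_gfac s).
have cl := is_derive_continuous (is_derive_lq F0 G0).
have ck (a : R) : {for s, continuous (fun=> a)} by exact: cst_continuous.
have cp : {for s, continuous (fun s => pp (1 - lq s / L))}.
  apply: (@continuous_comp _ _ _ (fun s => 1 - lq s / L) pp); last exact: continuous_pp.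
  by apply: continuousB => //; exact: continuousM.
have ce : {for s, continuous (fun s => expR (- b * lq s))}.
  apply: (@continuous_comp _ _ _ (fun s => - b * lq s) expR);
    last exact: continuous_expR.
  exact: continuousM.
have ci : {for s, continuous (fun s => eta / (F s * gfac s))}.
  apply: continuousM => //; apply: (@cvgV _ _ _ _ (fun s => F s * gfac s)).
    by rewrite mulf_neq0// gt_eqF.
  exact: continuousM.
have cFi : {for s, continuous (fun s => (F s)^-1)} by exact: cvgV.
apply: continuousM.
  by apply: continuousM => //; exact: (@continuous_real_invpow _ F).
apply: continuousB.
  apply: continuousM; last exact: continuous_real_pow.
  by apply: continuousB; apply: continuousM.
apply: continuousM => //; apply: continuousM => //.
exact: continuousM.
Qed.

Lemma dfac_range s : 0 <= s -> ball_top c s -> 0 < F s <= 1.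
Proof.
rewrite /ball_top /dfac => s0 cs; apply/andP; split; first by lra.
by rewrite lerBlDr lerDl mulr_ge0// divr_ge0// sqr_ge0.
Qed.

Lemma gfac_range s : 0 <= s -> ball_top c s -> F s <= gfac s.
Proof. by move=> s0 _; rewrite /gfac lerDl mulr_ge0// ltW. Qed.

Lemma weight_hx j b L : 0 < L -> weight (ball_top c) (hx j b L) (hx' j b L).
Proof.
move=> L0; pose eL := expR L - 1.
have eL0 : 0 < eL by rewrite subr_gt0 expR_gt1.
have d0 : 0 < eta + eL * (c ^+ 2 / 4).
  by rewrite ltr_wpDr// mulr_ge0// ?divr_ge0 ?sqr_ge0// ltW.
(* This radius solves [gfac s = expR L * F s], that is [lq s = L]. *)
exists ([set s | 0 < F s] `&` [set s | 0 < gfac s]), (eL / (eta + eL * (c ^+ 2 / 4))).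
have rt : ball_top c (eL / (eta + eL * (c ^+ 2 / 4))).
  rewrite /ball_top mulrA ltr_pdivrMr// -subr_gt0 (_ : _ - _ = 4 * eta).
    by rewrite mulr_gt0.
  by field.
split => //.
- apply: openI.
    apply: (@open_comp _ _ F [set t | 0 < t]); last exact: open_gt.
    by move=> t _; exact: is_derive_continuous (is_derive_dfac t).
  apply: (@open_comp _ _ gfac [set t | 0 < t]); last exact: open_gt.
  by move=> t _; exact: is_derive_continuous (is_derive_gfac t).
- move=> s s0 st; have /andP[F0 _] := dfac_range s0 st; split => //=.
  by apply: lt_le_trans F0 (gfac_range s0 st).
- by move=> s [/= F0 G0]; split; [exact: is_derive_hx|exact: continuous_hx'].
- move=> s rs st; have s0 : 0 <= s.
    by apply: le_trans (ltW rs); rewrite divr_ge0// ltW.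
  have /andP[F0 _] := dfac_range s0 st; have FG := gfac_range s0 st.
  have G0 := lt_le_trans F0 FG.
  rewrite /hx pp_eq0 ?expr0n ?mulr0// subr_le0 ler_pdivlMr// mul1r /lq.
  rewrite -ln_div ?posrE// -[leLHS](expRK L) ler_ln ?posrE ?expR_gt0 ?divr_gt0//.
  rewrite ler_pdivlMr//; move: rs; rewrite ltr_pdivrMr// /eL /gfac /dfac => rs.
  move: rs; set X := expR L - 1; rewrite (_ : expR L = X + 1); last by rewrite /X subrK.
  move: X => X rs; rewrite -subr_ge0.
  rewrite (_ : _ - _ = s * (eta + X * (c ^+ 2 / 4)) - X); last by field.
  by rewrite subr_ge0 ltW.
Qed.

Lemma lq_ge0 s : 0 <= s -> ball_top c s -> 0 <= lq s.
Proof.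
move=> s0 st; have /andP[F0 _] := dfac_range s0 st; have FG := gfac_range s0 st.
by rewrite /lq subr_ge0 ler_ln ?posrE// (lt_le_trans F0).
Qed.

Lemma expR_lq s : 0 <= s -> ball_top c s -> expR (- lq s) = F s / gfac s.
Proof.
move=> s0 st; have /andP[F0 _] := dfac_range s0 st; have FG := gfac_range s0 st.
have G0 := lt_le_trans F0 FG.
by rewrite /lq opprB expRB !lnK ?posrE.
Qed.

(* |grad lq|^2 <= c^2 + eta *)
Lemma lq_gradient s : 0 <= s -> ball_top c s ->
  4 * s * eta ^+ 2 <= (c ^+ 2 + eta) * gfac s ^+ 2.
Proof.
move=> s0 st; have /andP[F0 F1] := dfac_range s0 st.
have [->|sn0] := eqVneq s 0.
  by rewrite mulr0 mul0r mulr_ge0 ?sqr_ge0// addr_ge0 ?sqr_ge0// ltW.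
have sp : 0 < s by rewrite lt_neqAle eq_sym sn0.
(* Multiplying by [s] eliminates [c] through [c^2 s = 4 (1 - F)]; what remains is a polynomial in F
   and [eta * s], written below as a sum of nonnegative terms. *)
rewrite -(ler_pM2r sp) /gfac.
have cF : c ^+ 2 * s = 4 * (1 - F s) by rewrite /dfac; field.
move: F0 F1 cF; move: (F s) => f F0 F1 cF.
rewrite (_ : (c ^+ 2 + eta) * (f + eta * s) ^+ 2 * s =
  (c ^+ 2 * s + eta * s) * (f + eta * s) ^+ 2); last by ring.
rewrite cF (_ : 4 * s * eta ^+ 2 * s = 4 * (eta * s) ^+ 2); last by ring.
have : 0 <= eta * s by rewrite mulr_ge0// ltW.
move: (eta * s) => e e0; rewrite -subr_ge0.
rewrite (_ : _ - _ =
  4 * (1 - f) * f ^+ 2 + 8 * (1 - f) * f * e + e * (f - e) ^+ 2); last by ring.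
have f1 : 0 <= 1 - f by lra.
have f0 := ltW F0.
apply: addr_ge0; first apply: addr_ge0.
- by apply: mulr_ge0 (sqr_ge0 f); apply: mulr_ge0.
- by apply: mulr_ge0 e0; apply: mulr_ge0 f0; apply: mulr_ge0.
- exact: mulr_ge0 (sqr_ge0 _).
Qed.

End ball_weight.

(** * Integral bounds for the weights *)

Lemma fatou_le d (T : measurableType d) (R : realType)
    (mu : {measure set T -> \bar R}) (D : set T) (f_ : nat -> T -> R) (f : T -> R)
    (C : \bar R) :
  measurable D -> (forall j, measurable_fun D (f_ j)) ->
  (forall j x, D x -> 0 <= f_ j x) ->
  (forall x, D x -> f_ ^~ x @ \oo --> f x) ->
  (forall j, (\int[mu]_(x in D) (f_ j x)%:E <= C)%E) ->
  (\int[mu]_(x in D) (f x)%:E <= C)%E.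
Proof.
move=> mD mf f0 ff fC.
have -> : (\int[mu]_(x in D) (f x)%:E =
    \int[mu]_(x in D) limn_einf (fun j => (f_ j x)%:E))%E.
  apply: eq_integral => x; rewrite inE => Dx.
  have cx : (fun j => (f_ j x)%:E) @ \oo --> (f x)%:E.
    by apply: cvg_EFin; [exact: nearW|exact: ff].
  by rewrite is_cvg_limn_einfE; [apply/esym/cvg_lim|apply/cvg_ex; exists (f x)%:E].
apply: le_trans (@fatou _ _ _ mu D mD (fun j x => (f_ j x)%:E) _ _) _.
- by move=> j; exact/measurable_EFinP.
- by move=> j x Dx; rewrite lee_fin f0.
rewrite limn_einf_lim; apply: lime_le; first exact: is_cvg_einfs.
apply: nearW => j; apply: le_trans (fC j); apply: ereal_inf_lbound.
by exists j => //=.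
Qed.

Lemma le_scaled_integral (R : realType) (a : R) (X I : \bar R) :
  0 < a -> (0 <= I)%E -> (I < +oo)%E -> (a%:E * X <= I)%E ->
  (X <= (a^-1 * fine I)%:E)%E.
Proof.
move=> a0 I0 Ilt h; rewrite EFinM fineK ?ge0_fin_numE//.
by rewrite lee_pdivlMl.
Qed.

Lemma continuous_patch (R : realType) d (D K : set 'rV[R]_d) (f : 'rV[R]_d -> R) :
  open D -> closed K -> K `<=` D ->
  continuous_on D f -> (forall x, D x -> ~ K x -> f x = 0) -> continuous (f \_ D).
Proof.
move=> oD cK KD cf f0 x; have [Dx|nDx] := pselect (D x).
  apply: near_eq_continuous (cf x Dx).
  have : open_nbhs x D by [].
  by move=> /open_nbhs_nbhs; apply: filterS => y Dy; rewrite patchE mem_set.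
apply: (@near_eq_continuous _ _ (fun=> 0)); last exact: cst_continuous.
have : open_nbhs x (~` K) by split; [exact: closed_openC|move/KD].
move=> /open_nbhs_nbhs; apply: filterS => y Ky.
by rewrite patchE; case: ifPn => //; rewrite inE => Dy; rewrite f0.
Qed.

Section integral_bounds.
Context {R : realType}.
Variables (c eta : R) (k m : nat).
Hypothesis eta0 : 0 < eta.
Local Notation n := (k.+1 + m)%N.
Local Notation D := (chart_dom c k m).
Implicit Types (z : 'rV[R]_n) (L b s t : R).
Local Notation xs := (@xs R k m).
Local Notation yt := (@yt R k m).
Local Notation vol := (@vol R c k m).
Local Notation leb := (@lebesgue_rV R n).

Let oD : open D := @open_chart_dom R c k m.
Let mD : measurable D := open_rV_measurable oD.

Lemma prodw_integral_lty A A' B B' : weight (ball_top c) A A' ->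
  weight (fun=> True) B B' ->
  (forall z, D z -> 0 <= @prodw R k m A B z) ->
  (\int[leb]_(z in D) (@prodw R k m A B z)%:E < +oo)%E.
Proof.
move=> wA wB AB0; have [K [M [cK KD KM K0]]] := prodw_support k m wA wB.
have cP := continuous_patch oD cK KD (C1_continuous (C1_prodw wA wB)) K0.
have /integrableP[_] : leb.-integrable setT (EFin \o (@prodw R k m A B \_ D)).
  apply: (box_integrable cP (M := M)) => z zM.
  by rewrite patchE; case: ifPn => //; rewrite inE => Dz; rewrite K0// => /KM.
apply: le_lt_trans; rewrite integral_mkcond le_eqVlt; apply/orP; left; apply/eqP.
apply: eq_integral => z _; rewrite /= !patchE.
case: ifPn => [|_] /=; last by rewrite normr0.
by rewrite inE => Dz; rewrite ger0_norm// AB0.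
Qed.

Lemma hy_ge0 j L t : 0 <= t -> 0 <= hy j L t.
Proof. by move=> t0; rewrite mulr_ge0 ?sqr_ge0// invr_ge0 exprn_ge0// addr_ge0. Qed.

Lemma hx_ge0 j b L s : 0 <= s -> ball_top c s -> 0 <= hx c eta j b L s.
Proof.
move=> s0 st; have /andP[F0 _] := dfac_range s0 st.
apply: mulr_ge0 (sqr_ge0 _); apply: mulr_ge0 (expR_ge0 _).
by rewrite invr_ge0 exprn_ge0// ltW.
Qed.

Lemma continuous_on_hx j b L : 0 < L ->
  continuous_on D (fun z => hx c eta j b L (xs z)).
Proof.
move=> L0; apply: C1_continuous.
exact: (C1_weight (@C1_xs R c k m) (@xs_range R c k m) (weight_hx c eta0 j b L0)).
Qed.

Lemma continuous_on_hy j L : 0 < L -> continuous_on D (fun z => hy j L (yt z)).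
Proof.
move=> L0; apply: C1_continuous.
exact: (C1_weight (@C1_yt R c k m) (@yt_range R c k m) (weight_hy j L0)).
Qed.

Lemma measurable_hxhy i b L j L' : 0 < L -> 0 < L' ->
  measurable_fun D (fun z => hx c eta i b L (xs z) * hy j L' (yt z)).
Proof.
move=> L0 L0'; apply: continuous_on_measurable => //.
by apply: continuous_on_mul; [exact: continuous_on_hx|exact: continuous_on_hy].
Qed.

Lemma hxhy_ge0 i b L j L' z : D z -> 0 <= hx c eta i b L (xs z) * hy j L' (yt z).
Proof.
move=> Dz; have [s0 st] := xs_range Dz; have [t0 _] := yt_range Dz.
by rewrite mulr_ge0 ?hx_ge0 ?hy_ge0.
Qed.

Lemma hxhy_lty i b L j L' : 0 < L -> 0 < L' ->
  (\int[leb]_(z in D) (hx c eta i b L (xs z) * hy j L' (yt z))%:E < +oo)%E.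
Proof.
move=> L0 L0'; apply: (prodw_integral_lty (weight_hx c eta0 i b L0) (weight_hy j L0')).
by move=> z Dz; exact: hxhy_ge0.
Qed.

Hypothesis m2 : (2 <= m)%N.

Let m2R : 2 <= m%:R :> R. Proof. by rewrite (ler_nat R 2). Qed.

(** With [v = 1 / (1 + t)] the left side is at most [(1 + t)^-m p^2 (1/2 - m + 2 m v)]. For
    [1 + t >= 4] this is nonpositive. Otherwise [ln (1 + t) <= t < 3], so the cutoff of length 6 is
    at least 1/2 before squaring, and the factor 8 compensates the resulting 1/4. *)
Lemma sphere_radial_le t L : 0 <= t -> 0 < L ->
  2^-1 * hy m L t + (m%:R * hy m L t + 2 * t * hy' m L t) <= 8 * m%:R * hy 0 6 t.
Proof.
move=> t0 L0; have w0 : 0 < 1 + t by rewrite ltr_pwDl.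
have w1 : 1 <= 1 + t by rewrite lerDl.
rewrite /hy /hy' expr0 invr1 mul1r ![(1 + t) ^+ m.+1]exprS.
set p := pp (1 - ln (1 + t) / L); set q := pp _.
have p0 : 0 <= p by exact: pp_ge0.
have p1 : p <= 1.
  by apply: pp_le1; rewrite lerBlDr lerDl divr_ge0 ?ln_ge0// ltW.
have T0 : 0 < ((1 + t) ^+ m)^-1 by rewrite invr_gt0 exprn_gt0.
have T1 : ((1 + t) ^+ m)^-1 <= 1.
  by rewrite invf_le1 ?exprn_gt0// exprn_ege1.
rewrite invfM; move: T0 T1; set T := _^-1 => T0 T1.
set v := (1 + t)^-1; have v0 : 0 < v by rewrite invr_gt0.
have vt : t * v = 1 - v by rewrite /v; field; rewrite gt_eqF.
have Tp : 0 <= T * p ^+ 2 by rewrite mulr_ge0 ?sqr_ge0// ltW.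
have Li : 0 < L^-1 by rewrite invr_gt0.
have E : 2^-1 * (T * p ^+ 2) + (m%:R * (T * p ^+ 2) +
   2 * t * - (m%:R * (v * T) * p ^+ 2 + 2 * (v * T) * p / L)) =
   T * p ^+ 2 * (2^-1 - m%:R + 2 * m%:R * v) - 4 * (t * v) * T * p * L^-1.
  transitivity (T * p ^+ 2 * (2^-1 + m%:R - 2 * m%:R * (t * v))
    - 4 * (t * v) * T * p * L^-1).
    by rewrite -/(v); ring.
  by rewrite vt; congr (_ - _); ring.
rewrite E.
have h1 : 0 <= 4 * (t * v) * T * p * L^-1.
  by rewrite !mulr_ge0// ltW.
apply: le_trans (_ : T * p ^+ 2 * (2^-1 - m%:R + 2 * m%:R * v) <= _).
  by rewrite gerBl.
have [w4|w4] := leP 4 (1 + t).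
  apply: le_trans (_ : 0 <= _); last by rewrite mulr_ge0 ?sqr_ge0 ?mulr_ge0.
  rewrite mulr_ge0_le0//.
  have : v <= 4^-1 by rewrite lef_pV2 ?posrE.
  move: m2R; move: (m%:R : R) => M M2 v4.
  have : M * v <= M * 4^-1 by rewrite ler_wpM2l//; lra.
  lra.
have q2 : 2^-1 <= q.
  rewrite /q /pp le_max; apply/orP; right.
  have : ln (1 + t) <= t by rewrite le_ln1Dx// (lt_le_trans _ t0).
  lra.
have v1 : v <= 1 by rewrite invf_le1.
have Tp1 : T * p ^+ 2 <= 1.
  by rewrite mulr_ile1 ?sqr_ge0 ?expr_le1// ltW.
have M0 : 0 <= m%:R :> R by [].
apply: le_trans (_ : 2 * m%:R <= _); last first.
  have : 4^-1 <= q ^+ 2.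
    have := mulr_ge0 (ltW (ltr0Sn R 1)) M0.
    by rewrite expr2 => _; nra.
  move=> q4; apply: le_trans (_ : 8 * m%:R * 4^-1 <= _); first lra.
  by rewrite ler_wpM2l// mulr_ge0.
apply: le_trans (_ : T * p ^+ 2 * (2 * m%:R) <= _).
  apply: ler_wpM2l => //.
  have : m%:R * v <= m%:R * 1 by rewrite ler_wpM2l.
  move: m2R; lra.
by rewrite ler_piMl// mulr_ge0.
Qed.

(** Finiteness of the volume of the sphere: the comparison weight is compactly supported and does
    not involve [L]. *)
Lemma sphere_bound L1 : 0 < L1 -> exists C : R, forall L, 0 < L ->
  (\int[leb]_(z in D) (hx c eta k.+1 0 L1 (xs z) * hy m L (yt z))%:E <= C%:E)%E.
Proof.
move=> L10.
pose G z := 8 * m%:R * (hx c eta k.+1 0 L1 (xs z) * hy 0 6 (yt z)).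
have G0 z : D z -> 0 <= G z by move=> Dz; rewrite mulr_ge0 ?hxhy_ge0// mulr_ge0.
have mG : measurable_fun D G by apply: measurable_funM => //; exact: measurable_hxhy.
pose I := (\int[leb]_(z in D) (G z)%:E)%E.
have Ilty : (I < +oo)%E.
  rewrite /I (eq_integral (fun z => (8 * m%:R)%:E *
     (hx c eta k.+1 0 L1 (xs z) * hy 0 6 (yt z))%:E)%E); last first.
    by move=> z _; rewrite EFinM.
  rewrite ge0_integralZl_EFin//.
  - by rewrite lte_mul_pinfty// ?lee_fin ?mulr_ge0//; apply: hxhy_lty.
  - by move=> z Dz; rewrite lee_fin hxhy_ge0.
  - by apply/measurable_EFinP; apply: measurable_hxhy.
have I0 : (0 <= I)%E by apply: integral_ge0 => z Dz; rewrite lee_fin G0.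
exists ((2^-1)^-1 * fine I) => L L0; apply: le_scaled_integral => //.
rewrite -ge0_integralZl_EFin//; first last.
- by apply/measurable_EFinP; apply: measurable_hxhy.
- by move=> z Dz; rewrite lee_fin hxhy_ge0.
under eq_integral do rewrite -EFinM.
apply: (radial_ineq_right (weight_hx c eta0 k.+1 0 L10) (weight_hy m L0)) => //.
- by apply: measurable_funM => //; exact: measurable_hxhy.
- by move=> z Dz; rewrite mulr_ge0// hxhy_ge0.
move=> z Dz; have [s0 st] := xs_range Dz; have [t0 _] := yt_range Dz.
rewrite (mulrCA 2^-1) -mulrDr /G (mulrCA (8 * _)) ler_wpM2l ?hx_ge0//.
exact: sphere_radial_le.
Qed.

(** The two sides differ by [(1 + t)^-m p^2 (m + t (m - 2))], which is nonnegative since the sphere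
    has dimension at least 2. *)
Lemma capacity_radial_le t L : 0 <= t -> 0 < L ->
  4 / L * (t * (1 + t) ^- m * pp (1 - ln (1 + t) / L))
  + (m%:R * hy m.-1 L t + 2 * t * hy' m.-1 L t) <= 2 * m%:R * hy m L t.
Proof.
move=> t0 L0; have w0 : 0 < 1 + t by rewrite ltr_pwDl.
have w1 : 1 <= 1 + t by rewrite lerDl.
have m1 : m.-1.+1 = m by rewrite prednK// (leq_trans _ m2).
rewrite /hy /hy' m1; set p := pp (1 - ln (1 + t) / L).
have p0 : 0 <= p by exact: pp_ge0.
have -> : (1 + t) ^- m.-1 = (1 + t) * (1 + t) ^- m.
  by rewrite -[in RHS]m1 exprS; field; rewrite expf_neq0 gt_eqF.
have T0 : 0 < ((1 + t) ^+ m)^-1 by rewrite invr_gt0 exprn_gt0.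
move: T0; set T := _^-1 => T0.
have -> : m.-1%:R = m%:R - 1 :> R by rewrite -[in RHS]m1 -natr1; ring.
rewrite -subr_ge0 (_ : _ - _ = T * p ^+ 2 * (m%:R + t * (m%:R - 2))).
  rewrite mulr_ge0//; first by rewrite mulr_ge0 ?sqr_ge0// ltW.
  by rewrite addr_ge0// mulr_ge0// subr_ge0.
by field; rewrite gt_eqF.
Qed.

Lemma continuous_on_capacity L1 L : 0 < L1 ->
  continuous_on D (fun z => hx c eta k.+1 0 L1 (xs z) *
    (yt z * (1 + yt z) ^- m * pp (1 - ln (1 + yt z) / L))).
Proof.
move=> L10.
apply: continuous_on_mul; first exact: continuous_on_hx.
have c1 : continuous_on D yt by exact: C1_continuous (@C1_yt R c k m).
have c2 : continuous_on D (fun z => 1 + yt z).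
  by apply: continuous_on_add => //; exact: continuous_on_cst.
have p2 z : 0 < 1 + yt z by rewrite ltr_pwDl// sqnorm_ge0.
apply: continuous_on_mul.
  apply: continuous_on_mul => //.
  apply: (continuous_on_comp (h := fun t => (1 + t) ^- m)) => // z _.
  apply: (@continuous_real_invpow _ (fun t => 1 + t)); first by rewrite gt_eqF.
  exact: is_derive_continuous (is_derive_1D _).
apply: (continuous_on_comp (h := fun t => pp (1 - ln (1 + t) / L))) => // z _.
exact: continuous_pp_ln.
Qed.

(** The integral of [t (1 + t)^-m p] grows at most like [L]. In the energy of the cutoff it comes
    with the factor [1 / L^2], so that energy is O(1 / L). *)
Lemma capacity_bound L1 : 0 < L1 -> exists C : R, forall L, 0 < L ->
  (\int[leb]_(z in D) (4 / L * (hx c eta k.+1 0 L1 (xs z) *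
    (yt z * (1 + yt z) ^- m * pp (1 - ln (1 + yt z) / L))))%:E <= C%:E)%E.
Proof.
move=> L10; have [C hC] := sphere_bound L10; exists (2 * m%:R * C) => L L0.
have mc : 0 <= 2 * m%:R :> R by rewrite mulr_ge0.
rewrite EFinM; apply: le_trans (lee_wpmul2l _ (hC L L0)); last by rewrite lee_fin.
rewrite -ge0_integralZl_EFin//; first last.
- by apply/measurable_EFinP; apply: measurable_hxhy.
- by move=> z Dz; rewrite lee_fin hxhy_ge0.
under [leRHS]eq_integral do rewrite -EFinM.
apply: (radial_ineq_right (weight_hx c eta0 k.+1 0 L10) (weight_hy m.-1 L0)).
- apply: measurable_funM => //; apply: continuous_on_measurable => //.
  exact: continuous_on_capacity.
- by apply: measurable_funM => //; exact: measurable_hxhy.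
- move=> z Dz; have [s0 st] := xs_range Dz; have [t0 _] := yt_range Dz.
  have w0 : 0 <= 1 + yt z by rewrite addr_ge0.
  have L4 : 0 <= 4 / L by rewrite divr_ge0// ltW.
  apply: mulr_ge0 L4 _; apply: mulr_ge0; first exact: hx_ge0.
  apply: mulr_ge0 (pp_ge0 _); apply: mulr_ge0 t0 _.
  by rewrite invr_ge0 exprn_ge0.
- by move=> z Dz; rewrite mulr_ge0// hxhy_ge0.
move=> z Dz; have [s0 st] := xs_range Dz; have [t0 _] := yt_range Dz.
rewrite (mulrCA (4 / L)) -mulrDr (mulrCA (2 * _)) ler_wpM2l ?hx_ge0//.
exact: capacity_radial_le.
Qed.

(** Volume growth contributes at most [2 k'] and the exponential [- 2 b (1 - f / g)]. Together with
    [b - k'] this leaves [- (b - k') + 2 b f / g], positive only where [lq] is below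
    [ln (2 b / (b - k'))]. A cutoff of twice that length is at least 1/2 there, which explains the
    weight on the right. *)
Lemma ball_radial_le (k' : R) b L s : k%:R <= k' -> 2^-1 <= k' -> k' < b ->
  0 < L -> 0 <= s -> ball_top c s ->
  (b - k') * hx c eta k.+1 b L s +
  (k.+1%:R * hx c eta k b L s + 2 * s * hx' c eta k b L s) <=
  8 * b * hx c eta k.+1 0 (2 * ln (2 * b / (b - k'))) s.
Proof.
move=> kk' k2' k'b L0 s0 st.
have /andP[F0 F1] := dfac_range s0 st; have FG := gfac_range eta0 s0 st.
have G0 := lt_le_trans F0 FG.
have q0 := lq_ge0 eta0 s0 st; have eq := expR_lq eta0 s0 st.
have k'0 : 0 < k' by apply: lt_le_trans k2'; rewrite invr_gt0.
have b0 : 0 < b by apply: lt_trans k'b.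
rewrite /hx /hx' ![dfac c s ^+ k.+1]exprS.
set p := pp (1 - _ / L); set e := expR (- b * _).
set r := pp (1 - _ / _).
have p0 : 0 <= p by exact: pp_ge0.
have p1 : p <= 1 by apply: pp_le1; rewrite gerBl divr_ge0// ltW.
have e0 : 0 <= e by exact: expR_ge0.
have e1 : e <= 1 by rewrite -expR0 ler_expR mulNr oppr_le0 mulr_ge0// ltW.
rewrite oppr0 mul0r expR0 mulr1 invfM.
have T0 : 0 < ((dfac c s) ^+ k)^-1 by rewrite invr_gt0 exprn_gt0.
move: T0; set T := (_ ^+ k)^-1 => T0.
set f := dfac c s; set g := gfac c eta s.
have fi0 : 0 < f^-1 by rewrite invr_gt0.
have es : eta * s = g - f by rewrite /g /gfac -/f; ring.
have cs : c ^+ 2 / 4 * s = 1 - f by rewrite /f /dfac; ring.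
have kf : k.+1%:R * f + 2 * k%:R * (1 - f) <= 2 * k'.
  (* For [k >= 1] this is [k + 1 <= 2 k]; for [k = 0] the left side is [f <= 1], whence the bound
     [2^-1 <= k']. *)
  rewrite -natr1; case: (leP 1%N k) => [k1|].
    have k1R : 1 <= k%:R :> R by rewrite (ler_nat R 1).
    have : 0 <= (k%:R - 1) * f by apply: mulr_ge0 (ltW F0); rewrite subr_ge0.
    lra.
  move=> k0; have -> : k%:R = 0 :> R by move: k0; case: (k).
  by move: k2' F1; rewrite -/f; lra.
have E : (b - k') * (f^-1 * T * e * p ^+ 2) + (k.+1%:R * (T * e * p ^+ 2) +
    2 * s * (T * e * ((k%:R * (c ^+ 2 / 4) / f - b * (eta / (f * g))) * p ^+ 2
      - 2 * p * (eta / (f * g)) / L))) =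
  f^-1 * T * e * p ^+ 2 * ((b - k') + (k.+1%:R * f + 2 * k%:R * (1 - f))
     - 2 * b * (1 - f / g)) - 4 * (f^-1 * T * e * p * (1 - f / g) / L).
  have -> : 1 - f / g = eta * s / g by rewrite es; field; rewrite gt_eqF.
  rewrite -cs; field; rewrite !gt_eqF//.
rewrite E.
have fg1 : f / g <= 1 by rewrite ler_pdivrMr// mul1r.
have fg0 : 0 <= f / g by rewrite divr_ge0// ltW.
have Te0 : 0 <= f^-1 * T * e * p.
  by rewrite !mulr_ge0// ltW.
have h1 : 0 <= 4 * (f^-1 * T * e * p * (1 - f / g) / L).
  by rewrite mulr_ge0// divr_ge0 ?(ltW L0)// mulr_ge0// subr_ge0.
apply: le_trans (_ : f^-1 * T * e * p ^+ 2 * (- (b - k') + 2 * b * (f / g)) <= _).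
  rewrite lerBlDr; apply: ler_wpDr h1 _.
  by apply: ler_wpM2l; [rewrite expr2 mulrA mulr_ge0|lra].
have fT0 : 0 <= f^-1 * T by rewrite mulr_ge0// ltW.
have [fgs|fgb] := leP (f / g) ((b - k') / (2 * b)).
  apply: le_trans (_ : 0 <= _).
    rewrite mulr_ge0_le0//; first by rewrite expr2 mulrA mulr_ge0.
    move: fgs; rewrite ler_pdivlMr ?mulr_gt0//; lra.
  by rewrite mulr_ge0 ?(ltW (mulr_gt0 _ b0))// mulr_ge0 ?sqr_ge0.
have r2 : 2^-1 <= r.
  rewrite /r /pp le_max; apply/orP; right.
  have bk0 : 0 < b - k' by rewrite subr_gt0.
  have bk : 0 < (b - k') / (2 * b) by rewrite divr_gt0 ?subr_gt0 ?mulr_gt0.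
  have LL : 0 < ln (2 * b / (b - k')).
    by rewrite ln_gt0// ltr_pdivlMr ?subr_gt0// mul1r; lra.
  have : lq c eta s <= ln (2 * b / (b - k')).
    rewrite -[leLHS]opprK -[X in - X](expRK) eq -/f -/g -(lnV) ?posrE ?divr_gt0//.
    rewrite ler_ln ?posrE ?invr_gt0 ?divr_gt0 ?mulr_gt0//.
    rewrite -[leRHS]invf_div lef_pV2 ?posrE ?divr_gt0 ?mulr_gt0//.
    exact: ltW.
  move=> ql; have : lq c eta s / (2 * ln (2 * b / (b - k'))) <= 2^-1.
    by rewrite ler_pdivrMr ?mulr_gt0// mulKf.
  lra.
apply: le_trans (_ : f^-1 * T * 1 * (2 * b) <= _).
  have ep : e * p ^+ 2 <= 1 by rewrite mulr_ile1 ?sqr_ge0 ?expr_le1.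
  have ep0 : 0 <= e * p ^+ 2 by rewrite mulr_ge0 ?sqr_ge0.
  apply: le_trans (_ : f^-1 * T * (e * p ^+ 2) * (2 * b) <= _).
    rewrite -[f^-1 * T * e * p ^+ 2]mulrA; apply: ler_wpM2l.
      exact: mulr_ge0.
    have : 2 * b * (f / g) <= 2 * b * 1 by rewrite ler_wpM2l// mulr_ge0// ltW.
    lra.
  by rewrite ler_wpM2r ?ler_wpM2l// mulr_ge0// ltW.
have r4 : 4^-1 <= r ^+ 2 by rewrite expr2; nra.
rewrite mulr1 (_ : 8 * b * (f^-1 * T * r ^+ 2) = f^-1 * T * (8 * b * r ^+ 2));
  last by ring.
rewrite ler_wpM2l//; have : b * 4^-1 <= b * r ^+ 2 by rewrite ler_wpM2l// ltW.
lra.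
Qed.

(** Both conditions on [b] are visible at [c = 0]: the weight [(1 + eta |x|^2)^-b] is integrable on
    R^(k+1) exactly when [2 b > k + 1]. This follows from [b > k] for [k >= 1] and reads [b > 1/2]
    for [k = 0]. *)
Lemma ball_bound b : k%:R < b -> 2^-1 < b -> exists C : R,
  forall L L', 0 < L -> 0 < L' ->
  (\int[leb]_(z in D) (hx c eta k.+1 b L (xs z) * hy m L' (yt z))%:E <= C%:E)%E.
Proof.
move=> kb b2; pose k' : R := Num.max k%:R 2^-1.
have k'b : k' < b by rewrite gt_max kb.
have k'0 : 0 < k'.
  by apply: (@lt_le_trans _ _ 2^-1); rewrite ?invr_gt0 ?ltr0n// le_max lexx orbT.
have b0 : 0 < b by apply: lt_trans b2.
pose L1 := 2 * ln (2 * b / (b - k')).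
have L10 : 0 < L1.
  by rewrite mulr_gt0// ln_gt0// ltr_pdivlMr ?subr_gt0// mul1r; lra.
have [C hC] := sphere_bound L10.
have C0 : (0 <= C%:E)%E.
  apply: le_trans (hC 1 ltr01); apply: integral_ge0 => z Dz.
  by rewrite lee_fin hxhy_ge0.
exists ((b - k')^-1 * fine (8 * b * C)%:E) => L L' L0 L0'.
have bb : 0 <= 8 * b by rewrite mulr_ge0// ltW.
apply: le_scaled_integral; rewrite ?subr_gt0 ?ltry//.
  by rewrite lee_fin mulr_ge0// -lee_fin.
rewrite EFinM; apply: le_trans (lee_wpmul2l _ (hC L' L0')); last by rewrite lee_fin.
rewrite -!ge0_integralZl_EFin ?subr_ge0 ?(ltW k'b)//; first last.
- by apply/measurable_EFinP; apply: measurable_hxhy.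
- by move=> z Dz; rewrite lee_fin hxhy_ge0.
- by apply/measurable_EFinP; apply: measurable_hxhy.
- by move=> z Dz; rewrite lee_fin hxhy_ge0.
under eq_integral do rewrite -EFinM.
under [leRHS]eq_integral do rewrite -EFinM.
apply: (radial_ineq_left (weight_hx c eta0 k b L0) (weight_hy m L0')).
- by apply: measurable_funM => //; exact: measurable_hxhy.
- by apply: measurable_funM => //; exact: measurable_hxhy.
- by move=> z Dz; rewrite mulr_ge0 ?hxhy_ge0// subr_ge0 ltW.
- by move=> z Dz; rewrite mulr_ge0 ?hxhy_ge0.
move=> z Dz; have [s0 st] := xs_range Dz; have [t0 _] := yt_range Dz.
rewrite (mulrC (hx _ _ _ _ _ _)) mulrCA -mulrDr.
rewrite (mulrC (hx _ _ _ _ _ _)) (mulrCA (8 * b)).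
by rewrite ler_wpM2l ?hy_ge0// ball_radial_le// le_max lexx ?orbT.
Qed.

End integral_bounds.

(** * Square integrability in the chart *)

Section weight_energies.
Context {R : realType}.
Variables (c eta : R).
Hypothesis eta0 : 0 < eta.
Implicit Types (L s t de tau : R).

(** Young's inequality [(x + y)^2 <= (1 + de) x^2 + (1 + 1 / de) y^2], with [x = tau p] from the
    exponential and [y = 1 / L] from the cutoff. The main term loses only a factor [1 + de], and the
    error decays with [L]. *)
Lemma ball_energy_le tau de L s : 0 < de -> 0 < L -> 0 <= s -> ball_top c s ->
  dfac c s ^+ 2 * s * (hx' c eta 0 (2 * tau) L s ^+ 2 / hx c eta 0 (2 * tau) L s) <=
  (c ^+ 2 + eta) * ((1 + de) * tau ^+ 2 * hx c eta 0 (2 * tau) L s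
     + (1 + de^-1) / L ^+ 2 * expR (- (2 * tau) * lq c eta s)).
Proof.
move=> de0 L0 s0 st; have /andP[F0 F1] := dfac_range s0 st.
have FG := gfac_range eta0 s0 st; have G0 := lt_le_trans F0 FG.
have gr := lq_gradient eta0 s0 st.
rewrite /hx /hx' expr0 invr1 !mul1r !mul0r sub0r.
set E := expR _; set p := pp _; have E0 : 0 < E by exact: expR_gt0.
have p0 : 0 <= p by exact: pp_ge0.
have ce0 : 0 <= c ^+ 2 + eta by rewrite addr_ge0 ?sqr_ge0// ltW.
have de1 : 0 <= 1 + de^-1 by rewrite addr_ge0 ?invr_ge0// ltW.
have [->|pn0] := eqVneq p 0.
  rewrite expr0n /= !(mulr0, mul0r) invr0 !mulr0 add0r.
  by rewrite !mulr_ge0// ?invr_ge0 ?sqr_ge0// ltW.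
have pp0 : 0 < p by rewrite lt_neqAle eq_sym pn0.
rewrite (_ : dfac c s ^+ 2 * s * _ =
   (4 * s * eta ^+ 2 / gfac c eta s ^+ 2) * (E * (tau * p + L^-1) ^+ 2)); last first.
  by field; rewrite !gt_eqF.
apply: le_trans (_ : (c ^+ 2 + eta) * (E * (tau * p + L^-1) ^+ 2) <= _).
  apply: ler_wpM2r; first by rewrite mulr_ge0 ?sqr_ge0// ltW.
  by rewrite ler_pdivrMr// exprn_gt0.
apply: ler_wpM2l => //.
rewrite (_ : (1 + de) * tau ^+ 2 * _ + _ =
  E * ((1 + de) * (tau * p) ^+ 2 + (1 + de^-1) * L^-1 ^+ 2)); last first.
  by rewrite exprVn; ring.
apply: ler_wpM2l; first exact: ltW.
move: (tau * p) (L^-1) => x y; rewrite -subr_ge0.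
rewrite (_ : _ - _ = de^-1 * (de * x - y) ^+ 2); last by field; rewrite gt_eqF.
by rewrite mulr_ge0 ?sqr_ge0// invr_ge0 ltW.
Qed.

(** On the support of the cutoff the left side equals [t / L^2]. There [ln (1 + t) < L], so the
    cutoff of length [2 L] is at least 1/2 and can stand for the indicator of the support. *)
Lemma sphere_energy_le L t : 0 < L -> 0 <= t ->
  ((1 + t) / 2) ^+ 2 * t * (hy' 0 L t ^+ 2 / hy 0 L t) <=
  2 * t / L ^+ 2 * pp (1 - ln (1 + t) / (2 * L)).
Proof.
move=> L0 t0; have w0 : 0 < 1 + t by rewrite ltr_pwDl.
have r0 : 0 <= 2 * t / L ^+ 2 by rewrite divr_ge0 ?sqr_ge0 ?mulr_ge0.
rewrite /hy /hy' expr0 invr1 !mul1r mul0r mul0r add0r expr1.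
have [pn0|pn0] := leP (1 - ln (1 + t) / L) 0.
  by rewrite (pp_eq0 pn0) expr0n invr0 !mulr0 mulr_ge0 ?pp_ge0.
rewrite [pp (1 - _ / L)]ppE ?(ltW pn0)//.
rewrite (_ : _ * _ = t / L ^+ 2); last first.
  by move: pn0; move: (1 - _ / L) => q q0; field; rewrite !gt_eqF.
have : 2^-1 <= pp (1 - ln (1 + t) / (2 * L)).
  rewrite /pp le_max; apply/orP; right; rewrite invfM mulrCA; lra.
move=> h; apply: le_trans (ler_wpM2l r0 h).
by rewrite le_eqVlt; apply/orP; left; apply/eqP; field; rewrite gt_eqF.
Qed.

(* Either [U^(p-2)] dominates the weight or [U] is dominated by a power of it. *)
Lemma sqr_weight_le (n : nat) (U v : R) : (3 <= n)%N -> 0 < U -> 0 <= v ->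
  U ^+ 2 * expR (- v) <= U * U `^ (yamabe_exp n - 1) + expR (- (n%:R / 2 * v)).
Proof.
move=> n3 U0 v0; have n3R : 3 <= n%:R :> R by rewrite (ler_nat R 3).
set x := ln U.
have UE : U = expR x by rewrite lnK.
have -> : U * U `^ (yamabe_exp n - 1) = expR (yamabe_exp n * x).
  rewrite /powR gt_eqF// -/x [X in X * _]UE -expRD; congr expR; ring.
have -> : U ^+ 2 * expR (- v) = expR (2 * x - v).
  by rewrite expr2 [X in X * X]UE -!expRD; congr expR; ring.
have [h|h] := leP (2 * x - v) (yamabe_exp n * x).
  by apply: ler_wpDr; rewrite ?expR_ge0// ler_expR.
apply: ler_wpDl; first exact: expR_ge0.
rewrite ler_expR; move: h; rewrite /yamabe_exp.
have n2 : 0 < n%:R - 2 :> R by lra.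
move: (n%:R : R) n2 n3R => N n2 n3R.
(* The gap between the exponents is [4 / (n - 2)]: in this case [ln U < - v (n - 2) / 4], hence
   [2 ln U - v < - n v / 2]. This factor [n / 2] is the origin of [tau = b / n]. *)
rewrite (_ : 2 * N / (N - 2) * x = 2 * x + 4 * (x / (N - 2))); last first.
  by field; rewrite gt_eqF.
move=> h; have h2 : x / (N - 2) < - (v / 4) by lra.
have : x <= - (v / 4) * (N - 2).
  by rewrite -ler_pdivrMr// ltW.
lra.
Qed.

End weight_energies.

Lemma cvg_pp2 (R : realType) (x : nat -> R) : x @ \oo --> (0 : R) ->
  (fun j => pp (1 - x j) ^+ 2) @ \oo --> (1 : R).
Proof.
move=> x0; have c1 : (fun j => 1 - x j) @ \oo --> (1 : R).
  by rewrite -[X in _ --> X]subr0; apply: cvgB => //; exact: cvg_cst.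
have c3 : (fun j => pp (1 - x j)) @ \oo --> (1 : R).
  by rewrite -[X in _ --> X](@ppE R 1)//; exact: (cvg_comp _ _ c1 (@continuous_pp R 1)).
rewrite (_ : (fun j => _) = fun j => pp (1 - x j) * pp (1 - x j)).
  by rewrite -[X in _ --> X](mulr1 1); exact: cvgM.
by apply/funext => j; rewrite expr2.
Qed.

Section main_estimate.
Context {R : realType}.
Variables (c : R) (k m : nat).
Hypothesis m2 : (2 <= m)%N.
Local Notation n := (k.+1 + m)%N.
Local Notation D := (chart_dom c k m).
Implicit Types (z : 'rV[R]_n) (L eta : R).
Local Notation xs := (@xs R k m).
Local Notation yt := (@yt R k m).
Local Notation vol := (@vol R c k m).
Local Notation leb := (@lebesgue_rV R n).
Local Notation a := (yamabe_coef n : R).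

Variables (U : 'rV[R]_n -> R) (mu : R).
Hypothesis U_smooth : smooth_on D U.
Hypothesis U_pos : forall z, D z -> 0 < U z.
Hypothesis U_eq : forall z, D z -> conformal_laplacian (chart_metric c false) U z =
  mu * U z `^ (yamabe_exp n - 1).

Let W z := U z * U z `^ (yamabe_exp n - 1).
Let Ip := (\int[leb]_(z in D) (vol z * W z)%:E)%E.
Hypothesis Ip_lty : (Ip < +oo)%E.
Variable B0 : R.
Hypothesis U_le : {ae leb, forall z, D z -> U z <= B0}.

Variables (b de : R).
Hypothesis kb : k%:R < b.
Hypothesis b2 : 2^-1 < b.
Hypothesis de0 : 0 < de.

Let tau := b / n%:R.
Let K1 := - c ^+ 2 * k%:R * k.+1%:R + m%:R * (m%:R - 1) + a * (k%:R ^+ 2 * c ^+ 2 / 4).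
Let kappa := K1 - a * (c ^+ 2 + de) * (1 + de) * tau ^+ 2.
Hypothesis kappa0 : 0 < kappa.

Let oD : open D := @open_chart_dom R c k m.
Let mD : measurable D := open_rV_measurable oD.

Let n3 : (3 <= n)%N. Proof. by rewrite addSn ltnS (leq_trans m2)// leq_addl. Qed.

Let n0 : 0 < n%:R :> R. Proof. by rewrite ltr0n. Qed.

Let tau0 : 0 < tau. Proof. by rewrite divr_gt0// (lt_trans _ b2)// invr_gt0. Qed.

Let a0 : 0 < a. Proof. exact: yamabe_coef_gt0. Qed.

Let mU : measurable_fun D U.
Proof. apply: continuous_on_measurable => //; exact: C1_continuous (C1_U U_smooth). Qed.

Let mW : measurable_fun D W.
Proof.
apply: measurable_funM => //.
exact: (measurableT_comp (measurable_powR _) mU).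
Qed.

Let W0 z : D z -> 0 <= W z.
Proof. by move=> Dz; rewrite mulr_ge0 ?powR_ge0// ltW// U_pos. Qed.

Let cvol : continuous_on D vol.
Proof. by apply: C1_continuous; exact: C1_dhpow. Qed.

Let vol0 z : D z -> 0 <= vol z.
Proof. by move=> Dz; rewrite ltW// vol_gt0. Qed.

Let mvol : measurable_fun D vol.
Proof. exact: continuous_on_measurable. Qed.

Lemma measurable_expR_lq eta d : 0 < eta ->
  measurable_fun D (fun z => expR (d * lq c eta (xs z))).
Proof.
move=> eta0; apply: continuous_on_measurable => //.
apply: (continuous_on_comp (h := fun s => expR (d * lq c eta s))).
  exact: C1_continuous (@C1_xs R c k m).
move=> z Dz; have [s0 st] := xs_range Dz.
have /andP[F0 _] := dfac_range s0 st; have FG := gfac_range eta0 s0 st.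
apply: (@continuous_comp _ _ _ (fun s => d * lq c eta s) expR); last first.
  exact: continuous_expR.
apply: continuousM; first exact: cst_continuous.
apply: is_derive_continuous (is_derive_lq F0 _).
exact: lt_le_trans FG.
Qed.

Lemma volE z : vol z = 2 ^+ m * (dfac c (xs z) ^- k.+1 * (1 + yt z) ^- m).
Proof. by rewrite /vol exprMn exprVn invfM invrK; ring. Qed.

(** [ball_bound] is uniform in both cutoff lengths, so Fatou's lemma removes the two cutoffs at
    once. *)
Lemma integral_volume_weight_lty eta : 0 < eta ->
  (\int[leb]_(z in D) (vol z * expR (- b * lq c eta (xs z)))%:E < +oo)%E.
Proof.
move=> eta0; have [C hC] := ball_bound c eta0 m2 kb b2.
have c2 : 0 <= 2 ^+ m :> R by exact: exprn_ge0.
apply: le_lt_trans (ltry (2 ^+ m * C)).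
apply: (@fatou_le _ _ _ _ _ (fun j z => 2 ^+ m *
   (hx c eta k.+1 b j.+1%:R (xs z) * hy m j.+1%:R (yt z)))) => //.
- by move=> j; apply: measurable_funM => //; apply: measurable_hxhy.
- by move=> j z Dz; rewrite mulr_ge0// hxhy_ge0.
- move=> z Dz; rewrite volE /hx /hy.
  have H x : (fun j : nat => pp (1 - x / j.+1%:R) ^+ 2) @ \oo --> (1 : R).
    apply: cvg_pp2; rewrite -[X in _ --> X](mulr0 x).
    by apply: cvgM; [exact: cvg_cst|exact: cvg_harmonic].
  pose Y := 2 ^+ m *
    (dfac c (xs z) ^- k.+1 * expR (- b * lq c eta (xs z)) * (1 + yt z) ^- m).
  rewrite (_ : (fun j => _) =
      fun j : nat => Y * (pp (1 - lq c eta (xs z) / j.+1%:R) ^+ 2 *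
     pp (1 - ln (1 + yt z) / j.+1%:R) ^+ 2)); last first.
    by apply/funext => j; rewrite /Y; ring.
  rewrite (_ : _ * _ = Y * (1 * 1)); last by rewrite /Y; ring.
  by apply: cvgM; [exact: cvg_cst|apply: cvgM; exact: H].
- move=> j; rewrite EFinM.
  apply: le_trans (lee_wpmul2l _ (hC j.+1%:R j.+1%:R _ _)) => //.
  rewrite -ge0_integralZl_EFin//.
  + by move=> z Dz; rewrite lee_fin hxhy_ge0.
  + by apply/measurable_EFinP; apply: measurable_hxhy.
Qed.

Lemma weighted_square_lty eta : 0 < eta ->
  (\int[leb]_(z in D)
    (vol z * U z ^+ 2 * expR (- (2 * tau) * lq c eta (xs z)))%:E < +oo)%E.
Proof.
move=> eta0; apply: (@le_lt_trans _ _ (Ip +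
  \int[leb]_(z in D) (vol z * expR (- b * lq c eta (xs z)))%:E)%E); last first.
  by rewrite lte_add_pinfty// integral_volume_weight_lty.
rewrite -ge0_integralD//; first last.
- by apply/measurable_EFinP/measurable_funM => //; exact: measurable_expR_lq.
- by move=> z Dz; rewrite lee_fin mulr_ge0 ?vol0 ?expR_ge0.
- by apply/measurable_EFinP/measurable_funM.
- by move=> z Dz; rewrite lee_fin mulr_ge0 ?vol0 ?W0.
apply: ge0_le_integral => //.
- by move=> z Dz; rewrite lee_fin mulr_ge0 ?expR_ge0// mulr_ge0 ?sqr_ge0 ?vol0.
- apply/measurable_EFinP/measurable_funM; last exact: measurable_expR_lq.
  by apply: measurable_funM => //; exact: measurable_funX.
- apply: emeasurable_funD; apply/measurable_EFinP/measurable_funM => //.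
  exact: measurable_expR_lq.
move=> z Dz; have [s0 st] := xs_range Dz.
rewrite lee_fin -mulrDr -mulrA ler_wpM2l ?vol0//.
have q0 := lq_ge0 eta0 s0 st.
have v0 : 0 <= 2 * tau * lq c eta (xs z).
  by apply: mulr_ge0 q0; apply: mulr_ge0 => //; exact: ltW.
have := sqr_weight_le n3 (U_pos Dz) v0.
rewrite !mulNr (_ : n%:R / 2 * _ = b * lq c eta (xs z))//.
by rewrite /tau; field; rewrite gt_eqF.
Qed.

Lemma energy_pointwise eta L L2 z : 0 < eta -> eta <= de -> 0 < L -> 0 < L2 ->
  D z -> U z <= B0 ->
  kappa * (vol z * U z ^+ 2 * prodw (hx c eta 0 (2 * tau) L) (hy 0 L2) z) <=
  vol z * (prodw (hx c eta 0 (2 * tau) L) (hy 0 L2) z * (K1 * U z ^+ 2 - mu * W z)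
    - a * U z ^+ 2 * prodw_energy c (hx c eta 0 (2 * tau) L) (hx' c eta 0 (2 * tau) L)
        (hy 0 L2) (hy' 0 L2) z)
  + (`|mu| * (vol z * W z)
     + a * (c ^+ 2 + eta) * (1 + de^-1) / L ^+ 2 *
         (vol z * U z ^+ 2 * expR (- (2 * tau) * lq c eta (xs z)))
     + a * B0 ^+ 2 * 2 ^+ m / L2 * (4 / (2 * L2) * (hx c eta k.+1 0 L (xs z) *
         (yt z * (1 + yt z) ^- m * pp (1 - ln (1 + yt z) / (2 * L2)))))).
Proof.
move=> eta0 etade L0 L20 Dz UB; have [s0 st] := xs_range Dz; have [t0 _] := yt_range Dz.
have V0 := vol_gt0 Dz; have Wz0 := W0 Dz; have U0 := U_pos Dz.
have /andP[F0 F1] := dfac_range s0 st.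
have e1 := ball_energy_le eta0 tau de0 L0 s0 st.
have e2 := sphere_energy_le L20 t0.
have q0 := lq_ge0 eta0 s0 st.
rewrite /prodw_energy /prodw.
move: e1 e2; set X1 := _ * (_ / hx _ _ _ _ _ _); set X2 := _ * (_ / hy _ _ _) => e1 e2.
set A := hx c eta 0 _ _ _ in e1 *; set B := hy 0 _ _ in e2 *.
set E := expR (- (2 * tau) * _) in e1 *; set p3 := pp _ in e2 *.
have E0 : 0 <= E by exact: expR_ge0.
have E1 : E <= 1.
  by rewrite -expR0 ler_expR mulNr oppr_le0 mulr_ge0// mulr_ge0// ltW.
have Bn : 0 <= B by exact: hy_ge0.
have B1 : B <= 1.
  rewrite /B /hy expr0 invr1 mul1r expr_le1 ?pp_ge0// pp_le1// gerBl.
  by rewrite divr_ge0 ?ln_ge0 ?lerDl// ltW.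
pose p := pp (1 - lq c eta (xs z) / L).
have p0 : 0 <= p by exact: pp_ge0.
have p1 : p <= 1 by rewrite pp_le1// gerBl divr_ge0// ltW.
have AE : A = E * p ^+ 2 by rewrite /A /hx expr0 invr1 mul1r.
have HE : hx c eta k.+1 0 L (xs z) = dfac c (xs z) ^- k.+1 * p ^+ 2.
  by rewrite /hx oppr0 mul0r expR0 mulr1.
have p20 : 0 <= p ^+ 2 by exact: sqr_ge0.
have p21 : p ^+ 2 <= 1 by rewrite expr_le1.
have A0 : 0 <= A by rewrite AE mulr_ge0.
have A1 : A <= 1 by rewrite AE mulr_ile1.
have Ap : A <= p ^+ 2 by rewrite AE ler_piMl.
have U20 : 0 <= U z ^+ 2 by exact: sqr_ge0.
have UB2 : U z ^+ 2 <= B0 ^+ 2.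
  by rewrite ler_sqr ?nnegrE ?(ltW U0)// (le_trans (ltW U0)).
have c0 : 0 <= c ^+ 2 + eta by rewrite addr_ge0 ?sqr_ge0// ltW.
have d1 : 0 <= 1 + de^-1 by rewrite addr_ge0 ?invr_ge0// ltW.
have p30 : 0 <= p3 by exact: pp_ge0.
have r1 : vol z * (U z ^+ 2 * (X2 * A)) <=
   B0 ^+ 2 * 2 ^+ m / L2 * (4 / (2 * L2) * (hx c eta k.+1 0 L (xs z) *
         (yt z * (1 + yt z) ^- m * p3))).
  have X20 : 0 <= 2 * yt z / L2 ^+ 2 * p3.
    by apply: mulr_ge0 p30; apply: divr_ge0; [exact: mulr_ge0|exact: sqr_ge0].
  have h1 : X2 * A <= 2 * yt z / L2 ^+ 2 * p3 * p ^+ 2.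
    by apply: le_trans (ler_wpM2r A0 e2) _; exact: ler_wpM2l.
  have h2 : U z ^+ 2 * (X2 * A) <= B0 ^+ 2 * (2 * yt z / L2 ^+ 2 * p3 * p ^+ 2).
    apply: le_trans (ler_wpM2l U20 h1) _; apply: ler_wpM2r UB2.
    exact: mulr_ge0.
  apply: le_trans (ler_wpM2l (ltW V0) h2) _.
  rewrite HE volE le_eqVlt; apply/orP; left; apply/eqP.
  move: (dfac c (xs z) ^- k.+1) ((1 + yt z) ^- m) (2 ^+ m) => x y w.
  by field; rewrite gt_eqF.
have r2 : X1 * B <= (c ^+ 2 + eta) * (1 + de) * tau ^+ 2 * (A * B)
     + (c ^+ 2 + eta) * (1 + de^-1) / L ^+ 2 * E.
  apply: le_trans (ler_wpM2r Bn e1) _.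
  rewrite (_ : _ * B = (c ^+ 2 + eta) * (1 + de) * tau ^+ 2 * (A * B)
     + (c ^+ 2 + eta) * (1 + de^-1) / L ^+ 2 * E * B); last by ring.
  rewrite lerD2l ler_piMr// mulr_ge0// divr_ge0 ?sqr_ge0//.
  exact: mulr_ge0.
have r3 : mu * (A * B) * W z <= `|mu| * W z.
  apply: ler_wpM2r => //; apply: le_trans (ler_norm _) _.
  have AB0 : 0 <= A * B by exact: mulr_ge0.
  rewrite normrM (ger0_norm AB0) ler_piMr//.
  exact: mulr_ile1.
(* Replacing [eta] by [de] keeps [kappa] independent of [eta]. *)
have r4 : (c ^+ 2 + eta) * (1 + de) * tau ^+ 2 * (A * B) <=
          (c ^+ 2 + de) * (1 + de) * tau ^+ 2 * (A * B).
  apply: ler_wpM2r; first exact: mulr_ge0.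
  apply: ler_wpM2r; first exact: sqr_ge0.
  apply: ler_wpM2r; first by rewrite addr_ge0// ltW.
  by rewrite lerD2l.
have aU0 : 0 <= vol z * (a * U z ^+ 2).
  by apply: mulr_ge0 (ltW V0) _; apply: mulr_ge0 (ltW a0) _.
have s1 := ler_wpM2l aU0 (le_trans r2 (lerD r4 (lexx _))).
have s2 := ler_wpM2l (ltW a0) r1.
have s3 := ler_wpM2l (ltW V0) r3.
rewrite /kappa -subr_ge0.
move: s1 s2 s3; set T3 := 4 / (2 * L2) * _.
move: (U z ^+ 2) (W z) (vol z) => u v w s1 s2 s3.
have -> : w * (A * B * (K1 * u - mu * v) - a * u * (X1 * B + X2 * A)) +
  (`|mu| * (w * v) + a * (c ^+ 2 + eta) * (1 + de^-1) / L ^+ 2 * (w * u * E) +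
   a * B0 ^+ 2 * 2 ^+ m / L2 * T3) -
  (K1 - a * (c ^+ 2 + de) * (1 + de) * tau ^+ 2) * (w * u * (A * B)) =
  (w * (a * u) * ((c ^+ 2 + de) * (1 + de) * tau ^+ 2 * (A * B) +
        (c ^+ 2 + eta) * (1 + de^-1) / L ^+ 2 * E) - w * (a * u) * (X1 * B)) +
  (a * (B0 ^+ 2 * 2 ^+ m / L2 * T3) - a * (w * (u * (X2 * A)))) +
  (w * (`|mu| * v) - w * (mu * (A * B) * v)) by ring.
by apply: addr_ge0; [apply: addr_ge0|]; rewrite subr_ge0.
Qed.

(** [L] is chosen first, from the finite weighted square of [U]. The capacity constant depends on
    [L], so [L2] comes second. Each of the two errors is made at most 1, whence the 2, and the bound
    no longer involves [eta] or [M]. *)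
Lemma main_estimate eta (M : R) : 0 < eta -> eta <= de -> 0 < M ->
  exists L L2, [/\ M <= L, M <= L2 &
    (\int[leb]_(z in D) (kappa * (vol z * U z ^+ 2 *
       prodw (hx c eta 0 (2 * tau) L) (hy 0 L2) z))%:E <= `|mu|%:E * Ip + 2%:E)%E].
Proof.
move=> eta0 etade M0.
pose q z := vol z * U z ^+ 2 * expR (- (2 * tau) * lq c eta (xs z)).
have q0 z : D z -> 0 <= q z.
  by move=> Dz; rewrite mulr_ge0 ?expR_ge0// mulr_ge0 ?sqr_ge0 ?vol0.
have mq : measurable_fun D q.
  apply: measurable_funM; last exact: measurable_expR_lq.
  by apply: measurable_funM => //; exact: measurable_funX.
pose J := (\int[leb]_(z in D) (q z)%:E)%E.
have J0 : (0 <= J)%E by apply: integral_ge0 => z Dz; rewrite lee_fin q0.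
have Jlty : (J < +oo)%E := weighted_square_lty eta0.
have Jf : J = (fine J)%:E by rewrite fineK// ge0_fin_numE.
have Jf0 : 0 <= fine J by exact: fine_ge0.
pose C1 := a * (c ^+ 2 + eta) * (1 + de^-1).
have C10 : 0 <= C1.
  rewrite mulr_ge0 ?addr_ge0 ?invr_ge0 ?(ltW de0)// mulr_ge0 ?(ltW a0)//.
  by rewrite addr_ge0 ?sqr_ge0// ltW.
pose L := M + 1 + C1 * fine J.
have CJ0 : 0 <= C1 * fine J by exact: mulr_ge0.
have L0 : 0 < L by rewrite /L; lra.
have [Cc hC] := @capacity_bound R c eta k m eta0 m2 L L0.
pose cp L2 z := 4 / (2 * L2) * (hx c eta k.+1 0 L (xs z) *
         (yt z * (1 + yt z) ^- m * pp (1 - ln (1 + yt z) / (2 * L2)))).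
pose C2 := a * B0 ^+ 2 * 2 ^+ m.
have C20 : 0 <= C2.
  by rewrite /C2 mulr_ge0 ?exprn_ge0// mulr_ge0 ?sqr_ge0// ltW.
pose L2 := M + C2 * `|Cc|.
have L20 : 0 < L2 by rewrite /L2 ltr_wpDr// mulr_ge0.
have cp0 z : D z -> 0 <= cp L2 z.
  move=> Dz; have [s0 st] := xs_range Dz; have [t0 _] := yt_range Dz.
  apply: mulr_ge0; first by rewrite divr_ge0// ?mulr_ge0// ltW.
  apply: mulr_ge0; first exact: hx_ge0.
  apply: mulr_ge0 (pp_ge0 _); apply: (mulr_ge0 t0).
  by rewrite invr_ge0 exprn_ge0// addr_ge0.
have mcp : measurable_fun D (cp L2).
  apply: measurable_funM => //; apply: (continuous_on_measurable oD).
  by apply: continuous_on_capacity.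
exists L, L2; split.
- by rewrite /L -addrA lerDl addr_ge0.
- by rewrite /L2 lerDl; exact: mulr_ge0.
have wA := weight_hx c eta0 0 (2 * tau) L0; have wB := @weight_hy R 0 _ L20.
have A0 s : 0 <= hx c eta 0 (2 * tau) L s.
  by rewrite /hx expr0 invr1 mul1r mulr_ge0 ?sqr_ge0 ?expR_ge0.
have Bn t : 0 <= hy 0 L2 t by rewrite /hy expr0 invr1 mul1r sqr_ge0.
have A'0 s : hx c eta 0 (2 * tau) L s = 0 -> hx' c eta 0 (2 * tau) L s = 0.
  rewrite /hx /hx' expr0 invr1 !mul1r => /eqP; rewrite mulf_eq0 gt_eqF ?expR_gt0//=.
  by rewrite expf_eq0/= => /eqP ->; rewrite expr0n /= !(mulr0, mul0r) subr0 mulr0.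
have B'0 t : hy 0 L2 t = 0 -> hy' 0 L2 t = 0.
  rewrite /hy /hy' expr0 invr1 !mul1r => /eqP.
  by rewrite expf_eq0/= => /eqP ->; rewrite expr0n /= !(mulr0, mul0r) addr0 oppr0.
have mP : measurable_fun D (prodw (hx c eta 0 (2 * tau) L) (hy 0 L2)).
  apply: continuous_on_measurable => //; apply: C1_continuous.
  exact: (C1_prodw wA wB).
have mVW : measurable_fun D (fun z => `|mu| * (vol z * W z)).
  by apply: measurable_funM => //; exact: measurable_funM.
pose G2 z := `|mu| * (vol z * W z) + C1 / L ^+ 2 * q z + C2 / L2 * cp L2 z.
have CL0 : 0 <= C1 / L ^+ 2 by rewrite divr_ge0 ?sqr_ge0.
have CL20 : 0 <= C2 / L2 by rewrite divr_ge0// ltW.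
apply: (@le_trans _ _ (\int[leb]_(z in D) (G2 z)%:E)%E).
  apply: (energy_ineq wA wB A0 Bn A'0 B'0 U_smooth n3 U_eq).
  - apply: measurable_funM => //; apply: measurable_funM => //.
    by apply: measurable_funM => //; exact: measurable_funX.
  - apply: measurable_funD; last by apply: measurable_funM.
    by apply: measurable_funD => //; apply: measurable_funM.
  - move=> z Dz; apply: mulr_ge0 (ltW kappa0) _.
    apply: mulr_ge0; first by apply: mulr_ge0 (vol0 Dz) (sqr_ge0 _).
    exact: mulr_ge0.
  - move=> z Dz; apply: addr_ge0; [apply: addr_ge0|].
    + by rewrite mulr_ge0// mulr_ge0 ?vol0 ?W0.
    + by rewrite mulr_ge0// q0.
    + by rewrite mulr_ge0// cp0.
  - apply: filterS U_le => z UB Dz.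
    exact: (energy_pointwise eta0 etade L0 L20 Dz (UB Dz)).
have -> : (\int[leb]_(z in D) (G2 z)%:E =
   `|mu|%:E * Ip + ((C1 / L ^+ 2)%:E * J
    + (C2 / L2)%:E * \int[leb]_(z in D) (cp L2 z)%:E))%E.
  rewrite /G2; under eq_integral do rewrite !EFinD.
  rewrite ge0_integralD//; first last.
  - by apply/measurable_EFinP; apply: measurable_funM.
  - by move=> z Dz; rewrite lee_fin mulr_ge0// cp0.
  - apply: emeasurable_funD; apply/measurable_EFinP => //.
    exact: measurable_funM.
  - move=> z Dz; rewrite -EFinD lee_fin; apply: addr_ge0; last by rewrite mulr_ge0// q0.
    by rewrite mulr_ge0// mulr_ge0 ?vol0 ?W0.
  rewrite ge0_integralD//; first last.
  - by apply/measurable_EFinP; apply: measurable_funM.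
  - by move=> z Dz; rewrite lee_fin mulr_ge0// q0.
  - exact/measurable_EFinP.
  - by move=> z Dz; rewrite lee_fin mulr_ge0// mulr_ge0 ?vol0 ?W0.
  rewrite -addeA; congr (_ + (_ + _))%E.
  - under eq_integral do rewrite EFinM.
    rewrite ge0_integralZl_EFin//.
      by move=> z Dz; rewrite lee_fin mulr_ge0 ?vol0 ?W0.
    by apply/measurable_EFinP; apply: measurable_funM.
  - under eq_integral do rewrite EFinM.
    rewrite ge0_integralZl_EFin//.
    exact/measurable_EFinP.
  - under eq_integral do rewrite EFinM.
    rewrite ge0_integralZl_EFin//.
    exact/measurable_EFinP.
apply: leeD2l; rewrite (_ : 2%:E = 1%:E + 1%:E)%E//; apply: leeD.
  rewrite Jf -EFinM lee_fin mulrAC ler_pdivrMr ?exprn_gt0// mul1r.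
  have L1 : 1 <= L by rewrite /L; lra.
  apply: le_trans (_ : L <= _); first by rewrite /L; lra.
  by rewrite expr2 ler_peMl// ltW.
have L220 : 0 < 2 * L2 by exact: mulr_gt0.
have CL2E : (0 <= (C2 / L2)%:E)%E by rewrite lee_fin.
apply: le_trans (lee_wpmul2l CL2E (hC (2 * L2) L220)) _.
rewrite -EFinM lee_fin mulrAC ler_pdivrMr// mul1r.
apply: le_trans (_ : C2 * `|Cc| <= _); first by rewrite ler_wpM2l// ler_norm.
by rewrite /L2 lerDr ltW.
Qed.

Lemma square_integrable :
  (\int[leb]_(z in D) (vol z * U z ^+ 2)%:E < +oo)%E.
Proof.
pose eta j : R := de / j.+1%:R.
have eta0 j : 0 < eta j by rewrite divr_gt0.
have etade j : eta j <= de by rewrite ler_pdivrMr// ler_peMr ?ler1n// ltW.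
have h j := main_estimate (eta0 j) (etade j) (ltr0Sn R j).
have [L hL] := choice h; have {hL}[L2 hL] := choice hL.
have mv2 : measurable_fun D (fun z => vol z * U z ^+ 2).
  by apply: measurable_funM => //; exact: measurable_funX.
have C0 : (0 <= `|mu|%:E * Ip + 2%:E)%E.
  rewrite adde_ge0// ?lee_fin//; apply: mule_ge0; first by rewrite lee_fin.
  by apply: integral_ge0 => z Dz; rewrite lee_fin mulr_ge0 ?vol0 ?W0.
have Cty : (`|mu|%:E * Ip + 2%:E < +oo)%E.
  by rewrite lte_add_pinfty ?ltry// lte_mul_pinfty ?lee_fin.
apply: le_lt_trans (ltry (kappa^-1 * fine (`|mu|%:E * Ip + 2%:E)%E)).
apply: le_scaled_integral => //.
rewrite -ge0_integralZl_EFin ?(ltW kappa0)//; first last.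
- exact/measurable_EFinP.
- by move=> z Dz; rewrite lee_fin mulr_ge0 ?sqr_ge0 ?vol0.
under eq_integral do rewrite -EFinM.
have L0 j : 0 < L j by have [h1 _ _] := hL j; exact: lt_le_trans h1.
have L20 j : 0 < L2 j by have [_ h1 _] := hL j; exact: lt_le_trans h1.
have wA j := weight_hx c (eta0 j) 0 (2 * tau) (L0 j).
have wB j := @weight_hy R 0 _ (L20 j).
apply: (@fatou_le _ _ _ _ _ (fun j z => kappa * (vol z * U z ^+ 2 *
       prodw (hx c (eta j) 0 (2 * tau) (L j)) (hy 0 (L2 j)) z))) => //.
- move=> j; apply: measurable_funM => //; apply: measurable_funM => //.
  apply: continuous_on_measurable => //.
  exact: C1_continuous (C1_prodw (wA j) (wB j)).
- move=> j z Dz; apply: mulr_ge0 (ltW kappa0) _.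
  apply: mulr_ge0; first by apply: mulr_ge0 (vol0 Dz) (sqr_ge0 _).
  exact: hxhy_ge0.
- move=> z Dz; have [s0 st] := xs_range Dz; have [t0 _] := yt_range Dz.
  have /andP[F0 _] := dfac_range s0 st.
  have ln0 : 0 <= ln (1 + yt z) by rewrite ln_ge0// lerDl.
  pose q j := lq c (eta j) (xs z).
  have q0 j : 0 <= q j by exact: lq_ge0.
  (* From [ln (1 + x) <= x]: the exponents tend to 0 pointwise, so the weights converge to 1. *)
  have qle j : q j <= xs z / dfac c (xs z) * de * j.+1%:R^-1.
    have G0 := lt_le_trans F0 (gfac_range (eta0 j) s0 st).
    have sF : 0 <= eta j * xs z / dfac c (xs z).
      by rewrite divr_ge0 ?(ltW F0)// mulr_ge0// ltW.
    rewrite /q /lq -ln_div ?posrE//.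
    rewrite (_ : gfac _ _ _ / _ = 1 + eta j * xs z / dfac c (xs z)); last first.
      by rewrite /gfac; field; rewrite gt_eqF.
    apply: le_trans (le_ln1Dx _) _; first by apply: lt_le_trans sF; rewrite ltrN10.
    by rewrite le_eqVlt; apply/orP; left; apply/eqP; rewrite /eta; ring.
  have hz (x : R) : (fun j : nat => x * j.+1%:R^-1) @ \oo --> (0 : R).
    rewrite -[X in _ --> X](mulr0 x).
    by apply: cvgM; [exact: cvg_cst|exact: cvg_harmonic].
  have q_0 : q @ \oo --> (0 : R).
    apply: (squeeze_cvgr _ (cvg_cst 0) (hz (xs z / dfac c (xs z) * de))).
    by apply: nearW => j; rewrite q0 qle.
  have qL_0 : (fun j => q j / L j) @ \oo --> (0 : R).
    apply: (squeeze_cvgr _ (cvg_cst 0) q_0).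
    apply: nearW => j; rewrite divr_ge0 ?(ltW (L0 j))//= ler_pdivrMr//.
    have [h1 _ _] := hL j; rewrite ler_peMr// (le_trans _ h1)//.
    by rewrite (ler_nat R 1).
  have w_0 : (fun j => ln (1 + yt z) / L2 j) @ \oo --> (0 : R).
    apply: (squeeze_cvgr _ (cvg_cst 0) (hz (ln (1 + yt z)))).
    apply: nearW => j; rewrite divr_ge0 ?(ltW (L20 j))//=.
    have [_ h1 _] := hL j; rewrite ler_wpM2l// lef_pV2 ?posrE//.
  have e_1 : (fun j => expR (- (2 * tau) * q j)) @ \oo --> (1 : R).
    rewrite -[X in _ --> X]expR0 -[in X in _ --> X](mulr0 (- (2 * tau))).
    have c1 : (fun j => - (2 * tau) * q j) @ \oo --> - (2 * tau) * 0.
      by apply: cvgM => //; exact: cvg_cst.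
    exact: (cvg_comp _ _ c1 (@continuous_expR R _)).
  have -> : kappa * (vol z * U z ^+ 2) = kappa * (vol z * U z ^+ 2) * 1 * 1.
    by rewrite !mulr1.
  rewrite (_ : (fun j => _) = fun j => kappa * (vol z * U z ^+ 2) *
    (expR (- (2 * tau) * q j) * pp (1 - q j / L j) ^+ 2) *
    pp (1 - ln (1 + yt z) / L2 j) ^+ 2); last first.
    by apply/funext => j; rewrite /prodw /hx /hy !expr0 !invr1 !mul1r /q; ring.
  apply: cvgM; last exact: cvg_pp2.
  apply: cvgM; first exact: cvg_cst.
  by rewrite -[X in _ --> X]mulr1; apply: cvgM => //; exact: cvg_pp2.
- by move=> j; have [_ _] := hL j.
Qed.

End main_estimate.

(** * Transfer to the model space *)

Section density.
Local Open Scope ereal_scope.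
Context d1 d2 (X : measurableType d1) (Y : measurableType d2) (R : realType).
Variables (mu : {measure set X -> \bar R}) (nu : {measure set Y -> \bar R}).
Variables (D : set X) (phi : X -> Y) (g : X -> R).
Hypotheses (mD : measurable D) (mphi : measurable_fun [set: X] phi).
Hypotheses (mg : measurable_fun D g) (g0 : forall x, (0 <= g x)%R).
Hypothesis nuE : forall A, measurable A ->
  nu A = \int[mu]_(x in D `&` phi @^-1` A) (g x)%:E.

Import HBNNSimple.

(** [nu] is the image under [phi] of the measure with density [g] on [D], known only through its
    values on sets; simple functions and monotone convergence extend the formula to integrals. *)
Lemma ge0_integral_density (f : Y -> \bar R) : (forall y, 0 <= f y) ->
  measurable_fun [set: Y] f ->
  \int[nu]_y f y = \int[mu]_(x in D) (f (phi x) * (g x)%:E).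
Proof.
move=> f0 mf; pose h := nnsfun_approx measurableT mf.
have mgE : measurable_fun D (fun x => (g x)%:E) by exact/measurable_EFinP.
have mphiD (F : Y -> R) : measurable_fun setT F -> measurable_fun D (F \o phi).
  by move=> mF; apply: measurable_funTS; exact: measurableT_comp.
have -> : \int[nu]_y f y = limn (fun n => \int[nu]_y (EFin \o h n) y).
  have fE y : f y = limn (fun n => (EFin \o h n) y).
    by apply/esym/cvg_lim => //; exact: cvg_nnsfun_approx.
  under eq_integral => x _ do rewrite fE.
  apply: monotone_convergence => //.
  - by move=> n; apply/measurable_EFinP; exact/measurable_funP.
  - by move=> n x _ //=; rewrite lee_fin.
  - by move=> x _ a b ab; rewrite lee_fin; exact/lefP/nd_nnsfun_approx.
have -> : \int[mu]_(x in D) (f (phi x) * (g x)%:E) =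
    limn (fun n => \int[mu]_(x in D) ((h n (phi x))%:E * (g x)%:E)).
  have fg x : f (phi x) * (g x)%:E = limn (fun n => (h n (phi x))%:E * (g x)%:E).
    apply/esym/cvg_lim => //; apply: cvgeZr => //.
    exact: (@cvg_nnsfun_approx _ _ _ _ _ _ mf _ (phi x)).
  under eq_integral => x _ do rewrite fg.
  apply: monotone_convergence => //.
  - move=> n; apply: emeasurable_funM => //.
    by apply/measurable_EFinP/mphiD; exact/measurable_funP.
  - by move=> n x _ /=; rewrite mule_ge0 ?lee_fin.
  - move=> x _ a b ab/=; rewrite lee_wpmul2r ?lee_fin//.
    exact/lefP/nd_nnsfun_approx.
congr (limn _); apply/funext => n.
transitivity (\int[nu]_y
   (\sum_(r \in range (h n)) (r * \1_(h n @^-1` [set r]) y)%:E)).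
  by apply: eq_integral => t _; rewrite /= fimfunE -fsumEFin.
rewrite ge0_integral_fsum//; last 2 first.
- by move=> r; apply/measurable_EFinP; exact: measurable_funM.
- by move=> r y _; exact: nnfun_muleindic_ge0.
transitivity (\int[mu]_(x in D) (\sum_(r \in range (h n))
    (r * \1_(h n @^-1` [set r]) (phi x))%:E * (g x)%:E)); last first.
  apply: eq_integral => x xD.
  rewrite -ge0_mule_fsuml => [|r]; last exact: nnfun_muleindic_ge0.
  by rewrite fsumEFin // -(fimfunE _ (phi x)).
rewrite ge0_integral_fsum//; last 2 first.
- move=> r; apply: emeasurable_funM => //; apply/measurable_EFinP.
  by apply: (mphiD (fun y => r * \1_(h n @^-1` [set r]) y)%R); exact: measurable_funM.
- by move=> r x _; rewrite mule_ge0 ?lee_fin// -lee_fin nnfun_muleindic_ge0.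
apply: eq_fsbigr => r /set_mem [y _ hr].
have r0 : (0 <= r)%R by rewrite -hr.
under eq_integral do rewrite EFinM.
rewrite integralZl_indic_nnsfun// integral_indic// setIT nuE//.
under [RHS]eq_integral do rewrite EFinM -muleA.
rewrite ge0_integralZl//; last 2 first.
- apply: emeasurable_funM => //; apply/measurable_EFinP.
  by apply: (mphiD \1_(h n @^-1` [set r])).
- by move=> x _; rewrite mule_ge0// lee_fin.
congr (_ * _).
rewrite integral_mkcondr; apply: eq_integral => x _.
by rewrite epatch_indic muleC.
Qed.

End density.

(** * Positivity of the constant [kappa] *)

Section decay_exponent.
Context {R : realType}.

(* The form L^g + a c^2 k^2 / 4 stays positive after losing the gradient of the
   critical weight, whose exponent is k / n. *)
Lemma critical_gap (k m : nat) (c : R) : (2 <= m)%N -> -1 <= c <= 1 ->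
  2 * k%:R * `|c| < (k.+1 + m)%:R * (m%:R - 1) ->
  0 < - c ^+ 2 * k%:R * k.+1%:R + m%:R * (m%:R - 1)
   + yamabe_coef (k.+1 + m) * (k%:R ^+ 2 * c ^+ 2 / 4)
   - yamabe_coef (k.+1 + m) * c ^+ 2 * (k%:R / (k.+1 + m)%:R) ^+ 2.
Proof.
move=> m2 c1; have m2R : 2 <= m%:R :> R by rewrite (ler_nat R 2).
have k0 : 0 <= k%:R :> R by [].
have x0 := normr_ge0 c; have x1 : `|c| <= 1 by rewrite ler_norml.
rewrite -[c ^+ 2](real_normK (num_real c)).
rewrite /yamabe_coef natrD -[k.+1%:R]natr1.
move: (`|c|) (k%:R : R) (m%:R : R) x0 x1 k0 m2R => x K M x0 x1 K0 M2 h.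
have N0 : 0 < K + 1 + M by lra.
have N20 : 0 < K + 1 + M - 2 by lra.
(* Over the denominator n^2, the coefficient of [c^2 k] is [n^2 (k + 1) - k (n - 1) (n + 2) = n (m +
   1) + 2 k]. *)
rewrite (_ : _ - _ = ((K + 1 + M) ^+ 2 * (M * (M - 1)) - x ^+ 2 * K *
   ((K + 1 + M) * (M + 1) + 2 * K)) / (K + 1 + M) ^+ 2); last first.
  by field; rewrite !gt_eqF.
rewrite divr_gt0 ?exprn_gt0// subr_gt0.
set N := K + 1 + M in h N0 *.
have T1 : 1 <= M - 1 by lra.
pose y := K * x.
have y0 : 0 <= y by rewrite mulr_ge0.
have yx : y * x <= y by rewrite ler_piMr.
have hy : 2 * y < N * (M - 1) by rewrite /y mulrA.
(* The bound [|c| <= 1] enters here, through [y * x <= y]; the rest depends on [c] only through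
   [y = k |c|]. *)
apply: le_lt_trans (_ : y * (N * (M + 1)) + 2 * y ^+ 2 < _).
  rewrite (_ : x ^+ 2 * K * _ = y * x * (N * (M + 1)) + 2 * y ^+ 2); last first.
    by rewrite /y; ring.
  by rewrite lerD2r ler_wpM2r// mulr_ge0//; lra.
clearbody y N; pose q := N * (M - 1).
have q0 : 0 < q by rewrite mulr_gt0//; lra.
have h1 : 2 * y * (q + N) < q * (q + N) by rewrite ltr_pM2r// addr_gt0.
have h2 : y * (2 * y) <= y * q by rewrite ler_wpM2l// ltW.
(* The assumption reads [2 y < q], and it bounds the subtracted terms by [2 y (q + N)], hence
   strictly below [q (q + N)]. *)
have -> : N ^+ 2 * (M * (M - 1)) = q * (q + N) by rewrite /q; ring.
apply: le_lt_trans h1.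
have -> : y * (N * (M + 1)) = y * q + 2 * y * N by rewrite /q; ring.
lra.
Qed.

(** Continuity at [b = k], [de = 0] made explicit: if a perturbation [e <= 1] costs at most [C * e],
    then [e = g / (g + C)] keeps the gap [g] positive. *)
Lemma decay_exponent (k m : nat) (c : R) : (2 <= m)%N -> -1 <= c <= 1 ->
  2 * k%:R * `|c| < (k.+1 + m)%:R * (m%:R - 1) ->
  exists b de : R, [/\ k%:R < b, 2^-1 < b, 0 < de &
   0 < - c ^+ 2 * k%:R * k.+1%:R + m%:R * (m%:R - 1)
     + yamabe_coef (k.+1 + m) * (k%:R ^+ 2 * c ^+ 2 / 4)
     - yamabe_coef (k.+1 + m) * (c ^+ 2 + de) * (1 + de) * (b / (k.+1 + m)%:R) ^+ 2].
Proof.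
move=> m2 c1 h; have m2R : 2 <= m%:R :> R by rewrite (ler_nat R 2).
set n := (k.+1 + m)%N.
have n3 : (3 <= n)%N by rewrite /n addSn ltnS (leq_trans m2)// leq_addl.
have a0 : 0 < yamabe_coef n :> R by exact: yamabe_coef_gt0.
have N0 : 0 < n%:R :> R by rewrite ltr0n.
have c20 : 0 <= c ^+ 2 by exact: sqr_ge0.
have c21 : c ^+ 2 <= 1.
  by rewrite -[c ^+ 2](real_normK (num_real c)) expr_le1// ler_norml.
pose S : R := - c ^+ 2 * k%:R * k.+1%:R + m%:R * (m%:R - 1)
     + yamabe_coef n * (k%:R ^+ 2 * c ^+ 2 / 4).
have gapb : exists b : R, [/\ k%:R < b, 2^-1 < b &
   0 < - c ^+ 2 * k%:R * k.+1%:R + m%:R * (m%:R - 1)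
     + yamabe_coef n * (k%:R ^+ 2 * c ^+ 2 / 4)
     - yamabe_coef n * c ^+ 2 * (b / n%:R) ^+ 2].
  have := critical_gap m2 c1 h; rewrite -/n -/S => S0.
  (* For [k = 0] the exponent cannot approach [k] because of [2^-1 < b]; [b = 1] leaves an explicit
     inequality in [m]. *)
  have [k0|k0] := eqVneq k 0%N.
    exists 1; rewrite k0; split; [exact: ltr01|lra|].
    have -> : S = m%:R * (m%:R - 1) by rewrite /S k0; ring.
    have -> : n%:R = m%:R + 1 :> R by rewrite /n k0 natrD addrC.
    rewrite /yamabe_coef (_ : n%:R = m%:R + 1); last by rewrite /n k0 natrD addrC.
    move: (m%:R : R) m2R => M M2.
    rewrite (_ : _ - _ = (M / (M - 1) / (M + 1) ^+ 2) *
        (((M - 1) * (M + 1)) ^+ 2 - 4 * c ^+ 2)); last first.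
      by field; rewrite !gt_eqF//; lra.
    rewrite mulr_gt0 ?divr_gt0 ?exprn_gt0 ?subr_gt0//; try lra.
    have : 3 <= (M - 1) * (M + 1) by nra.
    move: (_ * _) => q q3; rewrite expr2; nra.
  have k1 : 1 <= k%:R :> R by rewrite (ler_nat R 1) lt0n.
  set g := S - _ in S0.
  pose C : R := yamabe_coef n * (2 * k%:R + 1) / n%:R ^+ 2.
  have C0 : 0 < C.
    by rewrite /C divr_gt0 ?exprn_gt0// mulr_gt0//; lra.
  pose e := g / (g + C).
  have gC : 0 < g + C by rewrite addr_gt0.
  have e0 : 0 < e by rewrite divr_gt0.
  have e1 : e <= 1 by rewrite ler_pdivrMr// mul1r lerDl ltW.
  exists (k%:R + e); split; [by rewrite ltrDl|lra|].
  have -> : S - yamabe_coef n * c ^+ 2 * ((k%:R + e) / n%:R) ^+ 2 =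
     g - c ^+ 2 * (yamabe_coef n * (2 * k%:R + e) / n%:R ^+ 2) * e.
    by rewrite /g; field; rewrite gt_eqF.
  rewrite subr_gt0; apply: le_lt_trans (_ : C * e < _).
    apply: ler_wpM2r; first exact: ltW.
    have q0 : 0 <= yamabe_coef n * (2 * k%:R + e) / n%:R ^+ 2.
      by rewrite divr_ge0 ?sqr_ge0// mulr_ge0 ?(ltW a0)//; lra.
    apply: le_trans (ler_wpM2r q0 c21) _.
    rewrite mul1r /C; apply: ler_wpM2r; first by rewrite invr_ge0 sqr_ge0.
    by rewrite ler_wpM2l ?(ltW a0)// lerD2l.
  by rewrite /e mulrA ltr_pdivrMr// mulrC ltr_pM2l// ltrDr.
have [b [kb b2 gp]] := gapb.
move: gp; rewrite -/S; set g := S - _ => g0.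
(* The loss is the coefficient times [de (c^2 + 1 + de) <= 3 de]; 6 is twice that 3. *)
pose C : R := 6 * yamabe_coef n * (b / n%:R) ^+ 2.
have C0 : 0 <= C by rewrite mulr_ge0 ?sqr_ge0// mulr_ge0// ltW.
pose de := g / (g + C).
have gC : 0 < g + C by rewrite ltr_wpDr.
have de0 : 0 < de by rewrite divr_gt0.
have de1 : de <= 1 by rewrite ler_pdivrMr// mul1r lerDl.
exists b, de; split => //; rewrite -/S.
have -> : S - yamabe_coef n * (c ^+ 2 + de) * (1 + de) * (b / n%:R) ^+ 2 =
   g - yamabe_coef n * (b / n%:R) ^+ 2 * (de * (c ^+ 2 + 1 + de)) by rewrite /g; ring.
rewrite subr_gt0; apply: le_lt_trans (_ : C / 2 * de < _).
  rewrite /C (_ : _ / 2 * de = yamabe_coef n * (b / n%:R) ^+ 2 * (de * 3));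
    last by field; rewrite gt_eqF.
  apply: ler_wpM2l; first by rewrite mulr_ge0 ?sqr_ge0// ltW.
  by rewrite ler_wpM2l ?(ltW de0)//; lra.
rewrite /de mulrA ltr_pdivrMr//.
rewrite mulrC ltr_pM2l//; lra.
Qed.

End decay_exponent.

Lemma sqnorm_stereo (R : realType) b m (y : 'rV[R]_m) : sqnorm (stereo b y) = 1.
Proof.
have w0 := sqnorm1D_neq0 y.
rewrite /sqnorm big_split_ord/= big_ord1 row_mxEr mxE eqxx mulr1n.
rewrite (eq_bigr (fun i => (2 / (1 + sqnorm y)) ^+ 2 * y 0 i ^+ 2)); last first.
  by move=> i _; rewrite row_mxEl mxE exprMn.
rewrite -mulr_sumr -/(sqnorm y) [((-1) ^+ b * _) ^+ 2]exprMn sqrr_sign mul1r.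
by field.
Qed.

(** * Norms on the model space as integrals in the chart *)

Section square_integrability.
Context {R : realType}.
Variables (c : R) (k m : nat) (u : 'rV[R]_k.+1 * 'rV[R]_(m + 1) -> R) (mu : R).
Local Notation n := (k.+1 + m)%N.
Local Notation D := (chart_dom c k m).
Local Notation mv := (model_volume c k m).
Local Notation leb := (@lebesgue_rV R n).
Local Notation v := (u \_ (model c k m)).

Hypothesis m2 : (2 <= m)%N.
Hypothesis c1 : -1 <= c <= 1.
Hypothesis u_smooth : smooth_on D (u \o chart false).
Hypothesis u_pos : forall p, model c k m p -> 0 < u p.
Hypothesis u_Linfty : v \in Lfun mv +oo%E.
Hypothesis u_Lp : v \in Lfun mv (yamabe_exp n)%:E.
Hypothesis u_eq : forall z, D z ->
  conformal_laplacian (chart_metric c false) (u \o chart false) z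
  = mu * u (chart false z) `^ (yamabe_exp n - 1).
Hypothesis ineq : 2 * k%:R * `|c| < n%:R * (m%:R - 1).

Let U := u \o chart false.

Let n3 : (3 <= n)%N. Proof. by rewrite addSn ltnS (leq_trans m2)// leq_addl. Qed.

Let oD : open D := @open_chart_dom R c k m.
Let mD : measurable D := open_rV_measurable oD.

Let chart_model z : D z -> model c k m (chart false z).
Proof. by move=> Dz; split => //=; exact: sqnorm_stereo. Qed.

Let U_pos z : D z -> 0 < U z.
Proof. by move=> /chart_model/u_pos. Qed.

Let vE z : D z -> v (chart false z) = U z.
Proof. by move=> Dz; rewrite patchE mem_set//; exact: chart_model. Qed.

Let mv_ : measurable_fun setT v.
Proof. by have /set_mem := sub_Lfun_mfun u_Lp. Qed.

Lemma integral_model_volume (r : R) :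
  (\int[mv]_p (`|v p| `^ r)%:E = \int[leb]_(z in D) (vol c z * U z `^ r)%:E)%E.
Proof.
have mvd := measurable_funTS (D := D) (@measurable_volume_density R c k m false).
have vd0 z : 0 <= volume_density (@chart_metric R c k m false) z by exact: sqrtr_ge0.
rewrite (@ge0_integral_density _ _ _ _ R leb mv D (chart false)
  (volume_density (chart_metric c false)) mD (@measurable_chart R k m false) mvd vd0).
- apply: eq_integral => z; rewrite inE => Dz.
  by rewrite vE// volume_density_vol// -EFinM mulrC ger0_norm// ltW// U_pos.
- by [].
- by move=> p; rewrite lee_fin powR_ge0.
- apply/measurable_EFinP; apply: (measurableT_comp (measurable_powR _)).
  exact: measurableT_comp.
Qed.

Let measurable_superlevel (B : R) : measurable [set p | B < `|v p|].
Proof.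
rewrite -[X in measurable X]setTI.
have mn : measurable_fun setT (fun p => `|v p|) by exact: measurableT_comp.
rewrite (_ : [set p | B < _] = (fun p => `|v p|) @^-1` `]B, +oo[).
  by apply: mn => //; exact: measurable_itv.
by apply/seteqP; split=> p /=; rewrite in_itv/= andbT.
Qed.

(** The volume density is positive on [D], so a part of [D] that is null for the Riemannian volume
    is also null for Lebesgue measure. *)
Lemma ae_bounded : exists B0, {ae leb, forall z, D z -> U z <= B0}.
Proof.
have [B hB] : exists B : R, mv [set p | B < `|v p|] = 0%E.
  have := sub_Lfun_finLfun u_Linfty; rewrite inE /finite_norm /= unlock.
  case: ifPn => [_ h|].
    have [B hB] : exists B : R, (ess_sup mv (abse \o (EFin \o v)) <= B%:E)%E.
      move: h; case: (ess_sup _ _) => [r _|//|_]; first by exists r.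
      by exists 0; rewrite leNye.
    exists B; have /ess_supP[N [mN N0 hN]] := hB.
    apply/eqP; rewrite -measure_le0 -N0.
    apply: le_measure; rewrite ?inE//.
    move=> p /= hp; apply: hN => /=; rewrite lee_fin => hp2.
    by move: hp; rewrite ltNge hp2.
  (* The supremum norm is 0 by convention when the total volume is 0; in that case every superlevel
     set is null. *)
  rewrite -leNgt measure_le0 => /eqP h; exists 0; apply/eqP.
  by rewrite -measure_le0 -h; apply: le_measure; rewrite ?inE.
exists B; pose A := D `&` chart false @^-1` [set p | B < `|v p|].
have mA : measurable A.
  apply: measurableI => //; rewrite -[X in measurable X]setTI.
  by apply: (@measurable_chart R k m false).
have mvd := measurable_funTS (D := A) (@measurable_volume_density R c k m false).
have : ae_eq leb A (EFin \o volume_density (@chart_metric R c k m false)) (cst 0%E).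
  apply/ae_eq_integral_abs => //; first exact/measurable_EFinP.
  rewrite -[RHS]hB; apply: eq_integral => z _ /=.
  by rewrite ger0_norm// sqrtr_ge0.
apply: filterS => z hz Dz; rewrite leNgt; apply/negP => BU.
have Az : A z by split => //=; rewrite vE// gtr0_norm// U_pos.
have := hz Az => /= -[]; rewrite volume_density_vol// => V0.
by have := vol_gt0 Dz; rewrite V0 ltxx.
Qed.

Lemma model_square_integrable : v \in Lfun mv 2%:E.
Proof.
have n3R : 3 <= n%:R :> R by rewrite (ler_nat R 3).
have p0 : 0 < yamabe_exp n :> R.
  by rewrite /yamabe_exp divr_gt0 ?mulr_gt0//; lra.
have Ip : (\int[leb]_(z in D) (vol c z * (U z * U z `^ (yamabe_exp n - 1)))%:E < +oo)%E.
  have := sub_Lfun_finLfun u_Lp; rewrite inE /finite_norm /= => h.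
  rewrite [X in (X < _)%E](_ : _ = \int[mv]_p (`|v p| `^ yamabe_exp n)%:E)%E.
    rewrite [X in (X < _)%E](_ : _ =
      'N[mv]_(yamabe_exp n)%:E[EFin \o v] `^ (yamabe_exp n))%E.
      exact: poweR_lty.
    by rewrite poweR_Lnorm ?gt_eqF.
  rewrite integral_model_volume; apply: (@eq_integral _ _ _ leb D) => z /set_mem Dz.
  by rewrite mulr_powRB1// ltW// U_pos.
have [B0 UB] := ae_bounded.
have [b [de [kb b2 de0 kappa0]]] := decay_exponent m2 c1 ineq.
have I2 := square_integrable m2 u_smooth U_pos u_eq Ip UB kb b2 de0 kappa0.
rewrite inE; apply/andP; split; first by rewrite inE; exact: mv_.
rewrite inE /finite_norm /= unlock; apply: poweR_lty.
rewrite [X in (X < _)%E](_ : _ = \int[mv]_p (`|v p| `^ 2)%:E)%E//.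
rewrite integral_model_volume [X in (X < _)%E](_ : _ =
  \int[leb]_(z in D) (vol c z * U z ^+ 2)%:E)%E//.
apply: (@eq_integral _ _ _ leb D) => z /set_mem Dz.
by rewrite powR_mulrn// ltW// U_pos.
Qed.

End square_integrability.

Unset Implicit Arguments.

Theorem theorem3p1 (R : realType) (n k : nat) (hn : (3 <= n)%N)
    (hk : (k <= n - 3)%N) (c : R) (hc : -1 <= c <= 1)
    (u : 'rV[R]_k.+1 * 'rV[R]_(n - k - 1 + 1) -> R) (mu : R)
    (u_smooth : forall b : bool,
      smooth_on (chart_dom c k (n - k - 1)) (u \o chart b))
    (u_pos : forall p, model c k (n - k - 1) p -> 0 < u p)
    (u_Linfty : u \_ (model c k (n - k - 1))
      \in Lfun (model_volume c k (n - k - 1)) +oo%E)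
    (u_Lp : u \_ (model c k (n - k - 1))
      \in Lfun (model_volume c k (n - k - 1)) (yamabe_exp n)%:E)
    (u_eq : forall (b : bool) z, chart_dom c k (n - k - 1) z ->
      conformal_laplacian (chart_metric c b) (u \o chart b) z
      = mu * u (chart b z) `^ (yamabe_exp n - 1))
    (hineq : 2 * k%:R * `|c| < n%:R * (n%:R - k%:R - 2)) :
  u \_ (model c k (n - k - 1))
    \in Lfun (model_volume c k (n - k - 1)) 2%:E.
Proof.
have nE : n = (k.+1 + (n - k - 1))%N by lia.
have m2 : (2 <= n - k - 1)%N by lia.
apply: (@model_square_integrable R c k (n - k - 1) u mu) => //.
- by rewrite -nE.
- by move=> z Dz; rewrite u_eq// -nE.
- have nR : n%:R - k%:R - 2 = (n - k - 1)%:R - 1 :> R.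
    by rewrite [in LHS]nE natrD -natr1; ring.
  by rewrite -nR -nE.
Qed.
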